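(* Let $\mathcal{G}$ be an ultragraph and $R$ a unital commutative ring. Then there is an isomorphism of $R$-algebras $\kappa:L_R(\mathcal{G})\to A_R(\mathbb{F}\ltimes_\Delta\mathsf{T})$ given on the generators of $L_R(\mathcal{G})$ by $$\kappa(p_A)=1_{\{\omega\}\times V_{(\omega,A,\omega)}},\qquad \kappa(s_e)=1_{\{e\}\times V_{(e,r(e),e)}},\qquad \kappa(s_e^* )=1_{\{e^{-1}\}\times V_{(\omega,r(e),\omega)}}$$ for each $A\in\mathcal{G}^0$ and $e\in\mathcal{G}^1$.
   Context: Ultragraph. An ultragraph is a quadruple $\mathcal{G}=(G^0,\mathcal{G}^1,r,s)$ with $G^0,\mathcal{G}^1$ countable sets, $s:\mathcal{G}^1\to G^0$, $r:\mathcal{G}^1\to P(G^0)\setminus\{\emptyset\}$ ($P$ = power set). $\mathcal{G}^0\subseteq P(G^0)$ is the smallest family containing $\emptyset$, all $\{v\}$, all $r(e)$, and closed under finite unions and finite intersections. $\mathcal{B}$ is the smallest family containing $\mathcal{G}^0$ and closed under relative complements, finite unions and finite intersections. Leavitt path algebra. $L_R(\mathcal{G})$ is the universal (not necessarily unital) $R$-algebra with generators $\{s_e,s_e^*:e\in\mathcal{G}^1\}\cup\{p_A:A\in\mathcal{G}^0\}$ and relations: (1) $p_\emptyset=0$, $p_Ap_B=p_{A\cap B}$, $p_{A\cup B}=p_A+p_B-p_{A\cap B}$ for all $A,B\in\mathcal{G}^0$; (2) $p_{s(e)}s_e=s_ep_{r(e)}=s_e$ and $p_{r(e)}s_e^*=s_e^*p_{s(e)}=s_e^*$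 for $e\in\mathcal{G}^1$; (3) $s_e^*s_f=\delta_{e,f}p_{r(e)}$ for $e,f\in\mathcal{G}^1$; (4) $p_v=\sum_{s(e)=v}s_es_e^*$ whenever $0<|s^{-1}(v)|<\infty$. Here $p_v=p_{\{v\}}$. Paths. $\mathcal{L}^*$ consists of the empty word $\omega$ ($|\omega|=0$) and all words $e_1\cdots e_n$ ($n\ge1$) of edges with $s(e_{i+1})\in r(e_i)$; $\mathfrak{p}^\infty$ is the set of infinite paths. For $\alpha=e_1\cdots e_n$, $s(\alpha)=s(e_1)$, $r(\alpha)=r(e_n)$; $r(\omega)=G^0$. $\alpha_{1,n}$ is the beginning of $\alpha$ of length $n$. $\mathcal{B}_\alpha=\{A\in\mathcal{B}: A\subseteq r(\alpha)\}$. For $A\in\mathcal{B}$: $r(A,\omega)=A$; for $|\alpha|\ge1$, $r(A,\alpha)=r(\alpha)$ if $s(\alpha)\in A$ and $\emptyset$ otherwise. Tight spectrum. A filter in a poset with least element $0$ is a nonempty up-closed, down-directed subset not containing $0$; an ultrafilter is a maximal filter. $E(S)=\{(\alpha,A,\alpha):\alpha\in\mathcal{L}^*,\ \emptyset\ne A\in\mathcal{B}_\alpha\}\cup\{0\}$ is a meet semilattice with product $(\alpha,A,\alpha)(\beta,B,\beta)=(\beta,r(A,\gamma)\cap B,\beta)$ if $\beta=\alpha\gamma$ and $r(A,\gamma)\cap B\neq\emptyset$, symmetrically if $\alpha=\beta\gamma$, and $0$ otherwise; $p\le q$ iff $pq=p$. Filters in $E(S)$ carry the topology of pointwise convergence of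 their characteristic functions; $\mathsf{T}$ (tight filters) is the closure, in the space of all filters, of the set of ultrafilters, with the subspace topology. For $e\in E(S)$, $V_e=\{\xi\in\mathsf{T}:e\in\xi\}$; by convention $V_{(\alpha,\emptyset,\alpha)}=\emptyset$. Each filter $\xi$ in $E(S)$ has an associated word $\alpha\in\mathcal{L}^*\cup\mathfrak{p}^\infty$: the words occurring in nonzero elements of $\xi$ are exactly the finite beginnings of $\alpha$; $\xi_n=\{A\in\mathcal{B}:(\alpha_{1,n},A,\alpha_{1,n})\in\xi\}$. For each infinite path there is exactly one filter in $\mathsf{T}$ with it as associated word; a filter with finite word $\alpha$ is determined by the pair $(\alpha,\xi_{|\alpha|})$. Topological partial action $\Delta=(\{V_t\}_{t\in\mathbb{F}},\{\varphi_t\}_{t\in\mathbb{F}})$. $\mathbb{F}$ is the free group on $\mathcal{G}^1$, with identity $\omega$. $V_\omega=\mathsf{T}$, $\varphi_\omega=\mathrm{id}$. If $t\neq\omega$ has reduced form $t=\alpha\beta^{-1}$ with $\alpha,\beta\in\mathcal{L}^*$ and $r(\alpha)\cap r(\beta)\neq\emptyset$, then $V_t=V_{(\alpha,\,r(\alpha)\cap r(\beta),\,\alpha)}$ and $\varphi_t:V_{t^{-1}}\to V_t$ replaces the beginning $\beta$ by $\alpha$: if $\xi$ has infinite word $\beta\gamma$, $\varphi_t(\xi)$ is the tight filter with word $\alpha\gamma$; if $\xi$ has finite word $\beta\gamma$ with $|\gamma|\ge1$, $\varphi_t(\xi)$ is given by the pair $(\alpha\gamma,\xi_{|\beta\gamma|})$;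 if $\xi$ has word $\beta$, $\varphi_t(\xi)$ is given by $(\alpha,\{A\cap r(\alpha): A\in\mathcal{B},\ A\supseteq C\text{ for some }C\in\xi_{|\beta|}\})$. For all other $t$, $V_t=\emptyset$. Transformation groupoid. $\mathbb{F}\ltimes_\Delta\mathsf{T}=\{(t,\xi)\in\mathbb{F}\times\mathsf{T}:\xi\in V_t\}$ with range $\xi$, source $\varphi_{t^{-1}}(\xi)$ (units $(\omega,\xi)$ identified with $\xi$), product $(t,\xi)(u,\varphi_{t^{-1}}(\xi))=(tu,\xi)$, inverse $(t,\xi)^{-1}=(t^{-1},\varphi_{t^{-1}}(\xi))$, and topology inherited from $\mathbb{F}\times\mathsf{T}$ with $\mathbb{F}$ discrete; it is an ample Hausdorff groupoid. For an ample Hausdorff groupoid $\Gamma$, the Steinberg algebra $A_R(\Gamma)$ is the $R$-algebra of locally constant compactly supported functions $\Gamma\to R$ with convolution product. *)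

(* Defs.v *)
From HB Require Import structures.
From mathcomp Require Import all_boot all_algebra generic_quotient finmap.
From mathcomp Require Import all_classical.
From mathcomp Require Import topology numfun.

Set Implicit Arguments.
Unset Strict Implicit.
Unset Printing Implicit Defensive.

Import GRing.Theory.

Local Open Scope classical_set_scope.
Local Open Scope quotient_scope.
Local Open Scope ring_scope.

HB.mixin Record Lmodule_isNuAlgebra (R : comPzRingType) V
    of GRing.Lmodule R V := {
  numul : V -> V -> V;
  numulA : associative numul;
  numulDl : left_distributive numul +%R;
  numulDr : right_distributive numul +%R;
  numulZl : forall (a : R) (x y : V), numul (a *: x) y = a *: numul x y;
  numulZr : forall (a : R) (x y : V), numul x (a *: y) = a *: numul x y
}.

#[short(type="nuAlgType")]
HB.structure Definition NuAlgebra (R : comPzRingType) :=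
  { V of Lmodule_isNuAlgebra R V & GRing.Lmodule R V }.

Section Presentation.
Variables (R : comPzRingType) (X : Type).

Inductive nuterm : Type :=
  | TGen of X
  | TZero
  | TAdd of nuterm & nuterm
  | TOpp of nuterm
  | TScale of R & nuterm
  | TMul of nuterm & nuterm.

HB.instance Definition _ := gen_eqMixin nuterm.
HB.instance Definition _ := gen_choiceMixin nuterm.

Variable rel : nuterm -> nuterm -> Prop.

Inductive nucongr : nuterm -> nuterm -> Prop :=
  | NC_rel t u : rel t u -> nucongr t u
  | NC_refl t : nucongr t t
  | NC_sym t u : nucongr t u -> nucongr u t
  | NC_trans t u v : nucongr t u -> nucongr u v -> nucongr t v
  | NC_add t t' u u' : nucongr t t' -> nucongr u u' ->
      nucongr (TAdd t u) (TAdd t' u')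
  | NC_opp t t' : nucongr t t' -> nucongr (TOpp t) (TOpp t')
  | NC_scale a t t' : nucongr t t' -> nucongr (TScale a t) (TScale a t')
  | NC_mul t t' u u' : nucongr t t' -> nucongr u u' ->
      nucongr (TMul t u) (TMul t' u')
  | NC_addA t u v : nucongr (TAdd t (TAdd u v)) (TAdd (TAdd t u) v)
  | NC_addC t u : nucongr (TAdd t u) (TAdd u t)
  | NC_add0 t : nucongr (TAdd TZero t) t
  | NC_addN t : nucongr (TAdd (TOpp t) t) TZero
  | NC_scaleA a b t : nucongr (TScale a (TScale b t)) (TScale (a * b) t)
  | NC_scale1 t : nucongr (TScale 1 t) t
  | NC_scaleDr a t u :
      nucongr (TScale a (TAdd t u)) (TAdd (TScale a t) (TScale a u))
  | NC_scaleDl a b t :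
      nucongr (TScale (a + b) t) (TAdd (TScale a t) (TScale b t))
  | NC_mulA t u v : nucongr (TMul t (TMul u v)) (TMul (TMul t u) v)
  | NC_mulDl t u v : nucongr (TMul (TAdd t u) v) (TAdd (TMul t v) (TMul u v))
  | NC_mulDr t u v : nucongr (TMul t (TAdd u v)) (TAdd (TMul t u) (TMul t v))
  | NC_mulZl a t u : nucongr (TMul (TScale a t) u) (TScale a (TMul t u))
  | NC_mulZr a t u : nucongr (TMul t (TScale a u)) (TScale a (TMul t u)).

Definition nucongrb (t u : nuterm) : bool := `[< nucongr t u >].

Lemma nucongrb_refl : reflexive nucongrb.
Proof. by move=> t; apply/asboolP; apply: NC_refl. Qed.

Lemma nucongrb_sym : symmetric nucongrb.
Proof. by move=> t u; apply/asboolP/asboolP; apply: NC_sym. Qed.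

Lemma nucongrb_trans : transitive nucongrb.
Proof.
by move=> u t v /asboolP tu /asboolP uv; apply/asboolP; apply: NC_trans tu uv.
Qed.

Canonical nucongr_equiv :=
  EquivRel nucongrb nucongrb_refl nucongrb_sym nucongrb_trans.

Definition presented : Type := {eq_quot nucongr_equiv}.

HB.instance Definition _ := Choice.on presented.
HB.instance Definition _ := EqQuotient.on presented.

Lemma presentedP (t u : nuterm) :
  (\pi_presented t = \pi_presented u) <-> nucongr t u.
Proof.
by split=> [/eqmodP/asboolP //|tu]; apply/eqmodP/asboolP.
Qed.

Lemma repr_congr t : nucongr (repr (\pi_presented t)) t.
Proof. by apply/presentedP; rewrite reprK. Qed.

Local Notation pi := (\pi_presented).

Let add (x y : presented) := pi (TAdd (repr x) (repr y)).
Let opp (x : presented) := pi (TOpp (repr x)).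
Let scale (a : R) (x : presented) := pi (TScale a (repr x)).
Let mul (x y : presented) := pi (TMul (repr x) (repr y)).

Let piD t u : add (pi t) (pi u) = pi (TAdd t u).
Proof. by apply/presentedP; apply: NC_add; apply: repr_congr. Qed.
Let piN t : opp (pi t) = pi (TOpp t).
Proof. by apply/presentedP; apply: NC_opp; apply: repr_congr. Qed.
Let piZ a t : scale a (pi t) = pi (TScale a t).
Proof. by apply/presentedP; apply: NC_scale; apply: repr_congr. Qed.
Let piM t u : mul (pi t) (pi u) = pi (TMul t u).
Proof. by apply/presentedP; apply: NC_mul; apply: repr_congr. Qed.

Let addA : associative add.
Proof.
elim/quotW=> t; elim/quotW=> u; elim/quotW=> v.
by rewrite (piD u v) (piD t u) !piD; apply/presentedP/NC_addA.
Qed.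
Let addC : commutative add.
Proof.
by elim/quotW=> t; elim/quotW=> u; rewrite !piD; apply/presentedP/NC_addC.
Qed.
Let add0 : left_id (pi TZero) add.
Proof. by elim/quotW=> t; rewrite piD; apply/presentedP/NC_add0. Qed.
Let addN : left_inverse (pi TZero) opp add.
Proof. by elim/quotW=> t; rewrite piN piD; apply/presentedP/NC_addN. Qed.

HB.instance Definition _ :=
  GRing.isZmodule.Build presented addA addC add0 addN.

Let addE (x y : presented) : x + y = add x y. Proof. by []. Qed.

Let scaleA a b (x : presented) : scale a (scale b x) = scale (a * b) x.
Proof.
by elim/quotW: x => t; rewrite (piZ b t) !piZ; apply/presentedP/NC_scaleA.
Qed.
Let scale1 : left_id 1 scale.
Proof. by elim/quotW=> t; rewrite piZ; apply/presentedP/NC_scale1. Qed.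
Let scaleDr : right_distributive scale +%R.
Proof.
move=> a; elim/quotW=> t; elim/quotW=> u.
rewrite !addE (piD t u) (piZ a (TAdd t u)) (piZ a t) (piZ a u) piD.
exact/presentedP/NC_scaleDr.
Qed.
Let scaleDl (x : presented) : {morph scale^~ x : a b / a + b}.
Proof.
move=> a b; elim/quotW: x => t; rewrite addE (piZ (a + b) t) (piZ a t) (piZ b t) piD.
exact/presentedP/NC_scaleDl.
Qed.

HB.instance Definition _ :=
  GRing.Zmodule_isLmodule.Build R presented scaleA scale1 scaleDr scaleDl.

Let scaleE a (x : presented) : a *: x = scale a x. Proof. by []. Qed.

Let mulA : associative mul.
Proof.
elim/quotW=> t; elim/quotW=> u; elim/quotW=> v.
by rewrite (piM u v) (piM t u) !piM; apply/presentedP/NC_mulA.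
Qed.
Let mulDl : left_distributive mul +%R.
Proof.
elim/quotW=> t; elim/quotW=> u; elim/quotW=> v.
rewrite !addE (piD t u) (piM (TAdd t u) v) (piM t v) (piM u v) piD.
exact/presentedP/NC_mulDl.
Qed.
Let mulDr : right_distributive mul +%R.
Proof.
elim/quotW=> t; elim/quotW=> u; elim/quotW=> v.
rewrite !addE (piD u v) (piM t (TAdd u v)) (piM t u) (piM t v) piD.
exact/presentedP/NC_mulDr.
Qed.
Let mulZl (a : R) (x y : presented) : mul (a *: x) y = a *: mul x y.
Proof.
elim/quotW: x => t; elim/quotW: y => u.
rewrite !scaleE (piZ a t) (piM (TScale a t) u) (piM t u) piZ.
exact/presentedP/NC_mulZl.
Qed.
Let mulZr (a : R) (x y : presented) : mul x (a *: y) = a *: mul x y.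
Proof.
elim/quotW: x => t; elim/quotW: y => u.
rewrite !scaleE (piZ a u) (piM t (TScale a u)) (piM t u) piZ.
exact/presentedP/NC_mulZr.
Qed.

HB.instance Definition _ :=
  Lmodule_isNuAlgebra.Build R presented mulA mulDl mulDr mulZl mulZr.

Definition pgen (x : X) : presented := pi (TGen x).

Section Evaluation.
Variables (A : nuAlgType R) (f : X -> A).

Fixpoint nueval (t : nuterm) : A :=
  match t with
  | TGen x => f x
  | TZero => 0
  | TAdd t u => nueval t + nueval u
  | TOpp t => - nueval t
  | TScale a t => a *: nueval t
  | TMul t u => numul (nueval t) (nueval u)
  end.

Hypothesis f_rel : forall t u, rel t u -> nueval t = nueval u.

Lemma nueval_congr t u : nucongr t u -> nueval t = nueval u.
Proof.
elim=> //=.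
- by move=> v w x _ -> _ ->.
- by move=> v v' w w' _ -> _ ->.
- by move=> v w _ ->.
- by move=> a v w _ ->.
- by move=> v v' w w' _ -> _ ->.
- by move=> *; rewrite addrA.
- by move=> *; rewrite addrC.
- by move=> *; rewrite add0r.
- by move=> *; rewrite addNr.
- by move=> *; rewrite scalerA.
- by move=> *; rewrite scale1r.
- by move=> *; rewrite scalerDr.
- by move=> *; rewrite scalerDl.
- by move=> *; rewrite numulA.
- by move=> *; rewrite numulDl.
- by move=> *; rewrite numulDr.
- by move=> *; rewrite numulZl.
- by move=> *; rewrite numulZr.
Qed.

Lemma presented_universal : exists! h : presented -> A,
  [/\ linear h, {morph h : x y / numul x y} & forall x, h (pgen x) = f x].
Proof.
have piE t : nueval (repr (pi t)) = nueval t.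
  exact/nueval_congr/repr_congr.
exists (fun x => nueval (repr x)); split; first split.
- move=> a x y; rewrite [a *: x + y]/(add (scale a x) y) piE /=.
  by rewrite [scale a x]/(scale a x) piE.
- by move=> x y; rewrite [numul x y]/(mul x y) piE.
- by move=> x; rewrite piE.
move=> h [hL hM hf]; apply/funext => x; rewrite -[in RHS](reprK x).
have h0 : h 0 = 0.
  by have := hL (-1) 0 0; rewrite scaleN1r oppr0 addr0 scaleN1r addNr.
have hD y z : h (y + z) = h y + h z by have := hL 1 y z; rewrite !scale1r.
have hZ a y : h (a *: y) = a *: h y.
  by have := hL a y 0; rewrite !addr0 h0 addr0.
elim: (repr x) => /= [t||t -> u ->|t ->|a t ->|t -> u ->].
- by rewrite -hf.
- by rewrite -[pi TZero]/(0 : presented) h0.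
- by rewrite -piD -addE hD.
- by rewrite -piN -[opp _]/(- pi t) -(scaleN1r (pi t)) hZ scaleN1r.
- by rewrite -piZ -scaleE hZ.
- by rewrite -piM -[mul _ _]/(numul (pi t) (pi u)) hM.
Qed.

End Evaluation.
End Presentation.

Section FreeGroup.
Variable T : choiceType.

(* [(e, true)] stands for the generator [e] and [(e, false)] for its
   inverse. *)
Definition letter : Type := (T * bool)%type.
HB.instance Definition _ := Choice.on letter.

Definition linv (x : letter) : letter := (x.1, ~~ x.2).

Definition reduced (w : seq letter) : bool :=
  sorted [rel x y | y != linv x] w.

Record freeGroup : Type := FreeGroup {
  fgword : seq letter;
  _ : reduced fgword
}.

HB.instance Definition _ := [isSub for fgword].
HB.instance Definition _ := [Choice of freeGroup by <:].

Lemma linvK : involutive linv.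
Proof. by case=> x b; rewrite /linv /= negbK. Qed.

Lemma linv_neq x : (x != linv x) /\ (linv x != x).
Proof. by case: x => x []; rewrite !xpair_eqE eqxx. Qed.

Definition lcons (x : letter) (w : seq letter) : seq letter :=
  if w is y :: w' then if y == linv x then w' else x :: w else [:: x].

Definition wmul (u v : seq letter) : seq letter := foldr lcons v u.

Definition winv (w : seq letter) : seq letter := rev (map linv w).

Lemma reduced_behead x w : reduced (x :: w) -> reduced w.
Proof. exact: path_sorted. Qed.

Lemma lcons_reduced x w : reduced w -> reduced (lcons x w).
Proof.
case: w => //= y w rw; case: ifPn => [_|yx /=]; last by rewrite yx.
exact: path_sorted rw.
Qed.

Lemma wmul_reduced u v : reduced v -> reduced (wmul u v).
Proof. by move=> rv; elim: u => //= x u; apply: lcons_reduced. Qed.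

Lemma lconsK x w : reduced w -> lcons (linv x) (lcons x w) = w.
Proof.
case: w => [|y w] /=; first by rewrite linvK eqxx.
case: eqP => [->|_] /=; last by rewrite linvK eqxx.
by case: w => //= z w /andP[zx _]; rewrite (negPf zx).
Qed.

Lemma wmul_lcons x u v : reduced v -> wmul (lcons x u) v = lcons x (wmul u v).
Proof.
case: u => //= y u rv; case: eqP => //= ->.
by rewrite -{1}[x]linvK lconsK //; apply: wmul_reduced.
Qed.

Lemma wmulA u v w : reduced w -> wmul u (wmul v w) = wmul (wmul u v) w.
Proof. by move=> rw; elim: u => //= x u ->; rewrite wmul_lcons. Qed.

Lemma wmulw0 u : reduced u -> wmul u [::] = u.
Proof.
elim: u => //= x u IH rxu; rewrite IH ?(reduced_behead rxu) //.
by case: u rxu {IH} => //= y u /andP[/negPf->].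
Qed.

Lemma wmulVw u w : reduced w -> wmul (winv u) (wmul u w) = w.
Proof.
elim: u w => //= x u IH w rw.
rewrite /winv /= rev_cons -cats1 /wmul foldr_cat /= lconsK; last exact: wmul_reduced.
exact: IH.
Qed.

Lemma winvK : involutive winv.
Proof.
by move=> w; rewrite /winv map_rev revK mapK //; apply: linvK.
Qed.

Lemma winv_reduced w : reduced w -> reduced (winv w).
Proof.
rewrite /winv /reduced rev_sorted sorted_map; apply: sub_sorted => x y /=.
by rewrite linvK eq_sym.
Qed.

Lemma reducedP (t : freeGroup) : reduced (fgword t).
Proof. by case: t. Qed.

Definition fg_one : freeGroup := @FreeGroup [::] isT.
Definition fg_mul (t u : freeGroup) : freeGroup :=
  FreeGroup (wmul_reduced (fgword t) (reducedP u)).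
Definition fg_inv (t : freeGroup) : freeGroup :=
  FreeGroup (winv_reduced (reducedP t)).

Lemma fg_mulA : associative fg_mul.
Proof.
by move=> t u v; apply: val_inj; rewrite /= wmulA //; apply: reducedP.
Qed.
Lemma fg_mul1 : left_id fg_one fg_mul.
Proof. by move=> t; apply: val_inj. Qed.
Lemma fg_1mul : right_id fg_one fg_mul.
Proof. by move=> t; apply: val_inj; apply/wmulw0/reducedP. Qed.
Lemma fg_mulV : left_inverse fg_one fg_inv fg_mul.
Proof.
move=> t; apply: val_inj; rewrite /= -[X in wmul _ X](wmulw0 (reducedP t)).
exact: wmulVw.
Qed.
Lemma fg_Vmul : right_inverse fg_one fg_inv fg_mul.
Proof.
move=> t; have tVV : fg_inv (fg_inv t) = t by apply/val_inj/winvK.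
by rewrite -{1}tVV fg_mulV.
Qed.

HB.instance Definition _ :=
  isGroup.Build freeGroup fg_mulA fg_mul1 fg_1mul fg_mulV fg_Vmul.

HB.instance Definition _ := hasNbhs.Build freeGroup principal_filter.
HB.instance Definition _ := Discrete_ofNbhs.Build freeGroup erefl.

Definition fggen (e : T) : freeGroup := @FreeGroup [:: (e, true)] isT.

End FreeGroup.

Section PosetFilters.
Variables (T : Type) (le : T -> T -> Prop) (zero : T).

Definition poset_filter (F : set T) : Prop :=
  [/\ F !=set0,
      forall x y, F x -> le x y -> F y,
      forall x y, F x -> F y -> exists z, [/\ F z, le z x & le z y]
    & ~ F zero].

Definition poset_ultrafilter (F : set T) : Prop :=
  poset_filter F /\ forall F', poset_filter F' -> F `<=` F' -> F' = F.

End PosetFilters.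

Record ultragraph : Type := Ultragraph {
  vertex : countType;
  edge : countType;
  src : edge -> vertex;
  rng : edge -> set vertex;
  rng_neq0 : forall e, rng e !=set0
}.

Section Ultragraph.
Variable G : ultragraph.
Local Notation vertex := (vertex G).
Local Notation edge := (edge G).

(* [gvset] is the calligraphic G^0 of the literature, whose elements index the
   projections; [bset] is its closure under relative complements. *)
Inductive gvset : set (set vertex) :=
  | gvset0 : gvset set0
  | gvset1 v : gvset [set v]
  | gvset_rng e : gvset (rng e)
  | gvsetU A B : gvset A -> gvset B -> gvset (A `|` B)
  | gvsetI A B : gvset A -> gvset B -> gvset (A `&` B).

Inductive bset : set (set vertex) :=
  | bset_gv A : gvset A -> bset A
  | bsetD A B : bset A -> bset B -> bset (A `\` B)
  | bsetU A B : bset A -> bset B -> bset (A `|` B)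
  | bsetI A B : bset A -> bset B -> bset (A `&` B).

Definition is_path (al : seq edge) : bool :=
  sorted [rel e f | src f \in rng e] al.

Definition is_infpath (p : nat -> edge) : Prop :=
  forall n, rng (p n) (src (p n.+1)).

Definition prange (al : seq edge) : set vertex :=
  if al is e :: al' then rng (last e al') else setT.

Definition relrange (A : set vertex) (al : seq edge) : set vertex :=
  if al is e :: _ then [set v | A (src e) /\ prange al v] else A.

Fixpoint cat_inf (al : seq edge) (p : nat -> edge) : nat -> edge :=
  if al is e :: al' then
    fun n => if n is m.+1 then cat_inf al' p m else e
  else p.

Definition es_valid (x : seq edge * set vertex) : Prop :=
  [/\ is_path x.1, bset x.2, x.2 !=set0 & x.2 `<=` prange x.1].

(* [None] is the zero element. *)
Definition ES : Type := option {x : seq edge * set vertex | es_valid x}.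

(* [es al A] is [(al, A, al)], read as zero if [A] is empty; so [V_ (es al A)]
   below is then empty, since filters do not contain zero. *)
Definition es (al : seq edge) (A : set vertex) : ES :=
  if pselect (es_valid (al, A)) is left h then Some (exist _ (al, A) h)
  else None.

(* Hence [es_mul] below yields zero only for empty intersections or
   incomparable words. *)
Lemma es_valid_mul al A be B :
  es_valid (al, A) -> es_valid (be, B) ->
  relrange A (drop (size al) be) `&` B !=set0 ->
  es_valid (be, relrange A (drop (size al) be) `&` B).
Proof.
move=> [_ /= bA _ _] [pbe /= bB _ sB] ne; split=> //=; last first.
  by move=> v [_ /sB].
apply: bsetI => //; case: (drop _ _) => //= e ga.
have [Ae|nAe] := pselect (A (src e)).
  have -> : [set v | A (src e) /\ rng (last e ga) v] = rng (last e ga).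
    by apply/seteqP; split=> [v []|v].
  exact/bset_gv/gvset_rng.
have -> : [set v | A (src e) /\ rng (last e ga) v] = set0.
  by apply/seteqP; split=> [v []|v].
exact/bset_gv/gvset0.
Qed.

Definition es_mul (x y : ES) : ES :=
  if x is Some (exist (al, A) _) then
    if y is Some (exist (be, B) _) then
      if prefix al be then es be (relrange A (drop (size al) be) `&` B)
      else if prefix be al then
        es al (relrange B (drop (size be) al) `&` A)
      else None
    else None
  else None.

Definition es_le (x y : ES) : Prop := es_mul x y = x.

(* A filter is represented by its characteristic function. *)
Definition filters : set {ptws ES -> bool} :=
  [set chi | poset_filter es_le None [set x | chi x]].

Definition filterSpace : topologicalType := set_type filters.

Definition fset_of (xi : filterSpace) : set ES := [set x | set_val xi x].

Definition ultrafilters : set filterSpace :=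
  [set xi | poset_ultrafilter es_le None (fset_of xi)].

Definition tight : topologicalType := set_type (closure ultrafilters).

Definition tset (xi : tight) : set ES := fset_of (set_val xi).

Definition V_ (x : ES) : set tight := [set xi | tset xi x].

Definition occurs (xi : tight) (al : seq edge) : Prop :=
  exists A, es_valid (al, A) /\ tset xi (es al A).

Definition has_word (xi : tight) (al : seq edge) : Prop :=
  is_path al /\ forall be, occurs xi be <-> prefix be al.

Definition has_infword (xi : tight) (p : nat -> edge) : Prop :=
  is_infpath p /\ forall be, occurs xi be <-> be = mkseq p (size be).

(* [fiber xi al] is [xi_n], for [al] the beginning of length [n] of the word
   of [xi]. *)
Definition fiber (xi : tight) (al : seq edge) : set (set vertex) :=
  [set A | bset A /\ tset xi (es al A)].

Definition reduced_form (t : freeGroup edge) (al be : seq edge) : Prop :=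
  [/\ is_path al, is_path be, prange al `&` prange be !=set0 &
      fgword t = [seq (e, true) | e <- al] ++ [seq (e, false) | e <- rev be]].

Definition pa_dom (t : freeGroup edge) : set tight :=
  [set xi | t = 1%g \/ exists al be, [/\ t <> 1%g, reduced_form t al be &
    V_ (es al (prange al `&` prange be)) xi]].

(* For [t] nontrivial, the graph of the partial map of index [t], which goes
   from [pa_dom t^-1] to [pa_dom t]. A tight filter is determined by its word if
   this is infinite, and by its word and last fiber otherwise, so there is only
   one such [eta]. *)
Definition pa_graph (t : freeGroup edge) (xi eta : tight) : Prop :=
  pa_dom t^-1%g xi /\ exists al be, reduced_form t al be /\
  [\/ exists ga, has_infword xi (cat_inf be ga) /\
                 has_infword eta (cat_inf al ga),
      exists ga, [/\ ga <> [::], has_word xi (be ++ ga),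
                     has_word eta (al ++ ga) &
                     fiber eta (al ++ ga) = fiber xi (be ++ ga)]
    | [/\ has_word xi be, has_word eta al &
          fiber eta al = [set A `&` prange al | A in
            [set A | bset A /\ exists2 C, fiber xi be C & C `<=` A]]]].

(* [xi] itself is a dummy value outside the domain of the partial map. *)
Definition pa_map (t : freeGroup edge) (xi : tight) : tight :=
  if t == 1%g then xi else xget xi [set eta | pa_graph t xi eta].

Definition transf : topologicalType :=
  set_type [set x : freeGroup edge * tight | pa_dom x.1 x.2].

Definition tr_grp (g : transf) : freeGroup edge := (set_val g).1.
Definition tr_range (g : transf) : tight := (set_val g).2.
Definition tr_source (g : transf) : tight :=
  pa_map (tr_grp g)^-1%g (tr_range g).

(* [tr_mul g h k] means that [g] and [h] are composable with product [k]. *)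
Definition tr_mul (g h k : transf) : Prop :=
  [/\ tr_source g = tr_range h, tr_grp k = (tr_grp g * tr_grp h)%g &
      tr_range k = tr_range g].

Definition slice (t : freeGroup edge) (x : ES) : set transf :=
  [set g | tr_grp g = t /\ V_ x (tr_range g)].

End Ultragraph.

Section Leavitt.
Variables (R : comPzRingType) (G : ultragraph).

Definition gvtype : Type := {A : set (vertex G) | gvset A}.

Definition gv0 : gvtype := exist _ set0 (gvset0 G).
Definition gv1 (v : vertex G) : gvtype := exist _ [set v] (gvset1 v).
Definition gvr (e : edge G) : gvtype := exist _ (rng e) (gvset_rng e).
Definition gvU (A B : gvtype) : gvtype :=
  exist _ (sval A `|` sval B) (gvsetU (svalP A) (svalP B)).
Definition gvI (A B : gvtype) : gvtype :=
  exist _ (sval A `&` sval B) (gvsetI (svalP A) (svalP B)).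

Inductive leavitt_gen : Type :=
  | Gen_p of gvtype
  | Gen_s of edge G
  | Gen_ss of edge G.

Local Notation term := (nuterm R leavitt_gen).
Local Notation p A := (TGen R (Gen_p A)).
Local Notation s e := (TGen R (Gen_s e)).
Local Notation ss e := (TGen R (Gen_ss e)).
Local Notation zero := (TZero R leavitt_gen).

Inductive leavitt_rel : term -> term -> Prop :=
  | L_p0 : leavitt_rel (p gv0) zero
  | L_pI A B : leavitt_rel (TMul (p A) (p B)) (p (gvI A B))
  | L_pU A B : leavitt_rel (p (gvU A B))
      (TAdd (TAdd (p A) (p B)) (TOpp (p (gvI A B))))
  | L_srcs e : leavitt_rel (TMul (p (gv1 (src e))) (s e)) (s e)
  | L_srng e : leavitt_rel (TMul (s e) (p (gvr e))) (s e)
  | L_rngss e : leavitt_rel (TMul (p (gvr e)) (ss e)) (ss e)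
  | L_sssrc e : leavitt_rel (TMul (ss e) (p (gv1 (src e)))) (ss e)
  | L_sss e : leavitt_rel (TMul (ss e) (s e)) (p (gvr e))
  | L_sss0 e f : e <> f -> leavitt_rel (TMul (ss e) (s f)) zero
  | L_emit v : [set e | src e = v] !=set0 -> finite_set [set e | src e = v] ->
      leavitt_rel (p (gv1 v))
        (\big[@TAdd R leavitt_gen/zero]_(e <- fset_set [set e | src e = v])
            TMul (s e) (ss e)).

Definition leavitt : nuAlgType R := presented leavitt_rel.

Definition leavitt_p (A : gvtype) : leavitt := pgen leavitt_rel (Gen_p A).
Definition leavitt_s (e : edge G) : leavitt := pgen leavitt_rel (Gen_s e).
Definition leavitt_ss (e : edge G) : leavitt := pgen leavitt_rel (Gen_ss e).

End Leavitt.

Section Steinberg.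
Variables (R : comPzRingType) (Gam : topologicalType).

Definition locally_constant (f : Gam -> R) : Prop :=
  forall x, \forall y \near x, f y = f x.

(* The support of a locally constant function is closed, hence no closure
   below. *)
Definition steinberg_pred : {pred Gam -> R^o} :=
  fun f => `[< locally_constant f /\ compact [set x | f x != 0] >].

Lemma closed_support (f : Gam -> R) :
  locally_constant f -> closed [set x | f x != 0].
Proof.
move=> lf x clx; have [y [/= fy0 fyx]] := clx _ (lf x).
by rewrite /= -fyx.
Qed.

Lemma steinberg_submod : submod_closed steinberg_pred.
Proof.
split=> [|a f g /asboolP[lf cf] /asboolP[lg cg]].
  apply/asboolP; split; first by move=> x; near=> y.
  suff -> : [set x : Gam | (0 : Gam -> R^o) x != 0] = set0 by exact: compact0.
  by apply/seteqP; split=> x //=; rewrite eqxx.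
have hE x : (a *: f + g : Gam -> R^o) x = a * f x + g x by [].
have lh : locally_constant (a *: f + g : Gam -> R^o).
  move=> x; near=> y; rewrite !hE.
  by congr (_ * _ + _); [near: y; exact: lf|near: y; exact: lg].
apply/asboolP; split=> //.
apply: (subclosed_compact (closed_support lh) (compactU cf cg)) => x /= hx.
have [fx0|fx0] := eqVneq (f x) 0; last by left.
right; apply: contraNneq hx => gx0.
by rewrite hE fx0 gx0 mulr0 addr0.
Unshelve. all: by end_near.
Qed.

HB.instance Definition _ :=
  GRing.isSubmodClosed.Build R (Gam -> R^o) steinberg_pred steinberg_submod.

Record steinberg : Type := Steinberg {
  steinberg_fun :> Gam -> R^o;
  _ : steinberg_fun \in steinberg_pred
}.

HB.instance Definition _ := [isSub for steinberg_fun].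
HB.instance Definition _ := [Choice of steinberg by <:].
HB.instance Definition _ := [SubChoice_isSubLmodule of steinberg by <:].

(* [mul g h k] is to be read: [g] and [h] are composable with product [k].
   For functions in [steinberg] over an ample Hausdorff groupoid, the sum has
   finitely many nonzero terms. *)
Definition convolution (mul : Gam -> Gam -> Gam -> Prop) (f g : Gam -> R)
    (k : Gam) : R :=
  \sum_(q \in [set q : Gam * Gam | mul q.1 q.2 k]) (f q.1 * g q.2).

End Steinberg.

(* Main.v *)
From HB Require Import structures.
Require Import Defs.
From mathcomp Require Import all_boot all_algebra generic_quotient finmap.
From mathcomp Require Import all_classical topology numfun.

Set Implicit Arguments.
Unset Strict Implicit.
Unset Printing Implicit Defensive.

Import GRing.Theory.

Local Open Scope classical_set_scope.
Local Open Scope quotient_scope.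
Local Open Scope ring_scope.

(** The isomorphism is obtained without making the Steinberg algebra into an
    algebra first. Each generator of [leavitt R G] acts on the functions on
    [F x T], where [F] is the free group on the edges and [T] the tight
    spectrum: [p_A] multiplies by the indicator of [V_(omega,A,omega)], while
    [s_e] and [s_e^*] pull back along the maps that delete or prepend the edge [e]
    in a tight filter and translate the component in [F] ([rep_gen]). The
    relations hold ([rep_rel]); two of them use tightness, namely
    [p_(A U B) = p_A + p_B - p_(A I B)], because ultrafilters are prime
    ([ultra_prime]), and the relation at a vertex emitting finitely many
    edges, because an ultrafilter does not stop at a vertex that emits
    ([ultra_emit]). Letting [x] act on the indicator of the units gives a
    function [kap x] on [F x T].

    The algebra is spanned by the monomials [s_al p_A s_be^*]
    ([leavitt_spanned]), and [kap] sends such a monomial to the indicator of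
    [{t} x V] with [t = al be^-1] ([kap_mon]). This set lies in the groupoid,
    where the monomial acts by the partial map of index [t^-1] ([mon_pa]); the
    point is that this map deletes [al] and prepends [be], whatever the shape
    of the word of the filter ([pa_map_ups]). Hence [kap x] restricts to a
    compactly supported locally constant function, and the action of [x] is
    convolution by that function ([kappa_convolution]), which gives
    multiplicativity.

    For injectivity ([kapr_inj]), the values of [kap x] at different group
    elements come from the parts of [x] of different degrees, and a part of
    degree [al be^-1], in reduced form, is [s_al y s_be^*] with [y] a combination
    of diagonal elements [s_ga p_A s_ga^*] ([homogeneous_inj]). For such [y] the
    claim is proved by induction on the length of the words ([diag_inj]). The
    sets [A] and the sources of the words split [y] into finitely many pieces.
    On each piece either only a constant is left, and there is an ultrafilter to
    evaluate it at, or the piece is a single vertex [v]. There one splits further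
    by first edges: the part avoiding these edges either vanishes by the relation
    at [v] or is again a constant seen by an ultrafilter, and the other parts
    have shorter words ([affine_vertex]).

    For surjectivity ([kapr_surj]), the image contains the indicators of
    arbitrarily small neighborhoods [{t} x U] of each point, and it stays stable
    when its elements are cut by such a set [U] or by its complement. A
    compactly supported locally constant function is a finite combination of
    disjoint pieces of this kind. *)

(** * Filters of the semilattice of words *)

Section PathFilters.
Variable G : ultragraph.
Local Notation path := (seq (edge G)).
Implicit Types (F : set (ES G)) (al be ga : path) (A B : set (vertex G)).

Lemma cat_injr al : injective (cat al).
Proof. by move=> x y; elim: al => //= e al IH [/IH]. Qed.

Lemma prange_cat al e ga : prange (al ++ e :: ga) = prange (e :: ga).
Proof. by case: al => //= f al; rewrite last_cat. Qed.

Lemma is_path_cat al e ga :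
  is_path (al ++ e :: ga) = [&& is_path al, src e \in prange al & is_path (e :: ga)].
Proof.
case: al => [|f al] /=; first by rewrite in_setT.
by rewrite /is_path /= cat_path /=.
Qed.

Lemma is_path_catl al ga : is_path (al ++ ga) -> is_path al.
Proof. by case: ga => [|e ga]; rewrite ?cats0 // is_path_cat => /and3P[]. Qed.

Lemma is_path_catr al ga : is_path (al ++ ga) -> is_path ga.
Proof. by case: ga => [|e ga]; rewrite ?cats0 // is_path_cat => /and3P[]. Qed.

Lemma bset_prange al : al <> [::] -> bset (prange al).
Proof. by case: al => // e al _; apply/bset_gv/gvset_rng. Qed.

Lemma bset_prangeI A al : bset A -> bset (A `&` prange al).
Proof.
case: al => [|e al] bA /=; first by rewrite setIT.
exact/bsetI/bset_gv/gvset_rng.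
Qed.

Lemma esE al A (h : es_valid (al, A)) : es al A = Some (exist _ (al, A) h).
Proof.
rewrite /es; case: pselect => // h'; congr (Some (exist _ _ _)).
exact: Prop_irrelevance.
Qed.

Lemma esN al A : ~ es_valid (al, A) -> es al A = None.
Proof. by rewrite /es; case: pselect. Qed.

Lemma es_neqN al A : es al A <> None -> es_valid (al, A).
Proof. by rewrite /es; case: pselect. Qed.

Variant es_spec : ES G -> Prop :=
  | EsZero : es_spec None
  | EsElem al A of es_valid (al, A) : es_spec (es al A).

Lemma esP x : es_spec x.
Proof.
case: x => [[[al A] h]|]; last exact: EsZero.
by rewrite -esE; apply: EsElem.
Qed.

Lemma es_inj al A be B : es_valid (al, A) -> es al A = es be B ->
  al = be /\ A = B.
Proof.
move=> h; rewrite (esE h) /es; case: pselect => // h' E.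
by case: E.
Qed.

Lemma es_leP al A be B : es_valid (al, A) -> es_valid (be, B) ->
  es_le (es al A) (es be B) <->
  exists2 ga, al = be ++ ga & A `<=` relrange B ga.
Proof.
move=> hA hB; rewrite /es_le (esE hA) (esE hB) /= -(esE hA).
have sI C : A `<=` C -> C `&` A = A by move=> /setIidPr.
have sI' C : C `&` A = A -> A `<=` C by move=> /setIidPr.
split.
  case: ifPn => [/prefixP[ga ->]|_].
    rewrite drop_size_cat // => /esym/(es_inj hA)[E AE].
    have /size0nil ga0 : size ga = 0%N.
      by apply/eqP; rewrite -(eqn_add2l (size al)) addn0 -size_cat -E.
    exists [::]; first by rewrite ga0 cats0 cats0.
    by move: AE; rewrite ga0 /= => ->; apply: subIsetr.
  case: ifPn => [/prefixP[ga E]|_]; last by rewrite (esE hA).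
  rewrite {2}E drop_size_cat // => /esym/(es_inj hA)[_ AE]; exists ga => //.
  by rewrite AE; apply: subIsetl.
move=> [ga E sA].
case: ifPn => [/prefixP[de E']|_].
  have /size0nil ga0 : size ga = 0%N.
    have := congr1 size E; rewrite E' !size_cat -addnA => /eqP.
    by rewrite -{1}[size al]addn0 eqn_add2l eq_sym addn_eq0 => /andP[_ /eqP].
  move: E E' sA; rewrite ga0 cats0 => <- E' /= sA.
  rewrite drop_size /=; congr es.
  exact/setIidPl.
have -> : prefix be al by rewrite E prefix_prefix.
by rewrite {2}E drop_size_cat // sI.
Qed.

Lemma sub_relrange al A B e ga : es_valid (al ++ e :: ga, A) ->
  A `<=` relrange B (e :: ga) <-> B (src e).
Proof.
move=> [_ _ /= [v Av] sA]; split=> [/(_ v Av)[]//|Bs w Aw]; split=> //.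
by have := sA w Aw; rewrite prange_cat.
Qed.

(** Written out on the words and sets of [E(S)], the filter axioms separate
    into conditions on finitely many elements at a time, which is why they
    define a closed set of characteristic functions. The fourth one carries
    the information: past an edge [e], membership at the shorter word is
    decided by the source of [e]. *)
Definition path_filter F : Prop :=
  [/\ ~ F None /\ F !=set0,
      forall al A B, F (es al A) -> A `<=` B -> es_valid (al, B) -> F (es al B),
      forall al A B, F (es al A) -> F (es al B) -> F (es al (A `&` B)),
      forall al e ga A B, F (es (al ++ e :: ga) B) -> es_valid (al, A) ->
        F (es al A) <-> A (src e)
    & forall al A be B, F (es al A) -> F (es be B) ->
        prefix al be \/ prefix be al].

Lemma path_filter_valid F al A :
  path_filter F -> F (es al A) -> es_valid (al, A).
Proof. by move=> [[F0 _] _ _ _ _] FA; apply: es_neqN => E; rewrite E in FA. Qed.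

Lemma prefix_linear al be ga : prefix al ga -> prefix be ga ->
  prefix al be \/ prefix be al.
Proof.
move=> /prefixP[x ->] /prefixP[y E].
have [le|/ltnW le] := leqP (size al) (size be).
  left; apply/prefixP; exists (take (size be - size al) x).
  have := congr1 (take (size be)) E; rewrite take_cat ltnNge le /=.
  by rewrite take_size_cat.
right; apply/prefixP; exists (take (size al - size be) y).
have := congr1 (take (size al)) E; rewrite [in RHS]take_cat ltnNge le /=.
by rewrite take_size_cat.
Qed.

Lemma poset_filterP F : poset_filter (@es_le G) None F <-> path_filter F.
Proof.
split.
  move=> [Fne Fup Fdir F0].
  have val al A : F (es al A) -> es_valid (al, A).
    by move=> FA; apply: es_neqN => E; rewrite E in FA.
  have low al A be B : F (es al A) -> F (es be B) -> exists ga C,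
      [/\ F (es ga C), es_le (es ga C) (es al A) & es_le (es ga C) (es be B)].
    move=> FA FB; have [z [+ + +]] := Fdir _ _ FA FB.
    by case: (esP z) => [//|ga C _ *]; exists ga, C.
  split=> //.
  - move=> al A B FA sAB vB; have vA := val _ _ FA.
    apply: Fup FA _; apply/es_leP => //.
    by exists [::]; rewrite ?cats0.
  - move=> al A B FA FB; have [ga [C [FC]]] := low _ _ _ _ FA FB.
    have vC := val _ _ FC.
    have [vA vB] := (val _ _ FA, val _ _ FB).
    move=> /(es_leP vC vA)[de E sA] /(es_leP vC vB)[de' E' sB].
    have ee : de' = de.
      by apply: (@cat_injr al); rewrite -E -E'.
    subst de'.
    have vAB : es_valid (al, A `&` B).
      case: vA vB => pal bA _ sal [_ bB _ _]; split=> //=.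
      - exact: bsetI.
      - case: de E {E'} sA sB => [|e de] E sA sB.
          case: vC => _ _ [v Cv] _; exists v; split; [exact: sA|exact: sB].
        exists (src e); subst ga.
        by split; [exact: (sub_relrange A vC).1 sA|exact: (sub_relrange B vC).1 sB].
      - by move=> v [/sal].
    apply: Fup FC _; apply/es_leP => //; exists de => //.
    case: (de) E sA sB => [|e de'] E sA sB v Cv; first by split; [exact: sA|exact: sB].
    by have [? ?] := sA _ Cv; have [? ?] := sB _ Cv.
  - move=> al e ga A B FB vA; have vB := val _ _ FB; split=> [FA|As].
      have [ze [C [FC]]] := low _ _ _ _ FA FB; have vC := val _ _ FC.
      move=> /(es_leP vC vA)[de E sA] /(es_leP vC vB)[de' E' _].
      have ee : de = e :: ga ++ de'.
        by apply: (@cat_injr al); rewrite -E E' -catA.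
      by subst de ze; exact: (sub_relrange A vC).1 sA.
    apply: Fup FB _; apply/es_leP => //; exists (e :: ga) => //.
    exact/(sub_relrange A vB).
  - move=> al A be B FA FB; have [ga [C [FC]]] := low _ _ _ _ FA FB.
    have vC := val _ _ FC.
    have [vA vB] := (val _ _ FA, val _ _ FB).
    move=> /(es_leP vC vA)[de E _] /(es_leP vC vB)[de' E' _].
    by apply: (@prefix_linear _ _ ga); [rewrite E|rewrite E']; rewrite prefix_prefix.
move=> pF; have val al A := @path_filter_valid F al A pF.
case: pF => [[F0 Fne] Fup FI Ftr Fco].
split=> //.
  move=> x y; case: (esP x) => [//|al A vA] FA.
  case: (esP y) => [|be B vB]; first by rewrite /es_le (esE vA).
  move=> /(es_leP vA vB)[[|e ga] E sA].
    by rewrite cats0 in E; subst be; apply: Fup FA _ _.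
  subst al; apply/(Ftr _ _ _ _ _ FA) => //; exact: (sub_relrange B vA).1 sA.
suff H al A be B : F (es al A) -> F (es be B) -> prefix al be ->
  exists z, [/\ F z, es_le z (es al A) & es_le z (es be B)].
  move=> x y; case: (esP x) => [//|al A _] FA; case: (esP y) => [//|be B _] FB.
  have [|p] := Fco _ _ _ _ FA FB; first exact: H.
  by have [z [? ? ?]] := H _ _ _ _ FB FA p; exists z.
move=> FA FB /prefixP[[|e ga] E]; subst be.
  rewrite cats0 in FB *; have FAB := FI _ _ _ FA FB.
  have [[vA vB] vAB] := (val _ _ FA, val _ _ FB, val _ _ FAB).
  exists (es al (A `&` B)); split=> //; apply/es_leP => //.
    by exists [::]; rewrite ?cats0 //; apply: subIsetl.
  by exists [::]; rewrite ?cats0 //; apply: subIsetr.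
have [vA vB] := (val _ _ FA, val _ _ FB).
exists (es (al ++ e :: ga) B); split=> //; apply/es_leP => //.
  by exists (e :: ga) => //; apply/(sub_relrange _ vB)/(Ftr _ _ _ _ _ FB).
by exists [::]; rewrite ?cats0.
Qed.

End PathFilters.

(** * Pointwise convergence *)

Section InitialTopology.
Variables (S : choiceType) (T : topologicalType) (f : S -> T).
Local Notation X := (initial_topology f).

Lemma initial_nbhsP (x : X) (W : set X) :
  nbhs x W <-> exists2 V, nbhs (f x) V & f @^-1` V `<=` W.
Proof.
split.
  move=> [_ [[V oV <-] Vx] sW]; exists V => //.
  by rewrite nbhsE; exists V.
move=> [V]; rewrite nbhsE => -[V' [oV' V'x] sV'] sW.
exists (f @^-1` V'); split=> [|//|y /sV' /sW //].
by exists V'.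
Qed.

(** A cluster point of the image filter lies over some point of [K], and the
    neighborhoods of that point are the preimages of those below. *)
Lemma initial_compact (K : set X) : compact (f @` K) -> compact K.
Proof.
move=> cK F FF FK.
have [_ [[x Kx <-] xcl]] : (f @` K) `&` cluster (f @ F) !=set0.
  apply: cK; rewrite nbhs_simpl /=; apply: filterS FK => y Ky.
  by exists y.
exists x; split=> // A B FA /initial_nbhsP[V Vx sB].
have fA : (f @ F) (f @` A) by rewrite nbhs_simpl /=; apply: filterS FA => y Ay; exists y.
have [_ [[y Ay <-] Vy]] := xcl _ _ fA Vx.
by exists y; split=> //; apply: sB.
Qed.

End InitialTopology.

Section PointwiseBool.
Variable I : Type.
Implicit Types (chi : {ptws I -> bool}) (l : seq I).

Definition agree l (chi chi' : I -> bool) : bool :=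
  all [pred x | chi x == chi' x] l.

Lemma agree_refl l chi : agree l chi chi.
Proof. by elim: l => //= x l ->; rewrite eqxx. Qed.

Lemma ptws_nbhsP chi (W : set {ptws I -> bool}) :
  nbhs chi W <-> exists l, forall chi', agree l chi chi' -> W chi'.
Proof.
pose F := filter_from [set: seq I] (fun l => [set chi' | agree l chi chi']).
have FF : Filter F.
  apply: filter_from_filter; first by exists [::].
  move=> l1 l2 _ _; exists (l1 ++ l2) => // chi' /=.
  by rewrite /agree all_cat => /andP.
have Fchi : F --> chi.
  apply/cvg_sup => i V /initial_nbhsP[V' V'x sV].
  exists [:: i] => // chi' /=; rewrite andbT => /eqP E; apply: sV.
  by rewrite /= -E; exact: nbhs_singleton V'x.
split=> [/Fchi[l _ sW]|[l sW]]; first by exists l => chi' /sW.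
suff: nbhs chi [set chi' | agree l chi chi'] by apply: filterS => chi' /sW.
elim: l {sW} => [|i l IH].
  by apply: filterS filterT => chi' _.
have ni : nbhs chi [set chi' : {ptws I -> bool} | chi i = chi' i].
  have : {ptws, nbhs chi --> chi} by [].
  move=> /cvg_sup /(_ i); apply; apply/initial_nbhsP.
  by exists [set chi i] => // chi' /= ->.
by apply: filterS2 ni IH => chi' /= -> ->; rewrite eqxx.
Qed.

Lemma closure_ptwsP chi (A : set {ptws I -> bool}) :
  closure A chi <-> forall l, exists2 chi', A chi' & agree l chi chi'.
Proof.
split=> [clA l|H W /ptws_nbhsP[l sW]].
  have [|chi' [? ?]] := clA [set chi' | agree l chi chi']; last by exists chi'.
  by apply/ptws_nbhsP; exists l.
by have [chi' ? ?] := H l; exists chi'; split=> //; apply: sW.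
Qed.

Lemma compact_ptws : compact [set: {ptws I -> bool}].
Proof.
have := @tychonoff {classic I} (fun=> bool) (fun=> setT) (fun=> bool_compact).
by congr compact; apply/seteqP; split.
Qed.

End PointwiseBool.

(** * Ultrafilters and tight filters *)

Section TightFilters.
Variable G : ultragraph.
Local Notation path := (seq (edge G)).
Implicit Types (F H U : set (ES G)) (al be ga : path) (A B C : set (vertex G)).

Definition ultra F := poset_ultrafilter (@es_le G) None F.

Lemma ultra_filter F : ultra F -> path_filter F.
Proof. by move=> [/poset_filterP]. Qed.

Lemma ultra_max F H : ultra F -> path_filter H -> F `<=` H -> H = F.
Proof. by move=> [_ m] /poset_filterP; apply: m. Qed.

Lemma ultra_exists F : path_filter F -> exists2 U, ultra U & F `<=` U.
Proof.
move=> /poset_filterP pF.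
(* Uniting with [F] makes the empty set, the union of the empty chain, acceptable. *)
pose P := [set X | poset_filter (@es_le G) None (X `|` F)].
have [D DP Dtot|A [PA maxA]] := @Zorn_bigcup _ P.
  have [->|/set0P[X0 DX0]] := eqVneq D set0.
    by rewrite bigcup_set0 /P /= set0U.
  have inD x : (\bigcup_(X in D) X `|` F) x -> exists2 X, D X & (X `|` F) x.
    by move=> [[X DX Xx]|Fx]; [exists X => //; left|exists X0 => //; right].
  have outD X x : D X -> (X `|` F) x -> (\bigcup_(X in D) X `|` F) x.
    by move=> DX [Xx|Fx]; [left; exists X|right].
  split.
  - by have [[x Fx] _ _ _] := pF; exists x; right.
  - move=> x y /inD[X DX Xx] xy; apply: (outD X) => //.
    by have [_ up _ _] := DP _ DX; apply: up Xx xy.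
  - move=> x y /inD[X DX Xx] /inD[Y DY Yy].
    have [Z [DZ Zx Zy]] : exists Z, [/\ D Z, (Z `|` F) x & (Z `|` F) y].
      have [XY|YX] := Dtot _ _ DX DY; [exists Y|exists X]; split=> //.
        by case: Xx => [/XY|]; [left|right].
      by case: Yy => [/YX|]; [left|right].
    have [_ _ dir _] := DP _ DZ; have [z [Zz zx zy]] := dir _ _ Zx Zy.
    by exists z; split=> //; apply: outD Zz.
  - by move=> /inD[X DX]; have [] := DP _ DX.
exists (A `|` F); last exact: subsetUr.
split=> // H pH sH; apply/seteqP; split=> // x Hx; left.
apply: contrapT => nAx; apply: (maxA H); last first.
  rewrite /P /=; have -> // : H `|` F = H.
  by apply/setUidPl => y Fy; apply: sH; right.
by split=> [y Ay|/(_ x Hx)//]; apply: sH; left.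
Qed.

Definition principal al A : set (ES G) :=
  [set x | x <> None /\ es_le (es al A) x].

Lemma principal_filter al A : es_valid (al, A) ->
  path_filter (principal al A) /\ principal al A (es al A).
Proof.
move=> vA; have le0 : es_le (es al A) (es al A).
  by apply/es_leP => //; exists [::]; rewrite ?cats0.
have p0 : principal al A (es al A) by split=> //; rewrite (esE vA).
split=> //; split.
- by split=> [[]//|]; exists (es al A).
- move=> be B C [/es_neqN vB /(es_leP vA vB)[ga E sA]] sBC vC.
  split; first by rewrite (esE vC).
  apply/es_leP => //; exists ga => //; case: ga E sA => [|e ga] E sA v Av.
    exact/sBC/sA.
  by have [/sBC] := sA v Av.
- move=> be B C [/es_neqN vB /(es_leP vA vB)[ga E sA]].
  move=> [/es_neqN vC /(es_leP vA vC)[ga' E' sA']].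
  have ee : ga' = ga by apply: (@cat_injr _ be); rewrite -E -E'.
  subst ga'.
  have sBC : A `<=` relrange (B `&` C) ga.
    case: ga sA sA' {E E'} => [|e ga] sA sA' v Av; first by split; [exact: sA|exact: sA'].
    by have [? ?] := sA v Av; have [? ?] := sA' v Av.
  have vBC : es_valid (be, B `&` C).
    case: vB vC => pb bB _ sB [_ bC _ _]; split=> //=; first exact: bsetI.
      case: ga E {E' sA sA'} sBC => [|e ga] E sBC.
        by case: vA => _ _ [v Av] _; exists v; apply: sBC.
      by exists (src e); subst al; exact: (sub_relrange _ vA).1 sBC.
    by move=> v [/sB].
  by split; [rewrite (esE vBC)|apply/es_leP => //; exists ga].
- move=> be e ga B C [/es_neqN vC /(es_leP vA vC)[de E sA]] vB.
  split=> [[_ /(es_leP vA vB)[de' E' sA']]|Bs].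
    have ee : de' = e :: ga ++ de.
      by apply: (@cat_injr _ be); rewrite -E' E -catA.
    by subst de'; rewrite E' in vA; exact: (sub_relrange _ vA).1 sA'.
  split; first by rewrite (esE vB).
  apply/es_leP => //; exists (e :: ga ++ de); first by rewrite E -catA.
  by rewrite E -catA cat_cons in vA; exact: (sub_relrange B vA).2 Bs.
- move=> be B ga C [/es_neqN vB /(es_leP vA vB)[de E _]].
  move=> [/es_neqN vC /(es_leP vA vC)[de' E' _]].
  by apply: (@prefix_linear _ _ _ al); [rewrite E|rewrite E']; rewrite prefix_prefix.
Qed.

Lemma ultra_point al A : es_valid (al, A) -> exists2 U, ultra U & U (es al A).
Proof.
move=> /principal_filter[/ultra_exists[U uU sU] pA].
by exists U => //; apply: sU.
Qed.

(** If the word of [F] is not empty, the source of its first edge decides which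
    sets belong to [F]. If it is empty and every element of [F] meets [A],
    then the supersets of the sets [C `&` A] with [C] in [F] form a filter, which
    is [F] by maximality. If some [C] in [F] is disjoint from [A], then
    [C `&` (A `|` B)] lies in [B]. *)
Lemma ultra_prime F A B : ultra F -> bset A -> bset B ->
  F (es [::] (A `|` B)) -> F (es [::] A) \/ F (es [::] B).
Proof.
move=> uF bA bB FAB; have pF := ultra_filter uF.
have [[F0 _] Fup FI Ftr Fco] := pF.
have [[e [ga [C FC]]]|noedge] :=
    pselect (exists e ga C, F (es (e :: ga) C)).
  have vAB := path_filter_valid pF FAB.
  have [ABs|ABs] : (A `|` B) (src e) := (Ftr [::] _ _ _ _ FC vAB).1 FAB.
    left; apply/(Ftr [::] _ _ _ _ FC) => //; split=> //.
    by exists (src e).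
  right; apply/(Ftr [::] _ _ _ _ FC) => //; split=> //.
  by exists (src e).
have [[C [FC CA]]|meetA] := pselect (exists C, F (es [::] C) /\ C `&` A = set0).
  right; have FCAB := FI _ _ _ FC FAB.
  have [_ _ CABne _] := path_filter_valid pF FCAB.
  apply: (Fup _ _ _ FCAB) => [v [Cv [Av|//]]|].
    by have : (C `&` A) v by []; rewrite CA.
  split=> //; case: CABne => v [Cv [Av|Bv]]; last by exists v.
  by have : (C `&` A) v by []; rewrite CA.
left.
pose H := [set x | exists2 D, x = es [::] D & [/\ bset D, es_valid ([::] : path, D) &
  exists2 C, F (es [::] C) & C `&` A `<=` D]].
have ne C : F (es [::] C) -> C `&` A !=set0.
  by move=> FC; apply/set0P/eqP => E; apply: meetA; exists C.
have wH al C : H (es al C) -> al = [::] /\ es_valid (al, C) /\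
    exists2 D, F (es [::] D) & D `&` A `<=` C.
  move=> [D E [bD vD [C' FC' s]]].
  by have [<- <-] := es_inj vD (esym E); split=> //; split=> //; exists C'.
have HA C : F (es [::] C) -> H (es [::] (C `&` A)).
  move=> FC; exists (C `&` A) => //.
  have [_ bC _ _] := path_filter_valid pF FC.
  split; [exact: bsetI|split=> //; [exact: bsetI|exact: ne]|by exists C].
have pH : path_filter H.
  split.
  - split; first by move=> [D E [_ vD _]]; move: E; rewrite (esE vD).
    by exists (es [::] ((A `|` B) `&` A)); apply: HA.
  - move=> al C D /wH[-> [vC [C' FC' s]]] sCD vD; exists D => //.
    by case: vD => [_ bD dne _]; split=> //; exists C' => // v /s/sCD.
  - move=> al C D /wH[-> [vC [C' FC' s]]] /wH[_ [vD [D' FD' s']]].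
    exists (C `&` D) => //.
    have FCD := FI _ _ _ FC' FD'.
    have sCD : C' `&` D' `&` A `<=` C `&` D.
      by move=> v [[? ?] ?]; split; [apply: s|apply: s'].
    have bCD : bset (C `&` D) by case: vC vD => _ bC _ _ [_ bD _ _]; apply: bsetI.
    split=> //; last by exists (C' `&` D').
    by split=> //; have [v /sCD] := ne _ FCD; exists v.
  - by move=> al e ga C D /wH[]; case: al.
  - by move=> al C be D /wH[-> _] /wH[-> _]; left.
have sF : F `<=` H.
  move=> x; case: (esP x) => [//|[|e al] C vC FC]; last first.
    by exfalso; apply: noedge; exists e, al, C.
  by exists C => //; split=> //; [case: vC|exists C => // v []].
have [v [_ Av]] := ne _ FAB.
rewrite -(ultra_max uF pH sF).
exists A => //; split=> //; first by split=> //; exists v.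
by exists (A `|` B) => // w [].
Qed.

(** An ultrafilter cannot stop at a vertex that emits an edge: the principal
    filter of the edge would be strictly larger. *)
Lemma ultra_emit F v : ultra F -> F (es [::] [set v]) ->
  (exists e, src e = v) -> exists2 e, src e = v & F (es [:: e] (rng e)).
Proof.
move=> uF Fv [e ev]; have pF := ultra_filter uF.
have [[F0 _] Fup FI Ftr Fco] := pF.
have vv := path_filter_valid pF Fv.
apply: contrapT => no.
have noedge f ga C : ~ F (es (f :: ga) C).
  move=> FC; apply: no; exists f; first exact: (Ftr [::] _ _ _ _ FC vv).1 Fv.
  have vf : es_valid ([:: f], rng f).
    by split=> //; [exact/bset_gv/gvset_rng|exact: rng_neq0].
  have vC := path_filter_valid pF FC.
  case: ga FC vC => [|g ga] FC vC; first by apply: Fup FC _ vf; case: vC.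
  apply/(Ftr [:: f] _ _ _ _ FC) => //.
  have [pf _ _ _] := vC; move: pf.
  by rewrite -cat1s is_path_cat => /and3P[_]; rewrite in_setE.
have vf : es_valid ([:: e], rng e).
  by split=> //; [exact/bset_gv/gvset_rng|exact: rng_neq0].
have [pP Pe] := principal_filter vf.
have sF : F `<=` principal [:: e] (rng e).
  move=> x; case: (esP x) => [//|[|f al] C vC FC]; last by case: (noedge _ _ _ FC).
  split; first by rewrite (esE vC).
  apply/es_leP => //; exists [:: e] => //.
  apply/(@sub_relrange _ [::] (rng e) C e [::]) => //.
  have [_ _ [w [Cw wv]] _] := path_filter_valid pF (FI _ _ _ FC Fv).
  by rewrite ev -wv.
apply: (@noedge e [::] (rng e)).
by rewrite -(ultra_max uF pP sF).
Qed.

(** Tight filters without the topology: a filter lies in the closure of the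
    ultrafilters when finitely many memberships never tell it from an
    ultrafilter. *)
Definition tight_filter (chi : ES G -> bool) : Prop :=
  path_filter [set x | chi x] /\
  forall l, exists2 psi : ES G -> bool, ultra [set x | psi x] & agree l chi psi.

Definition ev (xi : tight G) : ES G -> bool := set_val (set_val xi).

Lemma tsetE xi : tset xi = [set x | ev xi x]. Proof. by []. Qed.

Lemma filter_mk (chi : ES G -> bool) : path_filter [set x | chi x] ->
  exists p : filterSpace G, set_val p = chi.
Proof.
move=> /poset_filterP pchi.
have h : chi \in filters (G := G) by rewrite inE.
by exists (exist _ (chi : {ptws ES G -> bool}) h).
Qed.

Lemma evP (xi : tight G) : tight_filter (ev xi).
Proof.
split; first exact/poset_filterP/set_mem/(valP (set_val xi)).
move=> l; have /set_mem := valP xi.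
move=> /(_ (set_val @^-1` [set chi | agree l (ev xi) chi])) [].
  apply/initial_nbhsP; exists [set chi | agree l (ev xi) chi] => //.
  by apply/ptws_nbhsP; exists l.
by move=> p [up agp]; exists (set_val p).
Qed.

Lemma tight_mk (chi : ES G -> bool) : tight_filter chi ->
  exists xi : tight G, ev xi = chi.
Proof.
move=> [/filter_mk[p pchi] tchi].
have cp : p \in closure (ultrafilters (G := G)).
  rewrite inE => W /initial_nbhsP[V /ptws_nbhsP[l lV] sW].
  have [psi upsi ag] := tchi l.
  have [q qpsi] := filter_mk (ultra_filter upsi).
  exists q; split; first by rewrite /ultrafilters /= /fset_of qpsi.
  by apply: sW; rewrite /= qpsi; apply: lV; rewrite pchi.
by exists (exist _ p cp).
Qed.

Lemma tight_nbhsP (xi : tight G) (W : set (tight G)) :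
  nbhs xi W <-> exists l, forall eta, agree l (ev xi) (ev eta) -> W eta.
Proof.
split.
  move=> /initial_nbhsP[V /initial_nbhsP[V' /ptws_nbhsP[l lV'] sV] sW].
  by exists l => eta ag; apply/sW/sV/lV'.
move=> [l lW]; apply/initial_nbhsP.
exists [set p : filterSpace G | agree l (ev xi) (set_val p)]; last first.
  by move=> eta; apply: lW.
apply/initial_nbhsP; exists [set chi | agree l (ev xi) chi] => //.
by apply/ptws_nbhsP; exists l.
Qed.

Lemma ev_inj : injective ev.
Proof. by move=> xi eta /val_inj/val_inj. Qed.

End TightFilters.

(** * Deleting and prepending an edge *)

Section Shifts.
Variable G : ultragraph.
Local Notation path := (seq (edge G)).
Implicit Types (F H U : set (ES G)) (al be ga : path) (A B C : set (vertex G)).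
Implicit Types (e f : edge G) (xi eta : tight G).

(** Conjugation of idempotents by an edge: [x |-> s_e x s_e^*], and below
    [x |-> s_e^* x s_e]. *)
Definition conj_s e (x : ES G) : ES G :=
  if x is Some (exist (al, A) _) then es (e :: al) (A `&` prange (e :: al))
  else None.

Definition conj_ss e (x : ES G) : ES G :=
  if x is Some (exist (al, A) _) then
    if al is f :: al' then if f == e then es al' A else None
    else if `[< A (src e) >] then es [::] (rng e) else None
  else None.

Lemma conj_sE e al A : es_valid (al, A) ->
  conj_s e (es al A) = es (e :: al) (A `&` prange (e :: al)).
Proof. by move=> h; rewrite (esE h). Qed.

Lemma conj_ssE e f al A : es_valid (f :: al, A) ->
  conj_ss e (es (f :: al) A) = if f == e then es al A else None.
Proof. by move=> h; rewrite (esE h). Qed.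

Lemma conj_ss0 e A : es_valid ([::], A) ->
  conj_ss e (es [::] A) = if `[< A (src e) >] then es [::] (rng e) else None.
Proof. by move=> h; rewrite (esE h). Qed.

Lemma es_valid_rng e : es_valid ([::], rng e).
Proof. by split=> //; [exact/bset_gv/gvset_rng|exact: rng_neq0]. Qed.

Lemma es_valid_edge e : es_valid ([:: e], rng e).
Proof. by split=> //; [exact/bset_gv/gvset_rng|exact: rng_neq0]. Qed.

Lemma es_valid_behead e al A : es_valid (e :: al, A) -> es_valid (al, A).
Proof.
move=> [/= pal bA neA sA]; split=> //=; first exact: (@is_path_catr _ [:: e]).
by case: al sA {pal} => //= f al.
Qed.

(** Both conjugations are morphisms of semilattices, so that preimages of filters
    are filters; they are mutually inverse between the elements below [(e, r(e))]
    and those below [(omega, r(e))]. *)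
Lemma conj_s_filter e F : path_filter F -> F (es [:: e] (rng e)) ->
  path_filter [set x | F (conj_s e x)].
Proof.
move=> pF Fe; have val al A := @path_filter_valid _ F al A pF.
have [[F0 _] Fup FI Ftr Fco] := pF.
have mem al A : F (conj_s e (es al A)) ->
    es_valid (al, A) /\ F (es (e :: al) (A `&` prange (e :: al))).
  case: (pselect (es_valid (al, A))) => [v|/esN->//].
  by rewrite (conj_sE e v).
split.
- split=> //; exists (es [::] (rng e)).
  by rewrite /= (conj_sE _ (es_valid_rng e)) /= setIid.
- move=> al A B /mem[vA FA] sAB vB; rewrite /= (conj_sE e vB).
  have sI : A `&` prange (e :: al) `<=` B `&` prange (e :: al) by apply: setSI.
  apply: (Fup _ _ _ FA sI).
  have [pa _ [v Av] _] := val _ _ FA; split=> //.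
  - by apply: bsetI; [case: vB|exact: bset_prange].
  - by exists v; apply: sI.
  - exact: subIsetr.
- move=> al A B /mem[vA FA] /mem[vB FB] /=.
  have FAB := FI _ _ _ FA FB; rewrite -setIIl in FAB.
  rewrite conj_sE //.
  case: vA (vB) => pa bA _ sA [_ bB _ _]; split=> //.
  - exact: bsetI.
  - by have [_ _ [v [ABv _]] _] := val _ _ FAB; exists v.
  - by move=> v [/sA].
- move=> al f ga A B /mem[vB FB] vA; rewrite /= (conj_sE e vA).
  have vF := val _ _ FB.
  have sf : prange (e :: al) (src f).
    have [] := vF; rewrite -cat_cons is_path_cat => /and3P[_ + _] _ _ _.
    by rewrite in_setE.
  split=> [FA|As].
    by have [] := (Ftr (e :: al) _ _ _ _ FB (val _ _ FA)).1 FA.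
  apply/(Ftr (e :: al) _ _ _ _ FB) => //; split=> //.
  - by have [+ _ _ _] := vF; rewrite -cat_cons => /is_path_catl.
  - by apply: bsetI; [case: vA|exact: bset_prange].
  - by exists (src f).
  - exact: subIsetr.
- move=> al A be B /mem[_ FA] /mem[_ FB].
  by have [] := Fco _ _ _ _ FA FB; rewrite /= eqxx /=; [left|right].
Qed.

Lemma conj_ss_filter e F : path_filter F -> F (es [::] (rng e)) ->
  path_filter [set x | F (conj_ss e x)].
Proof.
move=> pF Fe; have val al A := @path_filter_valid _ F al A pF.
have [[F0 _] Fup FI Ftr Fco] := pF.
have mem al A : F (conj_ss e (es al A)) -> es_valid (al, A) /\
    ((al = [::] /\ A (src e)) \/ exists2 al', al = e :: al' & F (es al' A)).
  case: (pselect (es_valid (al, A))) => [v|/esN->//]; split=> //.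
  case: al v H => [|f al] v; first by rewrite conj_ss0 //; case: asboolP; left.
  by rewrite conj_ssE //; case: eqP => [->|//] FA; right; exists al.
have mem0 A : es_valid ([::], A) -> A (src e) -> F (conj_ss e (es [::] A)).
  by move=> v /asboolP As; rewrite conj_ss0 // As.
have mem1 al A : es_valid (e :: al, A) -> F (es al A) ->
    F (conj_ss e (es (e :: al) A)).
  by move=> v FA; rewrite conj_ssE // eqxx.
split.
- by split=> //; exists (es [:: e] (rng e)); apply: mem1 => //; apply: es_valid_edge.
- move=> al A B /mem[vA [[al0 As]|[al' al1 FA]]] sAB; rewrite ?al0 ?al1 => vB.
    by apply: mem0 => //; apply: sAB.
  by apply: mem1 => //; apply: Fup FA sAB (es_valid_behead vB).
- move=> al A B /mem[vA FA] /mem[vB FB].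
  have vAB : (A `&` B) !=set0 -> es_valid (al, A `&` B).
    case: vA vB => pa bA _ sA [_ bB _ _]; split=> //=; first exact: bsetI.
    by move=> v [/sA].
  case: FA FB => [[al0 As]|[al' al1 FA]] [[al0' Bs]|[al'' al1' FB]].
  - rewrite al0 in vAB *.
    by apply: mem0 => //; apply: vAB; exists (src e).
  - by rewrite al0 in al1'.
  - by rewrite al0' in al1.
  - have ee : al'' = al' by move: al1'; rewrite al1 => -[].
    rewrite ee in FB; have FAB := FI _ _ _ FA FB.
    by rewrite al1 in vAB *; apply: mem1 => //; apply: vAB; case: (val _ _ FAB).
- move=> al f ga A B /mem[vB []]; first by case: (al) => [|? ?] [].
  case: al vB => [|g al] vB [al' /= [-> gaE] FB] vA.
    split=> [/mem[_ [[]//|[]//]]|]; exact: mem0.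
  rewrite -gaE in FB; split.
    by move=> /mem[_ [[]//|[al'' [<-] FA]]]; exact: (Ftr _ _ _ _ _ FB (val _ _ FA)).1 FA.
  move=> As; apply: mem1 => //; apply/(Ftr _ _ _ _ _ FB) => //.
  exact: es_valid_behead vA.
- move=> al A be B /mem[_ [[-> _]|[al' -> FA]]]; first by left; rewrite prefix0s.
  move=> /mem[_ [[-> _]|[be' -> FB]]]; first by right; rewrite prefix0s.
  by have [] := Fco _ _ _ _ FA FB; rewrite /= eqxx /=; [left|right].
Qed.

Lemma conj_ssK e F : path_filter F -> F (es [:: e] (rng e)) ->
  forall x, F (conj_s e (conj_ss e x)) <-> F x.
Proof.
move=> pF Fe x; have val al A := @path_filter_valid _ F al A pF.
have [[F0 _] Fup FI Ftr Fco] := pF.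
case: (esP x) => [//|[|f al] A vA].
  rewrite conj_ss0 //; case: asboolP => As.
    rewrite (conj_sE _ (es_valid_rng e)) /= setIid.
    by split=> // _; apply/(Ftr [::] _ _ _ _ Fe).
  by split=> // FA; case: As; apply/(Ftr [::] _ _ _ _ Fe).
rewrite conj_ssE //; case: eqP => [E|fe].
  rewrite E in vA *; rewrite (conj_sE _ (es_valid_behead vA)).
  by have -> : A `&` prange (e :: al) = A by case: vA => _ _ _ /setIidPl.
split=> //= FA; have [] := Fco _ _ _ _ FA Fe.
  by rewrite /= => /andP[/eqP].
by rewrite /= => /andP[/eqP/esym].
Qed.

Lemma conj_sK e F : path_filter F -> F (es [::] (rng e)) ->
  forall x, F (conj_ss e (conj_s e x)) <-> F x.
Proof.
move=> pF Fe x; have val al A := @path_filter_valid _ F al A pF.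
have [[F0 _] Fup FI Ftr Fco] := pF.
case: (esP x) => [//|al A vA]; rewrite (conj_sE e vA).
have valE : F (es al A) -> es_valid (e :: al, A `&` prange (e :: al)).
  case: al vA => [|f al] vA FA.
    have [pa bA neA _] := val _ _ (FI _ _ _ FA Fe).
    by split=> //; apply: subIsetr.
  have sf := (Ftr [::] _ _ _ _ FA (es_valid_rng e)).1 Fe.
  have [/= pa bA neA sA] := vA.
  have -> : A `&` prange [:: e, f & al] = A by apply/setIidPl.
  split=> //.
  by rewrite -cat1s is_path_cat /= pa andbT; rewrite in_setE.
have eqF : F (es al (A `&` prange (e :: al))) <-> F (es al A).
  case: al vA {valE} => [|f al] vA.
    by split=> [FA|FA]; [apply: Fup FA _ _ => // v []|apply: FI].
  by have -> : A `&` prange [:: e, f & al] = A by case: vA => _ _ _ /setIidPl.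
have [v|nv] := pselect (es_valid (e :: al, A `&` prange (e :: al))).
  by rewrite conj_ssE // eqxx.
rewrite (esN nv); split=> //= /valE; contradiction.
Qed.

(** The two operations on filters are monotone and inverse to each other, so they
    preserve maximality. *)
Lemma conj_s_ultra e F : ultra F -> F (es [:: e] (rng e)) ->
  ultra [set x | F (conj_s e x)].
Proof.
move=> uF Fe; have pF := ultra_filter uF.
have pD := conj_s_filter pF Fe.
split; first exact/poset_filterP.
move=> H /poset_filterP pH sH.
have He : H (es [::] (rng e)).
  by apply: sH; rewrite /= (conj_sE _ (es_valid_rng e)) /= setIid.
have E : [set x | H (conj_ss e x)] = F.
  apply: (ultra_max uF (conj_ss_filter pH He)) => x Fx.
  by apply: sH; apply/conj_ssK.
apply/seteqP; split=> // x Hx /=.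
by rewrite -E; apply/conj_sK.
Qed.

Lemma conj_ss_ultra e F : ultra F -> F (es [::] (rng e)) ->
  ultra [set x | F (conj_ss e x)].
Proof.
move=> uF Fe; have pF := ultra_filter uF.
have pD := conj_ss_filter pF Fe.
split; first exact/poset_filterP.
move=> H /poset_filterP pH sH.
have He : H (es [:: e] (rng e)).
  by apply: sH; rewrite /= (conj_ssE _ (es_valid_edge e)) /= eqxx.
have E : [set x | H (conj_s e x)] = F.
  apply: (ultra_max uF (conj_s_filter pH He)) => x Fx.
  by apply: sH; apply/conj_sK.
apply/seteqP; split=> // x Hx /=.
by rewrite -E; apply/conj_ssK.
Qed.

Lemma agree_map (I J : Type) (h : I -> J) (l : seq I) (chi psi : J -> bool) :
  agree (map h l) chi psi = agree l (chi \o h) (psi \o h).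
Proof. by rewrite /agree all_map. Qed.

(** Membership of [x] in the new filter is membership of one element in the old one,
    so an ultrafilter approximating the old filter on finitely many elements
    yields one approximating the new filter. *)
Lemma tight_down e xi : exists eta,
  ev xi (es [:: e] (rng e)) -> ev eta = ev xi \o conj_s e.
Proof.
case xe: (ev xi (es [:: e] (rng e))); last by exists xi.
have [pxi txi] := evP xi.
have [] := @tight_mk _ (ev xi \o conj_s e); last by move=> eta E; exists eta.
split; first exact: conj_s_filter pxi xe.
move=> l; have [psi upsi] := txi (es [:: e] (rng e) :: map (conj_s e) l).
rewrite /= xe => /andP[/eqP/esym psie ag].
exists (psi \o conj_s e); first exact: conj_s_ultra upsi psie.
by rewrite -agree_map.
Qed.

Lemma tight_up e xi : exists eta,
  ev xi (es [::] (rng e)) -> ev eta = ev xi \o conj_ss e.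
Proof.
case xe: (ev xi (es [::] (rng e))); last by exists xi.
have [pxi txi] := evP xi.
have [] := @tight_mk _ (ev xi \o conj_ss e); last by move=> eta E; exists eta.
split; first exact: conj_ss_filter pxi xe.
move=> l; have [psi upsi] := txi (es [::] (rng e) :: map (conj_ss e) l).
rewrite /= xe => /andP[/eqP/esym psie ag].
exists (psi \o conj_ss e); first exact: conj_ss_ultra upsi psie.
by rewrite -agree_map.
Qed.

(** Deleting and prepending the edge [e]; junk when [e] is not the first edge of
    the word, respectively when it cannot be prepended. *)
Definition down e xi : tight G := projT1 (cid (tight_down e xi)).
Definition up e xi : tight G := projT1 (cid (tight_up e xi)).

Lemma downE e xi : ev xi (es [:: e] (rng e)) -> ev (down e xi) = ev xi \o conj_s e.
Proof. by rewrite /down; case: cid. Qed.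

Lemma upE e xi : ev xi (es [::] (rng e)) -> ev (up e xi) = ev xi \o conj_ss e.
Proof. by rewrite /up; case: cid. Qed.

Lemma down_dom e xi : ev xi (es [:: e] (rng e)) -> ev (down e xi) (es [::] (rng e)).
Proof.
by move=> xe; rewrite downE //= (conj_sE _ (es_valid_rng e)) /= setIid.
Qed.

Lemma up_dom e xi : ev xi (es [::] (rng e)) -> ev (up e xi) (es [:: e] (rng e)).
Proof. by move=> xe; rewrite upE //= (conj_ssE _ (es_valid_edge e)) eqxx. Qed.

Lemma downK e xi : ev xi (es [:: e] (rng e)) -> up e (down e xi) = xi.
Proof.
move=> xe; apply: ev_inj; apply/funext => x.
rewrite upE ?down_dom //= downE //=; apply/idP/idP => H.
  by have [/(_ H)] := conj_ssK (evP xi).1 xe x.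
by have [_ /(_ H)] := conj_ssK (evP xi).1 xe x.
Qed.

Lemma upK e xi : ev xi (es [::] (rng e)) -> down e (up e xi) = xi.
Proof.
move=> xe; apply: ev_inj; apply/funext => x.
rewrite downE ?up_dom //= upE //=; apply/idP/idP => H.
  by have [/(_ H)] := conj_sK (evP xi).1 xe x.
by have [_ /(_ H)] := conj_sK (evP xi).1 xe x.
Qed.

(** Tight filters containing [x] are cut out by conditions on finitely many
    coordinates each, hence form a closed subset of the product of copies of
    [bool]. Requiring [x] is what makes nonemptiness such a condition. *)
Lemma compact_V_ (x : ES G) : compact (V_ x).
Proof.
apply: initial_compact; apply: initial_compact.
have -> : set_val @` (set_val @` V_ x) =
    [set chi : {ptws ES G -> bool} | tight_filter chi /\ chi x].
  apply/seteqP; split=> [_ [_ [xi Vx <-] <-]|chi [/tight_mk[xi <-] chix]].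
    by split=> //; exact: evP.
  by exists (set_val xi) => //; exists xi.
apply: (subclosed_compact _ (@compact_ptws (ES G))) => // chi /closure_ptwsP cl.
split; last by have [psi [_ px]] := cl [:: x]; rewrite /= andbT => /eqP->.
split; last first.
  move=> l; have [psi [[_ tpsi] _] ag] := cl l; have [U uU ag'] := tpsi l.
  exists U => //; elim: l ag ag' {tpsi} => //= y l IH /andP[/eqP-> ag] /andP[-> ag'].
  exact: IH.
split=> /=.
- split.
    have [psi [[[[p0 _] _ _ _ _] _] _]] := cl [:: None].
    by rewrite /= andbT => /eqP->.
  by exists x; have [psi [_ px]] := cl [:: x]; rewrite /= andbT => /eqP->.
- move=> al A B; have [psi [[[_ pup _ _ _] _] _]] := cl [:: es al A; es al B].
  by move=> /and3P[/eqP-> /eqP-> _]; apply: pup.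
- move=> al A B; have [psi [[[_ _ pI _ _] _] _]] :=
    cl [:: es al A; es al B; es al (A `&` B)].
  by move=> /and4P[/eqP-> /eqP-> /eqP-> _]; apply: pI.
- move=> al e ga A B; have [psi [[[_ _ _ ptr _] _] _]] :=
    cl [:: es (al ++ e :: ga) B; es al A].
  by move=> /and3P[/eqP-> /eqP-> _]; apply: ptr.
- move=> al A be B; have [psi [[[_ _ _ _ pco] _] _]] := cl [:: es al A; es be B].
  by move=> /and3P[/eqP-> /eqP-> _]; apply: pco.
Qed.

End Shifts.

(** * Membership in a tight filter *)

Section TightFacts.
Variable G : ultragraph.
Local Notation path := (seq (edge G)).
Implicit Types (al be ga : path) (A B C : set (vertex G)).
Implicit Types (e f : edge G) (xi eta ze : tight G).

Lemma ev_valid xi al A : ev xi (es al A) -> es_valid (al, A).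
Proof. exact: (path_filter_valid (evP xi).1). Qed.

Lemma ev_None xi : ev xi None = false.
Proof. by have [[[x0 _] _ _ _ _] _] := evP xi; apply/negP. Qed.

Lemma ev_up xi al A B : ev xi (es al A) -> A `<=` B -> es_valid (al, B) ->
  ev xi (es al B).
Proof. by have [[_ up _ _ _] _] := evP xi; apply: up. Qed.

Lemma ev_up0 xi A B : ev xi (es [::] A) -> A `<=` B -> bset B ->
  ev xi (es [::] B).
Proof.
move=> xA sAB bB; apply: (ev_up xA sAB); split=> //.
by have [_ _ [v Av] _] := ev_valid xA; exists v; apply: sAB.
Qed.

Lemma ev_meet xi al A B :
  ev xi (es al A) -> ev xi (es al B) -> ev xi (es al (A `&` B)).
Proof. by have [[_ _ meet _ _] _] := evP xi; apply: meet. Qed.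

Lemma ev_trunc xi al e ga A B : ev xi (es (al ++ e :: ga) B) ->
  es_valid (al, A) -> ev xi (es al A) <-> A (src e).
Proof. by have [[_ _ _ tr _] _] := evP xi; apply: tr. Qed.

Lemma ev_linear xi al A be B : ev xi (es al A) -> ev xi (es be B) ->
  prefix al be \/ prefix be al.
Proof. by have [[_ _ _ _ co] _] := evP xi; apply: co. Qed.

Lemma ev_set0 xi al : ev xi (es al set0) = false.
Proof. by apply/negP => /ev_valid[_ _ [v []]]. Qed.

Lemma ev_setI xi A B : bset A -> bset B ->
  ev xi (es [::] (A `&` B)) = ev xi (es [::] A) && ev xi (es [::] B).
Proof.
move=> bA bB; apply/idP/andP => [xAB|[xA xB]]; last exact: ev_meet.
by split; apply: (ev_up0 xAB) => // v [].
Qed.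

(** An ultrafilter agreeing with [xi] at the three sets in question decides. *)
Lemma ev_setU xi A B : bset A -> bset B ->
  ev xi (es [::] (A `|` B)) = ev xi (es [::] A) || ev xi (es [::] B).
Proof.
move=> bA bB; apply/idP/idP => [xAB|]; last first.
  by case/orP => xA; apply: (ev_up0 xA) => [v|]; [left|exact: bsetU|right|exact: bsetU].
have [_ /(_ [:: es [::] (A `|` B); es [::] A; es [::] B])] := evP xi.
move=> [psi upsi /and4P[/eqP E /eqP-> /eqP-> _]].
by have [|->|->] := ultra_prime upsi bA bB; rewrite ?orbT //= -E.
Qed.

Lemma ev_setD xi A B : bset A -> bset B ->
  ev xi (es [::] (A `\` B)) = ev xi (es [::] A) && ~~ ev xi (es [::] B).
Proof.
move=> bA bB; have bD := bsetD bA bB.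
have /esym := ev_setI xi bD bB; have -> : (A `\` B) `&` B = set0.
  by apply/seteqP; split=> // v [[]].
rewrite ev_set0; have := ev_setU xi (bsetI bA bB) bD.
have -> : (A `&` B) `|` (A `\` B) = A by rewrite setUIDK.
by rewrite ev_setI // => ->; do 3!case: ev => //.
Qed.

(** Finitely many edges: tight filters inherit [ultra_emit], since it concerns
    finitely many memberships. *)
Lemma ev_emit xi v : ev xi (es [::] [set v]) -> [set e | src e = v] !=set0 ->
  finite_set [set e | src e = v] -> exists2 e, src e = v & ev xi (es [:: e] (rng e)).
Proof.
move=> xv [e0 e0v] fin.
have [_ /(_ (es [::] [set v] ::
  [seq es [:: e] (rng e) | e <- fset_set [set e | src e = v]]))] := evP xi.
move=> [psi upsi /= /andP[/eqP E ag]].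
have [||e ee pe] := @ultra_emit _ _ v upsi; first by rewrite /= -E.
  by exists e0.
exists e => //; move: ag; rewrite agree_map => /allP /(_ e).
by rewrite in_fset_set // in_setE /= => /(_ ee)/eqP->.
Qed.

Lemma ev_point al A : es_valid (al, A) -> exists xi, ev xi (es al A).
Proof.
move=> /ultra_point[U uU UA]; pose chi x := `[< U x >].
have E : [set x | chi x] = U by apply/seteqP; split=> x /asboolP.
have [|xi xiE] := @tight_mk _ chi.
  by split; [rewrite E; exact: ultra_filter|exists chi; rewrite ?E ?agree_refl].
by exists xi; rewrite xiE; apply/asboolP.
Qed.

Lemma ev_src xi e ga A B : ev xi (es (e :: ga) B) -> bset A ->
  ev xi (es [::] A) <-> A (src e).
Proof.
move=> xe bA; have [[v Av]|] := pselect (A !=set0).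
  by apply: (@ev_trunc _ [::] e ga A B) => //; split=> //; exists v.
move=> nA; split=> [/ev_valid[_ _ /nA]//|As].
by case: nA; exists (src e).
Qed.

Lemma ev_behead xi e al A : ev xi (es (e :: al) A) -> ev xi (es [:: e] (rng e)).
Proof.
case: al => [|f al] xA.
  by apply: (ev_up xA) (es_valid_edge e); have [] := ev_valid xA.
apply/(ev_trunc (al := [:: e]) xA (es_valid_edge e)).
by have [/= /andP[+ _] _ _ _] := ev_valid xA; rewrite in_setE.
Qed.

Lemma ev_edge_inj xi e f :
  ev xi (es [:: e] (rng e)) -> ev xi (es [:: f] (rng f)) -> e = f.
Proof.
by move=> xe /(ev_linear xe)[] /=; rewrite ?andbT => /eqP.
Qed.

(** The recursion along words on which all computations rest. Sets are cut down
    to the range of the word because at the empty word they need not lie in it. *)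
Lemma ev_cons xi e al A : bset A ->
  ev xi (es (e :: al) (A `&` prange (e :: al))) =
  ev xi (es [:: e] (rng e)) && ev (down e xi) (es al (A `&` prange al)).
Proof.
move=> bA; have EI : A `&` prange al `&` prange (e :: al) = A `&` prange (e :: al).
  case: al => [|f al] /=; first by rewrite setIT.
  by rewrite -setIA setIid.
apply/idP/andP => [xA|[xe]].
  have xe := ev_behead xA; split=> //; rewrite downE //=.
  have [pal _ [v [Av]]] := ev_valid xA => pv _.
  rewrite conj_sE ?EI //; split=> /=.
  - exact: (@is_path_catr _ [:: e]).
  - exact: bset_prangeI.
  - by exists v; split=> //; case: (al) pv.
  - exact: subIsetr.
move=> /[dup] /ev_valid v; by rewrite downE //= conj_sE // EI.
Qed.

Definition downs al xi := foldl (fun x e => down e x) xi al.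
Definition ups be xi := foldr (@up G) xi be.

(** At the empty word no condition is imposed: its range is the set of all
    vertices, which need not belong to [bset]. *)
Definition prependable al ze : Prop :=
  is_path al /\ (al <> [::] -> ev ze (es [::] (prange al))).

Lemma ups_cat al be ze : ups (al ++ be) ze = ups al (ups be ze).
Proof. exact: foldr_cat. Qed.

Lemma prependable_behead e al ze : prependable (e :: al) ze -> prependable al ze.
Proof.
case: al => [|f al] [pa E]; split=> //; first exact: (@is_path_catr _ [:: e]).
by move=> _; apply: E.
Qed.

Lemma prependable_up e al ze : prependable (e :: al) ze ->
  ev (ups al ze) (es [::] (rng e)).
Proof.
elim: al e => [|f al IH] e [pa E]; first exact: E.
have pf : prependable (f :: al) ze by apply: (@prependable_behead e).
have xf := up_dom (IH _ pf).
apply/(ev_src xf); first exact/bset_gv/gvset_rng.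
by move: pa => /= /andP[]; rewrite in_setE.
Qed.

Lemma ev_ups_cat al ga ze A : prependable al ze -> bset A ->
  ev (ups al ze) (es (al ++ ga) (A `&` prange (al ++ ga))) =
  ev ze (es ga (A `&` prange ga)).
Proof.
move=> + bA; elim: al => //= e al IH pa.
by rewrite (ev_cons _ e (al ++ ga)) // up_dom ?upK ?(IH (prependable_behead pa)) //;
  exact: prependable_up.
Qed.

Lemma ev_ups al ze A : prependable al ze -> bset A ->
  ev (ups al ze) (es al (A `&` prange al)) = ev ze (es [::] A).
Proof.
by move=> pa bA; have := ev_ups_cat [::] pa bA; rewrite cats0 /= setIT.
Qed.

(** By [ev_cons], the edges of [al] can be deleted one at a time. *)
Lemma ev_downs al xi A : bset A -> ev xi (es al (A `&` prange al)) ->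
  [/\ ev (downs al xi) (es [::] A), ups al (downs al xi) = xi &
      prependable al (downs al xi)].
Proof.
move=> bA; elim: al xi => [|e al IH] xi; first by rewrite /= setIT.
move=> /[dup] /ev_valid[/= pa _ _ _]; rewrite ev_cons // => /andP[xe /IH[dA dK [pa' Ea']]].
split=> //=; first by rewrite dK downK.
split=> // _; case: al pa Ea' {pa' IH} dK dA => [|f al] pa Ea' dK dA; last exact: Ea'.
exact: down_dom.
Qed.

End TightFacts.

(** * The word of a tight filter *)

Section Words.
Variable G : ultragraph.
Local Notation path := (seq (edge G)).
Implicit Types (al be ga : path) (A B C : set (vertex G)).
Implicit Types (e f : edge G) (xi eta ze : tight G) (p q : nat -> edge G).

Lemma occurs0 xi : occurs xi [::].
Proof.
have [[[n0 [x xx]] _ _ tr _] _] := evP xi; move: xx.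
case: (esP x) => [//|[|e al] A vA xA]; first by exists A.
exists [set src e]; have v : es_valid ([::], [set src e]).
  by split=> //; [exact/bset_gv/gvset1|exists (src e)].
by split=> //; apply/(ev_trunc (al := [::]) xA v).
Qed.

Lemma occurs_cat xi al be : occurs xi (al ++ be) -> occurs xi al.
Proof.
case: be => [|e be]; first by rewrite cats0.
move=> [A [[/= pa _ _ _] xA]]; exists [set src e].
have v : es_valid (al, [set src e]).
  move: pa; rewrite is_path_cat => /and3P[pa + _]; rewrite in_setE => sr.
  by split=> //=; [exact/bset_gv/gvset1|exists (src e)|move=> _ ->].
by split=> //; apply/(ev_trunc xA v).
Qed.

Lemma occurs_linear xi al be : occurs xi al -> occurs xi be ->
  prefix al be \/ prefix be al.
Proof. by move=> [A [_ xA]] [B [_ xB]]; apply: ev_linear xA xB. Qed.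

Lemma occurs_size xi al be : occurs xi al -> occurs xi be -> size al = size be ->
  al = be.
Proof.
suff H u v : prefix u v -> size u = size v -> u = v :> path.
  move=> oa ob s; have [/H->//|/H ba] := occurs_linear oa ob.
  by rewrite ba.
move=> /prefixP[w ->]; rewrite size_cat => /eqP.
by rewrite -{1}[size u]addn0 eqn_add2l eq_sym => /nilP->; rewrite cats0.
Qed.

Lemma occurs_path xi al : occurs xi al -> is_path al.
Proof. by move=> [A [[]]]. Qed.

(** The words occurring in a filter form a chain closed under prefixes, so they
    are the prefixes of a single finite or infinite word. *)
Lemma word_exists xi :
  (exists al, has_word xi al) \/ (exists p, has_infword xi p).
Proof.
have occ_take al n : occurs xi al -> occurs xi (take n al).
  by move=> o; apply: (@occurs_cat _ _ (drop n al)); rewrite cat_take_drop.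
have [long|/existsNP[n0 noN]] :=
    pselect (forall n, exists2 al, occurs xi al & (n <= size al)%N).
  right.
  have /choice[w wP] : forall n, exists al, occurs xi al /\ size al = n.
    move=> n; have [al o le] := long n; exists (take n al).
    by rewrite size_takel //; split=> //; apply: occ_take.
  have [e0 _] : exists e0, w 1%N = [:: e0].
    by have [_] := wP 1%N; case: (w 1%N) => [//|e0 [|//]] _; exists e0.
  pose p n := last e0 (w n.+1).
  have wE n : w n = mkseq p n.
    elim: n => [|n IH]; first by have [_ /size0nil] := wP 0%N.
    have [on sn] := wP n.+1; case/lastP E: (w n.+1) => [|v x]; first by rewrite E in sn.
    rewrite mkseqS /p E last_rcons -IH; congr rcons.
    apply: (@occurs_size xi).
    - by apply: (@occurs_cat _ _ [:: x]); rewrite cats1 -E.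
    - by have [] := wP n.
    - by have [_ ->] := wP n; move: sn; rewrite E size_rcons => -[].
  exists p; split.
    move=> n; have [/occurs_path + _] := wP n.+2.
    rewrite wE !mkseqS -cats1 is_path_cat => /and3P[_ + _].
    case: (mkseq p n) => [|y s] /=; first by rewrite in_setE.
    by rewrite last_rcons in_setE.
  move=> be; split=> [ob|->].
    by rewrite -wE; apply: (occurs_size ob); have [] := wP (size be).
  by rewrite -wE; have [] := wP (size be).
left.
have bound al : occurs xi al -> (size al < n0)%N.
  by move=> o; rewrite ltnNge; apply/negP => le; apply: noN; exists al.
have [n [[al oal nE] nmax]] : exists n, (exists2 al, occurs xi al & size al = n) /\
    forall be, occurs xi be -> (size be <= n)%N.
  elim: n0 {noN} bound => [|n IH] bound; first by have := bound _ (occurs0 xi).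
  have [[al oa sa]|no] := pselect (exists2 al, occurs xi al & size al = n).
    by exists n; split; [exists al|move=> be /bound].
  apply: IH => be ob; have := bound _ ob; rewrite ltnS leq_eqVlt => /orP[/eqP E|//].
  by case: no; exists be.
exists al; split; first exact: occurs_path oal.
move=> be; split=> [ob|/prefixP[ga E]]; last by apply: (@occurs_cat _ _ ga); rewrite -E.
have [//|/prefixP[ga E]] := occurs_linear ob oal.
have := nmax _ ob; rewrite E size_cat nE -[leqRHS]addn0 leq_add2l leqn0.
by move=> /nilP->; rewrite cats0 prefix_refl.
Qed.

Lemma word_uniq xi al be : has_word xi al -> has_word xi be -> al = be.
Proof.
have occ ga : has_word xi ga -> occurs xi ga.
  by move=> [_ h]; apply/h/prefix_refl.
move=> ha hb; have [oa ob] := (occ _ ha, occ _ hb).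
apply: (occurs_size oa ob); apply/eqP; rewrite eqn_leq.
by rewrite !size_prefix //; [apply/ha.2|apply/hb.2].
Qed.

Lemma infword_occurs xi p n : has_infword xi p -> occurs xi (mkseq p n).
Proof. by move=> [_ h]; apply/h; rewrite size_mkseq. Qed.

Lemma infword_uniq xi p q : has_infword xi p -> has_infword xi q -> p = q.
Proof.
move=> hp hq; apply/funext => n.
have := (hq.2 _).1 (infword_occurs n.+1 hp); rewrite size_mkseq !mkseqS.
by move=> /rcons_inj[].
Qed.

Lemma word_infword xi al p : has_word xi al -> ~ has_infword xi p.
Proof.
move=> [_ ha] hp; have /ha/size_prefix := infword_occurs (size al).+1 hp.
by rewrite size_mkseq ltnn.
Qed.

(** At a proper prefix of the word of a filter the sets are known: those which
    contain the source of the next edge. So only the last fiber of a finite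
    word carries information. *)
Lemma ev_proper_prefix xi al e ga A : occurs xi (al ++ e :: ga) ->
  es_valid (al, A) -> ev xi (es al A) = `[< A (src e) >].
Proof.
by move=> [C [_ xC]] vA; have [h1 h2] := ev_trunc xC vA; apply/idP/asboolP.
Qed.

Lemma infword_ext xi eta p : has_infword xi p -> has_infword eta p -> xi = eta.
Proof.
move=> hx he; apply: ev_inj; apply/funext => x.
case: (esP x) => [|al A vA].
  by rewrite !ev_None.
have [al_p|al_p] := pselect (al = mkseq p (size al)).
  have o ze : has_infword ze p -> occurs ze (al ++ [:: p (size al)]).
    by move=> h; rewrite cats1 {1}al_p -mkseqS; apply: infword_occurs.
  by rewrite (ev_proper_prefix (o _ hx) vA) (ev_proper_prefix (o _ he) vA).
have no ze : has_infword ze p -> ev ze (es al A) = false.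
  by move=> h; apply/negP => zA; apply/al_p/h.2; exists A.
by rewrite !no.
Qed.

Lemma word_ext xi eta al : has_word xi al -> has_word eta al ->
  fiber xi al = fiber eta al -> xi = eta.
Proof.
move=> hx he fE; apply: ev_inj; apply/funext => x.
case: (esP x) => [|be A vA].
  by rewrite !ev_None.
have [/prefixP[ga E]|npre] := boolP (prefix be al); last first.
  have no ze : has_word ze al -> ev ze (es be A) = false.
    move=> h; apply/negP => zA; move/negP: npre; apply; apply/h.2.
    by exists A.
  by rewrite !no.
have o (ze : tight G) : has_word ze al -> occurs ze al by move=> h; apply/h.2/prefix_refl.
case: ga E => [|e ga] E; last first.
  have [ox oe] := (o _ hx, o _ he); rewrite E in ox oe.
  by rewrite (ev_proper_prefix ox vA) (ev_proper_prefix oe vA).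
rewrite cats0 in E; subst be.
have fEA := congr1 (fun X => X A) fE; rewrite /fiber /= in fEA.
have [_ bA _ _] := vA.
apply/idP/idP => [xA|eA].
  by have [] : bset A /\ tset eta (es al A) by rewrite -fEA.
by have [] : bset A /\ tset xi (es al A) by rewrite fEA.
Qed.

Lemma occurs_up e ze be : ev ze (es [::] (rng e)) ->
  occurs (up e ze) be <-> be = [::] \/ exists2 be', be = e :: be' & occurs ze be'.
Proof.
move=> ze_e; split.
  case: be => [|f be] [A [vA]]; first by left.
  rewrite tsetE /= upE //= conj_ssE //; case: eqP => [->|_] zA; last by rewrite ev_None in zA.
  by right; exists be => //; exists A; split=> //; apply: ev_valid zA.
case=> [->|[be' -> [A [vA zA]]]]; first exact: occurs0.
have [_ bA _ /setIidPl sA] := vA.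
have : ev (up e ze) (es (e :: be') (A `&` prange (e :: be'))).
  by rewrite ev_cons // up_dom ?upK //= sA.
by move=> uA; exists (A `&` prange (e :: be')); split=> //; apply: ev_valid uA.
Qed.

Lemma has_word_up e ze al : ev ze (es [::] (rng e)) -> has_word ze al ->
  has_word (up e ze) (e :: al).
Proof.
move=> ze_e [pa ha]; split.
  apply: (@occurs_path (up e ze)); apply/occurs_up => //; right.
  by exists al => //; apply/ha/prefix_refl.
move=> be; split=> [/occurs_up[//|->|[be' -> /ha]]|]; rewrite ?prefix0s //=.
  by rewrite eqxx.
case: be => [|f be] /=; first by move=> _; apply: occurs0.
move=> /andP[/eqP-> p]; apply/occurs_up => //; right; exists be => //; exact/ha.
Qed.

Lemma has_infword_up e ze p : ev ze (es [::] (rng e)) -> has_infword ze p ->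
  has_infword (up e ze) (cat_inf [:: e] p).
Proof.
move=> ze_e hp; have [ip _] := hp.
have mkE n : mkseq (cat_inf [:: e] p) n.+1 = e :: mkseq p n.
  by rewrite /mkseq /= -[1%N]add1n iotaDl -map_comp.
split.
  case=> [|n] /=; last exact: ip.
  have : occurs (up e ze) [:: e; p 0%N].
    by apply/occurs_up => //; right; exists [:: p 0%N] => //; apply: (infword_occurs 1 hp).
  by move=> /occurs_path /= /andP[]; rewrite in_setE.
move=> be; split=> [/occurs_up[//|->//|[be' -> /hp.2 E]]|E].
  by rewrite [size _]/= mkE -E.
apply/occurs_up => //; rewrite E; case: (size be) => [|n]; first by left.
by right; exists (mkseq p n); [exact: mkE|exact: infword_occurs].
Qed.

Lemma has_word_ups be ze al : prependable be ze -> has_word ze al ->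
  has_word (ups be ze) (be ++ al).
Proof.
move=> pb h; elim: be pb => //= e be IH pb.
by apply: has_word_up; [exact: prependable_up|exact/IH/(prependable_behead pb)].
Qed.

Lemma has_infword_ups be ze p : prependable be ze -> has_infword ze p ->
  has_infword (ups be ze) (cat_inf be p).
Proof.
move=> pb h; elim: be pb => //= e be IH pb.
apply: (@has_infword_up e _ (cat_inf be p)); first exact: prependable_up.
exact/IH/(prependable_behead pb).
Qed.

Lemma fiber_ups be ze e al : prependable be ze ->
  fiber (ups be ze) (be ++ e :: al) = fiber ze (e :: al).
Proof.
move=> pb; have E A : bset A -> A `<=` prange (e :: al) ->
    ev (ups be ze) (es (be ++ e :: al) A) = ev ze (es (e :: al) A).
  move=> bA /setIidPl sA; have := ev_ups_cat (e :: al) pb bA.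
  by rewrite prange_cat sA.
apply/seteqP; split=> A [bA xA]; split=> //; have [_ _ _ sA] := ev_valid xA.
  by rewrite tsetE /= -E // -(prange_cat be).
by rewrite tsetE /= E.
Qed.

Lemma fiber_ups0 be ze : prependable be ze ->
  fiber (ups be ze) be = [set A | fiber ze [::] A /\ A `<=` prange be].
Proof.
move=> pb; apply/seteqP; split=> A /=.
  move=> [bA xA]; have [_ _ _ sA] := ev_valid xA; split=> //; split=> //.
  by have /setIidPl E := sA; rewrite tsetE /= -(ev_ups pb) // E.
move=> [[bA zA] sA]; split=> //.
by have /setIidPl E := sA; rewrite tsetE /= -E ev_ups.
Qed.

End Words.

(** * The partial action through shifts *)

Section Degrees.
Variable G : ultragraph.
Local Notation path := (seq (edge G)).
Local Notation FG := (freeGroup (edge G)).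
Implicit Types (al be ga : path) (A B C : set (vertex G)).
Implicit Types (e f : edge G) (xi eta ze : tight G) (t : FG).

Definition pos al : seq (letter (edge G)) := [seq (e, true) | e <- al].
Definition neg al : seq (letter (edge G)) := [seq (e, false) | e <- rev al].

Definition deg al : FG := foldr (fun e t => fggen e * t)%g 1%g al.

Lemma fgwordM t u : fgword (t * u)%g = wmul (fgword t) (fgword u).
Proof. by []. Qed.

Lemma fgwordV t : fgword t^-1%g = winv (fgword t).
Proof. by []. Qed.

Lemma deg_cat al be : deg (al ++ be) = (deg al * deg be)%g.
Proof. by elim: al => [|e al IH] /=; rewrite ?mul1g // IH mulgA. Qed.

Lemma deg_rcons al b : deg (rcons al b) = (deg al * fggen b)%g.
Proof. by rewrite -cats1 deg_cat /= mulg1. Qed.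

Lemma fgword_deg al : fgword (deg al) = pos al.
Proof. by elim: al => //= e al ->; case: al => //= f al; rewrite xpair_eqE andbF. Qed.

Lemma fgword_degV al : fgword (deg al)^-1%g = neg al.
Proof.
by rewrite fgwordV /winv fgword_deg -map_comp -map_rev.
Qed.

Lemma wmul_cat (u v : seq (letter (edge G))) : reduced (u ++ v) -> wmul u v = u ++ v.
Proof.
elim: u => //= x u IH ruv; rewrite IH ?(reduced_behead ruv) //.
by move: ruv => /=; case: (u ++ v) => //= y w /andP[/negPf->].
Qed.

Lemma reduced_sign b (s : path) : reduced [seq (e, b) | e <- s].
Proof.
case: s => //= e s; elim: s e => //= f s IH e; rewrite IH andbT.
by case: b {IH}; rewrite /linv xpair_eqE negb_and /= ?orbT.
Qed.

Lemma reduced_cat (u v : seq (letter (edge G))) x y :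
  reduced (rcons u x) -> reduced (y :: v) -> y != linv x ->
  reduced (rcons u x ++ y :: v).
Proof.
case: u => [|z u] /=; first by move=> _ -> ->.
by rewrite cat_path last_rcons /= => -> -> ->.
Qed.

(** Cancelling a common end brings [al be^-1] to its reduced form. *)
Lemma deg_reduced al be : exists al' be' ga,
  [/\ al = al' ++ ga, be = be' ++ ga,
      (deg al * (deg be)^-1 = deg al' * (deg be')^-1)%g &
      fgword (deg al' * (deg be')^-1)%g = pos al' ++ neg be'].
Proof.
have word al' be' : reduced (pos al' ++ neg be') ->
    fgword (deg al' * (deg be')^-1)%g = pos al' ++ neg be'.
  by move=> r; rewrite fgwordM fgword_degV fgword_deg wmul_cat.
elim/last_ind: al be => [|al a IH] be.
  by exists [::], be, [::]; split; [by []|by rewrite cats0|by []|apply/word/reduced_sign].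
case/lastP: be => [|be b].
  exists (rcons al a), [::], [::]; split;
    [by rewrite cats0|by rewrite cats0|by []|apply: word].
  by rewrite cats0; apply: reduced_sign.
have [->|ab] := eqVneq a b.
  have [al' [be' [ga [Ea Eb E wE]]]] := IH be.
  exists al', be', (rcons ga b); split.
  - by rewrite Ea rcons_cat.
  - by rewrite Eb rcons_cat.
  - by rewrite -E !deg_rcons invgM -!mulgA (mulgA (fggen b)) mulgV mul1g.
  - exact: wE.
exists (rcons al a), (rcons be b), [::]; split;
    [by rewrite cats0|by rewrite cats0|by []|apply: word].
have := @reduced_sign true (rcons al a); have := @reduced_sign false (rev (rcons be b)).
rewrite /pos /neg rev_rcons /= !map_rcons => rb ra; apply: reduced_cat => //.
by rewrite /linv xpair_eqE negb_and eq_sym ab.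
Qed.

Lemma pos_neg_inj al be al' be' :
  pos al ++ neg be = pos al' ++ neg be' -> al = al' /\ be = be'.
Proof.
have fpos b u v : [seq x.1 | x <- pos u ++ neg v & x.2 == b] =
    if b then u else rev v.
  rewrite filter_cat map_cat /pos /neg !filter_map /=.
  have F1 c (s : path) :
      [seq x.1 | x <- [seq (e, c) | e <- [seq e <- s | c == b]]] =
      if c == b then s else [::].
    by case: (c == b); rewrite ?filter_predT ?filter_pred0 // -map_comp map_id.
  by rewrite !F1; case: b {F1}; rewrite ?cats0.
move=> E; split; first by rewrite -(fpos true al be) E fpos.
by apply: (can_inj revK); rewrite -[LHS](fpos false al be) E fpos.
Qed.

Lemma reduced_form_uniq t al be al' be' :
  reduced_form t al be -> reduced_form t al' be' -> al = al' /\ be = be'.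
Proof. by move=> [_ _ _ E] [_ _ _ E']; apply: pos_neg_inj; rewrite -E -E'. Qed.

Lemma reduced_form_inv t al be : reduced_form t al be -> reduced_form t^-1%g be al.
Proof.
move=> [pa pb ne E]; split=> //; first by rewrite setIC.
rewrite fgwordV E /winv map_cat rev_cat -!map_rev revK -!map_comp.
by [].
Qed.

Lemma reduced_form_bset t al be : t <> 1%g -> reduced_form t al be ->
  bset (prange al `&` prange be).
Proof.
move=> t1 [_ _ _ E]; case: al E => [|a al] E; last first.
  by apply: bset_prangeI; apply/bset_gv/gvset_rng.
rewrite setIC; apply: bset_prangeI; case: be E => [|b be] E.
  by case: t1; apply: val_inj.
exact/bset_gv/gvset_rng.
Qed.

(** For [t = al be^-1] the partial map of index [t^-1] deletes [al] and prepends
    [be]. Once its argument is written as [ups al ze], the three cases of its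
    definition are told apart only by the word of [ze], and their conditions
    determine the image because a tight filter is determined by its word and
    last fiber. *)
Lemma pa_map_ups t al be ze : t <> 1%g -> reduced_form t al be ->
  ev ze (es [::] (prange al `&` prange be)) ->
  pa_dom t (ups al ze) /\ pa_map t^-1%g (ups al ze) = ups be ze.
Proof.
move=> t1 rt zab; have bab := reduced_form_bset t1 rt.
have [pa pb neab E] := rt.
have pra : prependable al ze.
  split=> // al0; apply: (ev_up0 zab) => [v []//|]; exact: bset_prange.
have prb : prependable be ze.
  split=> // be0; apply: (ev_up0 zab) => [v []//|]; exact: bset_prange.
have dom : pa_dom t (ups al ze).
  right; exists al, be; split=> //; rewrite /V_ /= tsetE /=.
  have -> : prange al `&` prange be = (prange al `&` prange be) `&` prange al.
    by rewrite setIAC setIid.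
  by rewrite ev_ups.
split=> //; rewrite /pa_map.
have -> : (t^-1 == 1)%g = false by rewrite invg_eq1; apply/eqP.
have fibE al' be' : prependable al' ze -> prependable be' ze ->
    prange al' `&` prange be' = prange al `&` prange be ->
    fiber (ups be' ze) be' = [set A `&` prange be' | A in
      [set A | bset A /\ exists2 C, fiber (ups al' ze) al' C & C `<=` A]].
  move=> pa' pb' ab; rewrite !fiber_ups0 //; apply/seteqP; split=> A /=.
    move=> [[bA zA] /setIidPl sA]; exists A => //; split=> //.
    exists (A `&` (prange al' `&` prange be')); last exact: subIsetl.
    split; last by move=> v [_ []].
    by rewrite ab; split; [exact: bsetI|exact: ev_meet].
  move=> [B [bB [C [[bC zC] sC] CB]] <-]; split; last exact: subIsetr.
  split; first exact: bset_prangeI.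
  have zB : ev ze (es [::] B) by apply: (ev_up0 zC).
  have := ev_meet zB zab; rewrite -ab => zBab.
  apply: (ev_up0 zBab); first by move=> v [? []].
  exact: bset_prangeI.
have gr : pa_graph t^-1%g (ups al ze) (ups be ze).
  split; first by rewrite invgK.
  exists be, al; split; first exact: reduced_form_inv.
  have [[[|e ga] h]|[p h]] := word_exists ze.
  - have := has_word_ups pra h; have := has_word_ups prb h; rewrite !cats0.
    by move=> wb wa; apply: Or33; split=> //; exact: fibE.
  - apply: Or32; exists (e :: ga); split=> //; try exact: has_word_ups.
    by rewrite !fiber_ups.
  - by apply: Or31; exists p; split; apply: has_infword_ups.
case: xgetP => [eta -> [_ [be' [al' [rt' C]]]]|]; last by move=> /(_ _ gr).
have [eb ea] := reduced_form_uniq rt' (reduced_form_inv rt); subst be' al'.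
have [_ [be' [al' [rt'' C']]]] := gr.
have [eb ea] := reduced_form_uniq rt'' (reduced_form_inv rt); subst be' al'.
case: C => [[p [xp ep]]|[ga [ga0 xga ega fga]]|[xal ebe fbe]];
  case: C' => [[p' [xp' ep']]|[ga' [ga0' xga' ega' fga']]|[xal' ebe' fbe']];
  try by [case: (word_infword xga' xp)|case: (word_infword xal' xp)
         |case: (word_infword xga xp')|case: (word_infword xal xp')].
- apply: (infword_ext ep); suff -> : p = p' by [].
  have /(congr1 (fun q n => q (size al + n)%N)) := infword_uniq xp xp'.
  have catE q : (fun n => cat_inf al q (size al + n)%N) = q.
    by apply/funext => n; elim: (al).
  by rewrite !catE.
- have eg := cat_injr (word_uniq xga xga'); subst ga'.
  by apply: (word_ext ega ega'); rewrite fga fga'.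
- have := word_uniq xga xal'; rewrite -[RHS]cats0 => /(@cat_injr _ al) eg.
  by case: ga0.
- have := word_uniq xal xga'; rewrite -[LHS]cats0 => /(@cat_injr _ al) eg.
  by case: ga0'.
- by apply: (word_ext ebe ebe'); rewrite fbe fbe'.
Qed.

End Degrees.

(** * A representation by partial shifts *)

Section LinearOperators.
Variables (R : comPzRingType) (M : lmodType R).

Definition linop_pred : {pred M -> M} := fun T => `[< linear T >].

Lemma linop_submod : submod_closed linop_pred.
Proof.
split=> [|a S T /asboolP lS /asboolP lT]; apply/asboolP => b x y.
  have E z : (0 : M -> M) z = 0 by [].
  by rewrite !E scaler0 addr0.
have E z : (a *: S + T : M -> M) z = a *: S z + T z by [].
by rewrite !E lS lT !scalerDr !scalerA (mulrC a b) addrACA.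
Qed.

HB.instance Definition _ :=
  GRing.isSubmodClosed.Build R (M -> M) linop_pred linop_submod.

(** The endomorphisms of a module, as a non-unital algebra under composition. *)
Record linop : Type := LinOp {
  linop_fun :> M -> M;
  _ : linop_fun \in linop_pred
}.

HB.instance Definition _ := [isSub for linop_fun].
HB.instance Definition _ := [Choice of linop by <:].
HB.instance Definition _ := [SubChoice_isSubLmodule of linop by <:].

Lemma linopP (T : linop) : linear T.
Proof. by case: T => T h; apply/asboolP. Qed.

Lemma linop_comp_subproof (S T : linop) : (S \o T) \in linop_pred.
Proof. by apply/asboolP => a x y /=; rewrite !linopP. Qed.

Definition linop_comp (S T : linop) : linop := LinOp (linop_comp_subproof S T).

Lemma linopE (S T : linop) : (forall x, S x = T x) -> S = T.
Proof. by move=> E; apply/val_inj/funext. Qed.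

Lemma linopD (S T : linop) x : (S + T) x = S x + T x. Proof. by []. Qed.

Lemma linop_applyD (S : linop) x y : S (x + y) = S x + S y.
Proof. by have := linopP S 1 x y; rewrite !scale1r. Qed.

Lemma linop_apply0 (S : linop) : S 0 = 0.
Proof. by apply: (addIr (S 0)); rewrite -linop_applyD !add0r. Qed.

Lemma linop_applyZ (S : linop) a x : S (a *: x) = a *: S x.
Proof. by have := linopP S a x 0; rewrite linop_apply0 !addr0. Qed.

Lemma linop_compA : associative linop_comp.
Proof. by move=> S T U; apply: linopE. Qed.
Lemma linop_compDl : left_distributive linop_comp +%R.
Proof. by move=> S T U; apply: linopE. Qed.
Lemma linop_compDr : right_distributive linop_comp +%R.
Proof. by move=> S T U; apply: linopE => x; apply: linop_applyD. Qed.
Lemma linop_compZl a S T : linop_comp (a *: S) T = a *: linop_comp S T.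
Proof. exact: linopE. Qed.
Lemma linop_compZr a S T : linop_comp S (a *: T) = a *: linop_comp S T.
Proof. by apply: linopE => x; apply: linop_applyZ. Qed.

HB.instance Definition _ := Lmodule_isNuAlgebra.Build R linop
  linop_compA linop_compDl linop_compDr linop_compZl linop_compZr.

Lemma linopM (S T : linop) x : (numul S T) x = S (T x). Proof. by []. Qed.

End LinearOperators.

Section WeightedShifts.
Variables (R : comPzRingType) (X : Type).
Local Notation M := (X -> R^o).
Implicit Types (c d : X -> bool) (f g : X -> X) (h : M).

Lemma partial_shift_subproof (c : X -> bool) (f : X -> X) :
  (fun (h : M) x => if c x then h (f x) else 0) \in @linop_pred R M.
Proof.
apply/asboolP => a h k; apply/funext => x.
rewrite -[LHS]/(if c x then a * h (f x) + k (f x) else 0 : R).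
rewrite -[RHS]/(a * (if c x then h (f x) else 0) + (if c x then k (f x) else 0) : R).
by case: (c x); rewrite // mulr0 addr0.
Qed.

(** Composition with a partial map: [f] defined on [c]. *)
Definition partial_shift (c : X -> bool) (f : X -> X) : linop M :=
  LinOp (partial_shift_subproof c f).

Lemma partial_shiftE c f h x : partial_shift c f h x = if c x then h (f x) else 0.
Proof. by []. Qed.

Lemma partial_shiftM c f d g :
  numul (partial_shift c f) (partial_shift d g) =
  partial_shift (fun x => c x && d (f x)) (g \o f).
Proof.
apply: linopE => h; apply/funext => x.
by rewrite linopM !partial_shiftE; case: (c x).
Qed.

Lemma eq_partial_shift c f d g : c =1 d -> (forall x, c x -> f x = g x) ->
  partial_shift c f = partial_shift d g.
Proof.
move=> E F; apply: linopE => h; apply/funext => x.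
by rewrite !partial_shiftE -E; case: ifP => // /F->.
Qed.

Lemma partial_shift0 c f : (forall x, ~~ c x) -> partial_shift c f = 0.
Proof.
move=> E; apply: linopE => h; apply/funext => x.
by rewrite partial_shiftE (negPf (E x)).
Qed.

End WeightedShifts.

Section Representation.
Variables (R : comPzRingType) (G : ultragraph).
Local Notation path := (seq (edge G)).
Local Notation FG := (freeGroup (edge G)).
Local Notation X := (FG * tight G)%type.
Implicit Types (al be ga : path) (e f : edge G) (xi eta ze : tight G).

(** The operators attached to the generators, on functions on the product of the
    free group [F] with the tight spectrum: pull back along the partial maps of
    the two shifts. The component in [F] keeps track of degrees. *)
Definition rep_p (A : set (vertex G)) : linop (X -> R^o) :=
  partial_shift _ (fun x : X => ev x.2 (es [::] A)) id.
Definition rep_s e : linop (X -> R^o) :=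
  partial_shift _ (fun x : X => ev x.2 (es [:: e] (rng e)))
    (fun x => ((fggen e)^-1 * x.1, down e x.2)%g).
Definition rep_ss e : linop (X -> R^o) :=
  partial_shift _ (fun x : X => ev x.2 (es [::] (rng e)))
    (fun x => (fggen e * x.1, up e x.2)%g).

Definition rep_gen (g : leavitt_gen G) : linop (X -> R^o) :=
  match g with
  | Gen_p A => rep_p (sval A)
  | Gen_s e => rep_s e
  | Gen_ss e => rep_ss e
  end.

Lemma sum_linop (I : Type) (r : seq I) (F : I -> linop (X -> R^o)) h x :
  (\sum_(i <- r) F i) h x = \sum_(i <- r) F i h x :> R.
Proof.
elim: r => [|i r IH]; first by rewrite !big_nil.
by rewrite !big_cons linopD -IH.
Qed.

Lemma rep_sss e : numul (rep_s e) (rep_ss e) =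
  partial_shift R (fun x : X => ev x.2 (es [:: e] (rng e))) id.
Proof.
rewrite partial_shiftM; apply: eq_partial_shift => [[t xi]|[t xi]] /=.
  by apply: andb_idr => /down_dom.
by case/andP => xe _; rewrite downK // mulgA mulgV mul1g.
Qed.

(** The two relations that need tightness are the union relation, by
    [ev_setU], and the one at a vertex emitting finitely many edges, by
    [ev_emit]; the others hold on all filters. *)
Lemma rep_rel t u : @leavitt_rel R G t u -> nueval rep_gen t = nueval rep_gen u.
Proof.
case=> /=.
- by apply: partial_shift0 => x; rewrite ev_set0.
- move=> A B; rewrite partial_shiftM; apply: eq_partial_shift => // x.
  by rewrite ev_setI //; apply/bset_gv/svalP.
- move=> A B; apply: linopE => h; apply/funext => x.
  have [bA bB] := (bset_gv (svalP A), bset_gv (svalP B)).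
  rewrite -[RHS]/(rep_p (sval A) h x + rep_p (sval B) h x
    - rep_p (sval A `&` sval B) h x : R) !partial_shiftE /= ev_setU // ev_setI //.
  by do 2!case: ev; rewrite /= ?addr0 ?subr0 ?add0r ?subr0 // addrK.
- move=> e; rewrite partial_shiftM; apply: eq_partial_shift => // -[t' xi] /=.
  apply: andb_idl => xe; apply/(ev_src xe) => //; exact/bset_gv/gvset1.
- move=> e; rewrite partial_shiftM; apply: eq_partial_shift => // -[t' xi] /=.
  by apply: andb_idr => /down_dom.
- move=> e; rewrite partial_shiftM; apply: eq_partial_shift => // -[t' xi] /=.
  by rewrite andbb.
- move=> e; rewrite partial_shiftM; apply: eq_partial_shift => // -[t' xi] /=.
  apply: andb_idr => /up_dom xe; apply/(ev_src xe) => //; exact/bset_gv/gvset1.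
- move=> e; rewrite partial_shiftM; apply: eq_partial_shift => -[t' xi] /=.
    by apply: andb_idr => /up_dom.
  by case/andP => xe _; rewrite upK // mulgA mulVg mul1g.
- move=> e f ef; rewrite partial_shiftM; apply: partial_shift0 => -[t' xi] /=.
  by apply/negP => /andP[/up_dom xe xf]; apply: ef; apply: ev_edge_inj xe xf.
- move=> v ne fin.
  have -> : nueval rep_gen (\big[@TAdd R (leavitt_gen G)/TZero R (leavitt_gen G)]_(e
      <- fset_set [set e | src e = v])
      TMul (TGen R (Gen_s e)) (TGen R (Gen_ss e))) =
    \sum_(e <- fset_set [set e | src e = v]) numul (rep_s e) (rep_ss e).
    by elim: (enum_fset _) => [|e s IH]; rewrite ?big_nil ?big_cons //= IH.
  apply: linopE => h; apply/funext => -[t' xi].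
  rewrite sum_linop; under eq_bigr do rewrite rep_sss partial_shiftE /=.
  rewrite partial_shiftE /=; case: ifP => xv.
    have [e ee xe] := ev_emit xv ne fin.
    rewrite (bigD1_seq e) ?fset_uniq //=; last by rewrite in_fset_set // in_setE.
    rewrite xe big1 ?addr0 // => f fe; case: ifP => // xf.
    by rewrite (ev_edge_inj xf xe) eqxx in fe.
  rewrite big1_seq // => e; rewrite in_fset_set // in_setE /= => ee.
  case: ifP => // xe; move: xv; rewrite (_ : ev _ _ = true) //.
  apply/(ev_src xe) => //; exact/bset_gv/gvset1.
Qed.

End Representation.

(** * Monomials *)

Section NuAlgebraTheory.
Variables (R : comPzRingType) (L : nuAlgType R).
Implicit Types x y z : L.

Lemma numul0x x : numul 0 x = 0.
Proof. by rewrite -[X in numul X _](scale0r (0 : L)) numulZl scale0r. Qed.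
Lemma numulx0 x : numul x 0 = 0.
Proof. by rewrite -[X in numul _ X](scale0r (0 : L)) numulZr scale0r. Qed.
Lemma numulNl x y : numul (- x) y = - numul x y.
Proof. by rewrite -(scaleN1r x) numulZl scaleN1r. Qed.
Lemma numulBl x y z : numul (x - y) z = numul x z - numul y z.
Proof. by rewrite numulDl numulNl. Qed.
Lemma numul_sumr (I : Type) (r : seq I) (F : I -> L) x :
  numul x (\sum_(i <- r) F i) = \sum_(i <- r) numul x (F i).
Proof.
elim: r => [|i r IH]; first by rewrite !big_nil numulx0.
by rewrite !big_cons numulDr IH.
Qed.
Lemma numul_suml (I : Type) (r : seq I) (F : I -> L) x :
  numul (\sum_(i <- r) F i) x = \sum_(i <- r) numul (F i) x.
Proof.
elim: r => [|i r IH]; first by rewrite !big_nil numul0x.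
by rewrite !big_cons numulDl IH.
Qed.

Lemma nueval_sum (Y I : Type) (f : Y -> L) (r : seq I) (F : I -> nuterm R Y) :
  nueval f (\big[@TAdd R Y/TZero R Y]_(i <- r) F i) = \sum_(i <- r) nueval f (F i).
Proof.
by elim: r => [|i r IH]; rewrite ?big_nil ?big_cons //= IH.
Qed.

End NuAlgebraTheory.

Section PresentedAlgebra.
Variables (R : comPzRingType) (Y : Type) (rel : nuterm R Y -> nuterm R Y -> Prop).
Local Notation P := (presented rel).
Local Notation pi := (\pi_(presented rel)).

Lemma pi_nueval t : pi t = nueval (@pgen R Y rel) t.
Proof.
elim: t => //= [t <- u <-|t <-|a t <-|t <- u <-].
- by apply/presentedP; apply: NC_add; apply/NC_sym/repr_congr.
- by apply/presentedP; apply: NC_opp; apply/NC_sym/repr_congr.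
- by apply/presentedP; apply: NC_scale; apply/NC_sym/repr_congr.
- by apply/presentedP; apply: NC_mul; apply/NC_sym/repr_congr.
Qed.

Lemma presented_rel t u : rel t u ->
  nueval (@pgen R Y rel) t = nueval (@pgen R Y rel) u.
Proof. by move=> tu; rewrite -!pi_nueval; apply/presentedP/NC_rel. Qed.

Lemma nueval_repr (x : P) : nueval (@pgen R Y rel) (repr x) = x.
Proof. by rewrite -pi_nueval reprK. Qed.

End PresentedAlgebra.

Section LeavittRelations.
Variables (R : comPzRingType) (G : ultragraph).
Local Notation L := (leavitt R G).
Local Notation p := (leavitt_p R).
Local Notation s := (leavitt_s R).
Local Notation ss := (leavitt_ss R).
Implicit Types (A B : gvtype G) (e f : edge G) (x : L).

Lemma leavitt_p_ext A B : sval A = sval B -> p A = p B.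
Proof.
case: A B => [A hA] [B hB] /= AB; subst B.
by congr (leavitt_p R (exist _ _ _)); apply: Prop_irrelevance.
Qed.

Lemma leavitt_p0 A : sval A = set0 -> p A = 0.
Proof.
by move=> A0; rewrite (@leavitt_p_ext A (gv0 G)) //; apply: (presented_rel (@L_p0 R G)).
Qed.

Lemma leavitt_pI A B : numul (p A) (p B) = p (gvI A B).
Proof. exact: (presented_rel (L_pI R A B)). Qed.

Lemma leavitt_pU A B : p (gvU A B) = p A + p B - p (gvI A B).
Proof. exact: (presented_rel (L_pU R A B)). Qed.

Lemma leavitt_src_s e : numul (p (gv1 (src e))) (s e) = s e.
Proof. exact: (presented_rel (L_srcs R e)). Qed.

Lemma leavitt_s_rng e : numul (s e) (p (gvr e)) = s e.
Proof. exact: (presented_rel (L_srng R e)). Qed.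

Lemma leavitt_rng_ss e : numul (p (gvr e)) (ss e) = ss e.
Proof. exact: (presented_rel (L_rngss R e)). Qed.

Lemma leavitt_ss_src e : numul (ss e) (p (gv1 (src e))) = ss e.
Proof. exact: (presented_rel (L_sssrc R e)). Qed.

Lemma leavitt_ss_s e : numul (ss e) (s e) = p (gvr e).
Proof. exact: (presented_rel (L_sss R e)). Qed.

Lemma leavitt_ss_s0 e f : e <> f -> numul (ss e) (s f) = 0.
Proof. by move=> ef; exact: (presented_rel (L_sss0 R ef)). Qed.

Lemma leavitt_emit (v : vertex G) : [set e | src e = v] !=set0 ->
  finite_set [set e | src e = v] ->
  p (gv1 v) = \sum_(e <- fset_set [set e | src e = v]) numul (s e) (ss e).
Proof.
move=> ne fin; have := presented_rel (L_emit R ne fin).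
by rewrite nueval_sum.
Qed.

Lemma leavitt_pI_sub A B : sval A `<=` sval B -> numul (p A) (p B) = p A.
Proof.
by move=> /setIidPl AB; rewrite leavitt_pI; apply: leavitt_p_ext.
Qed.

Lemma leavitt_pC A B : numul (p A) (p B) = numul (p B) (p A).
Proof. by rewrite !leavitt_pI; apply: leavitt_p_ext; apply: setIC. Qed.

Lemma leavitt_p_s A e :
  numul (p A) (s e) = if `[< sval A (src e) >] then s e else 0.
Proof.
rewrite -leavitt_src_s numulA leavitt_pI; case: asboolP => As.
  congr numul; apply: leavitt_p_ext; apply/seteqP; split=> [v []//|v /= ->].
  by split.
rewrite leavitt_p0 ?numul0x //; apply/seteqP; split=> // v /= [Av vE].
by rewrite vE in Av.
Qed.

Lemma leavitt_ss_p A e :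
  numul (ss e) (p A) = if `[< sval A (src e) >] then ss e else 0.
Proof.
rewrite -leavitt_ss_src -numulA leavitt_pI; case: asboolP => As.
  congr numul; apply: leavitt_p_ext; apply/seteqP; split=> [v []//|v /= ->].
  by split.
rewrite leavitt_p0 ?numulx0 //; apply/seteqP; split=> // v /= [vE Av].
by rewrite vE in Av.
Qed.

End LeavittRelations.

Section Monomials.
Variables (R : comPzRingType) (G : ultragraph).
Local Notation L := (leavitt R G).
Local Notation p := (leavitt_p R).
Local Notation s := (leavitt_s R).
Local Notation ss := (leavitt_ss R).
Local Notation path := (seq (edge G)).
Implicit Types (A B : gvtype G) (e f : edge G) (x y : L) (al be ga : path).

Definition lmul_path al x : L := foldr (fun e x => numul (s e) x) x al.
Definition rmul_path be x : L := foldr (fun e x => numul x (ss e)) x be.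

(** The monomial [s_al p_A s_be^*]. *)
Definition mon (m : path * gvtype G * path) : L :=
  lmul_path m.1.1 (rmul_path m.2 (p m.1.2)).

Lemma lmul_pathA al x y : numul (lmul_path al x) y = lmul_path al (numul x y).
Proof. by elim: al => //= e al IH; rewrite -numulA IH. Qed.

Lemma rmul_pathA be x y : numul x (rmul_path be y) = rmul_path be (numul x y).
Proof. by elim: be => //= e be IH; rewrite numulA IH. Qed.

Lemma lmul_rmul al be x : lmul_path al (rmul_path be x) = rmul_path be (lmul_path al x).
Proof. by elim: al => //= e al ->; rewrite rmul_pathA. Qed.

Lemma lmul_path_cat al be x : lmul_path (al ++ be) x = lmul_path al (lmul_path be x).
Proof. exact: foldr_cat. Qed.

Lemma rmul_path_cat al be x : rmul_path (al ++ be) x = rmul_path al (rmul_path be x).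
Proof. exact: foldr_cat. Qed.

Lemma lmul_pathD al x y : lmul_path al (x + y) = lmul_path al x + lmul_path al y.
Proof. by elim: al => //= e al ->; rewrite numulDr. Qed.
Lemma rmul_pathD al x y : rmul_path al (x + y) = rmul_path al x + rmul_path al y.
Proof. by elim: al => //= e al ->; rewrite numulDl. Qed.
Lemma lmul_pathZ al a x : lmul_path al (a *: x) = a *: lmul_path al x.
Proof. by elim: al => //= e al ->; rewrite numulZr. Qed.
Lemma rmul_pathZ al a x : rmul_path al (a *: x) = a *: rmul_path al x.
Proof. by elim: al => //= e al ->; rewrite numulZl. Qed.
Lemma lmul_path0 al : lmul_path al 0 = 0.
Proof. by elim: al => //= e al ->; rewrite numulx0. Qed.
Lemma rmul_path0 al : rmul_path al 0 = 0.
Proof. by elim: al => //= e al ->; rewrite numul0x. Qed.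

Definition lincomb (r : seq (R * (path * gvtype G * path))) : L :=
  \sum_(m <- r) m.1 *: mon m.2.

Definition spanned x : Prop := exists r, x = lincomb r.

Lemma spanned0 : spanned 0.
Proof. by exists [::]; rewrite /lincomb big_nil. Qed.

Lemma spannedD x y : spanned x -> spanned y -> spanned (x + y).
Proof. by move=> [r ->] [r' ->]; exists (r ++ r'); rewrite /lincomb big_cat. Qed.

Lemma spannedZ a x : spanned x -> spanned (a *: x).
Proof.
move=> [r ->]; exists [seq (a * m.1, m.2) | m <- r].
rewrite /lincomb big_map scaler_sumr; apply: eq_bigr => m _.
by rewrite scalerA.
Qed.

Lemma spanned_mon al A be : spanned (mon (al, A, be)).
Proof. by exists [:: (1, (al, A, be))]; rewrite /lincomb big_seq1 scale1r. Qed.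

(** The first letter of the left word absorbs the generator or is cancelled by
    it; if that word is empty, the set [A] or the right word absorbs it. *)
Lemma spanned_gen (g : leavitt_gen G) x :
  spanned x -> spanned (numul (pgen (@leavitt_rel R G) g) x).
Proof.
move=> [r ->]; rewrite /lincomb numul_sumr.
elim: r => [|[a [[al A] be]] r IH]; first by rewrite big_nil; exact: spanned0.
rewrite big_cons numulZr; apply: spannedD IH; apply: spannedZ.
rewrite /mon /=; case: g => [B|e|e].
- rewrite -/(p B); case: al => [|f al] /=.
    rewrite rmul_pathA leavitt_pI; exact: (spanned_mon [::]).
  rewrite numulA leavitt_p_s; case: ifP => _; last by rewrite numul0x; exact: spanned0.
  exact: (spanned_mon (f :: al)).
- exact: (spanned_mon (e :: al)).
- rewrite -/(ss e); case: al => [|f al] /=.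
    rewrite rmul_pathA leavitt_ss_p; case: ifP => _; last first.
      by rewrite rmul_path0; exact: spanned0.
    rewrite -leavitt_rng_ss -[numul _ _]/(rmul_path [:: e] (p (gvr e))) -rmul_path_cat.
    exact: (spanned_mon [::]).
  rewrite numulA; have [->|ef] := eqVneq e f; last first.
    by rewrite leavitt_ss_s0; [rewrite numul0x; exact: spanned0|apply/eqP].
  rewrite leavitt_ss_s; case: al => [|h al] /=.
    rewrite rmul_pathA leavitt_pI; exact: (spanned_mon [::]).
  rewrite numulA leavitt_p_s; case: ifP => _; last by rewrite numul0x; exact: spanned0.
  exact: (spanned_mon (h :: al)).
Qed.

Lemma leavitt_spanned x : spanned x.
Proof.
rewrite -(nueval_repr x).
suff [] : spanned (nueval (@pgen R _ (@leavitt_rel R G)) (repr x)) /\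
  forall y, spanned y ->
    spanned (numul (nueval (@pgen R _ (@leavitt_rel R G)) (repr x)) y) by [].
elim: (repr x) => {x} /= [g||t [IHt IHt'] u [IHu IHu']|t [IHt IHt']|a t [IHt IHt']|
    t [IHt IHt'] u [IHu IHu']]; split=> [|y sy].
- case: g => [A|e|e].
  + exact: (spanned_mon [::] A [::]).
  + rewrite -[pgen _ _]/(s e) -leavitt_s_rng; exact: (spanned_mon [:: e] (gvr e) [::]).
  + rewrite -[pgen _ _]/(ss e) -leavitt_rng_ss; exact: (spanned_mon [::] (gvr e) [:: e]).
- exact: spanned_gen.
- exact: spanned0.
- by rewrite numul0x; exact: spanned0.
- exact: spannedD.
- by rewrite numulDl; apply: spannedD; [exact: IHt'|exact: IHu'].
- by rewrite -scaleN1r; apply: spannedZ.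
- by rewrite numulNl -scaleN1r; apply/spannedZ/IHt'.
- exact: spannedZ.
- by rewrite numulZl; apply/spannedZ/IHt'.
- exact: IHt'.
- by rewrite -numulA; apply/IHt'/IHu'.
Qed.

Lemma leavitt_ind (P : L -> Prop) : P 0 -> (forall x y, P x -> P y -> P (x + y)) ->
  (forall a x, P x -> P (a *: x)) -> (forall m, P (mon m)) -> forall x, P x.
Proof.
move=> P0 PD PZ Pm x; have [r ->] := leavitt_spanned x.
rewrite /lincomb; elim: r => [|m r IH]; first by rewrite big_nil.
by rewrite big_cons; apply: PD => //; apply: PZ.
Qed.

End Monomials.

(** * The transform of a monomial *)

Section Kappa.
Variables (R : comPzRingType) (G : ultragraph).
Local Notation L := (leavitt R G).
Local Notation path := (seq (edge G)).
Local Notation FG := (freeGroup (edge G)).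
Local Notation X := (FG * tight G)%type.
Local Notation M := (X -> R^o).
Implicit Types (A B : gvtype G) (al be ga : path) (e f : edge G).
Implicit Types (xi eta ze : tight G) (x y : L) (h : M).

Lemma rep_exists : exists lam : L -> linop M,
  [/\ linear lam, {morph lam : x y / numul x y} &
      forall g, lam (pgen (@leavitt_rel R G) g) = rep_gen R g].
Proof. by have [lam [? _]] := presented_universal (@rep_rel R G); exists lam. Qed.

Definition lam : L -> linop M := projT1 (cid rep_exists).

Lemma lam_linear : linear lam.
Proof. by rewrite /lam; case: cid => ? []. Qed.
Lemma lamM x y : lam (numul x y) = numul (lam x) (lam y).
Proof. by rewrite /lam; case: cid => ? []. Qed.
Lemma lam_gen g : lam (pgen (@leavitt_rel R G) g) = rep_gen R g.
Proof. by rewrite /lam; case: cid => ? []. Qed.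
Lemma lam0 : lam 0 = 0.
Proof. by have := lam_linear (-1) 0 0; rewrite scaleN1r oppr0 addr0 scaleN1r addNr. Qed.
Lemma lamD x y : lam (x + y) = lam x + lam y.
Proof. by have := lam_linear 1 x y; rewrite !scale1r. Qed.
Lemma lamZ a x : lam (a *: x) = a *: lam x.
Proof. by have := lam_linear a x 0; rewrite lam0 !addr0. Qed.

Lemma lam_p A : lam (leavitt_p R A) = rep_p R (sval A).
Proof. exact: lam_gen. Qed.
Lemma lam_s e : lam (leavitt_s R e) = rep_s R e. Proof. exact: lam_gen. Qed.
Lemma lam_ss e : lam (leavitt_ss R e) = rep_ss R e. Proof. exact: lam_gen. Qed.

Lemma gv_bset A : bset (sval A). Proof. exact/bset_gv/svalP. Qed.

Lemma lam_rmul be A : lam (rmul_path be (leavitt_p R A)) =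
  partial_shift R (fun g : X => is_path be && ev g.2 (es [::] (sval A `&` prange be)))
    (fun g => (deg be * g.1, ups be g.2)%g).
Proof.
have bA := gv_bset A.
elim: be => [|e be IH].
  rewrite lam_p; apply: eq_partial_shift => [g|[t xi] _] /=; first by rewrite setIT.
  by rewrite mul1g.
rewrite lamM {}IH lam_ss partial_shiftM.
apply: eq_partial_shift => [[t xi]|[t xi] _]; last by rewrite /= mulgA.
have bre : bset (rng e) by exact/bset_gv/gvset_rng.
case: be => [|f be]; first by rewrite /= setIT ev_setI.
have -> : is_path [:: e, f & be] = (src f \in rng e) && is_path (f :: be) by [].
set P := is_path (f :: be); rewrite /=; case pf : P; rewrite /= ?andbF //.
case zA : (ev xi _); rewrite /= ?andbF //= andbT.
have pz : prependable (f :: be) xi.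
  split=> // _; apply: (ev_up0 zA) => [v []//|]; exact: bset_prange.
have uf := up_dom (prependable_up pz).
rewrite ?andbT; apply/idP/idP; rewrite in_setE => fe; exact/(ev_src uf bre).
Qed.

Definition mon_set A be : set (vertex G) := sval A `&` prange be.

Lemma mon_set_bset A be : bset (mon_set A be).
Proof. exact/bset_prangeI/gv_bset. Qed.

(** How the monomial [s_al p_A s_be^*] acts: it replaces the beginning [al] of a
    filter by [be]. *)
Lemma lam_mon al A be : lam (mon R (al, A, be)) =
  partial_shift R
    (fun g : X => is_path be && ev g.2 (es al (mon_set A be `&` prange al)))
    (fun g => (deg be * (deg al)^-1 * g.1, ups be (downs al g.2))%g).
Proof.
rewrite /mon /=; elim: al => [|e al IH] /=.
  rewrite lam_rmul; apply: eq_partial_shift => [g|g _] /=; first by rewrite setIT.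
  by rewrite invg1 mulg1.
rewrite lamM IH lam_s partial_shiftM.
apply: eq_partial_shift => [[t xi]|[t xi] _] /=.
  by have /= -> := ev_cons xi e al (mon_set_bset A be); rewrite andbCA.
by rewrite invgM !mulgA.
Qed.

Definition unit_delta : M := fun g => if g.1 == 1%g then 1 else 0.

(** The function on [F x T] whose restriction to the groupoid is [kappa x]: since
    the indicator of the units is neutral for convolution, it is obtained by
    letting [x] act on it. *)
Definition kap x : X -> R := lam x unit_delta.

Lemma kapD x y g : kap (x + y) g = kap x g + kap y g.
Proof. by rewrite /kap lamD. Qed.
Lemma kapZ a x g : kap (a *: x) g = a * kap x g.
Proof. by rewrite /kap lamZ. Qed.
Lemma kap0 g : kap 0 g = 0.
Proof. by rewrite /kap lam0. Qed.
Lemma kapM x y : kap (numul x y) = lam x (kap y).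
Proof. by rewrite /kap lamM. Qed.

Lemma kap_mon al A be t xi : kap (mon R (al, A, be)) (t, xi) =
  if [&& t == deg al * (deg be)^-1, is_path be &
         ev xi (es al (mon_set A be `&` prange al))]%g then 1 else 0.
Proof.
rewrite /kap lam_mon partial_shiftE /unit_delta /=.
have -> : (deg be * (deg al)^-1 * t == 1)%g = (t == deg al * (deg be)^-1)%g.
  rewrite -(inj_eq (mulgI (deg al * (deg be)^-1)%g)) mulg1 !mulgA.
  by rewrite -(mulgA _ _ (deg be)) mulVg mulg1 mulgV mul1g.
by case: eqP => _; case: is_path => //=; case: ev.
Qed.

(** Compared with [pa_map_ups], the words [al] and [be] may have a common end,
    which is deleted and prepended again without effect. *)
Lemma mon_pa al A be xi : is_path be ->
  ev xi (es al (mon_set A be `&` prange al)) ->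
  pa_dom (deg al * (deg be)^-1)%g xi /\
  pa_map (deg al * (deg be)^-1)^-1%g xi = ups be (downs al xi).
Proof.
move=> pb xA; have bAb := mon_set_bset A be.
have [dA dK pra] := ev_downs bAb xA.
have [/= pa _ _ _] := ev_valid xA.
set ze := downs al xi in dA dK pra *.
have prb : prependable be ze.
  split=> // b0; apply: (ev_up0 dA) => [v []//|]; exact: bset_prange.
have [al' [be' [ga [Ea Eb -> wE]]]] := deg_reduced al be.
set t := (deg al' * _)%g in wE *.
have ups_t : ups al' (ups ga ze) = xi by rewrite -ups_cat -Ea.
have ups_b : ups be' (ups ga ze) = ups be ze by rewrite -ups_cat -Eb.
have [t1|/eqP t1] := eqVneq t 1%g.
  rewrite t1 in wE *; rewrite invg1 /pa_map eqxx; split; first by left.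
  have [al0 be0] : al' = [::] /\ be' = [::].
    exact: (@pos_neg_inj _ al' be' [::] [::] (esym wE)).
  by rewrite al0 be0 /= in ups_t ups_b; rewrite -ups_t -ups_b.
have rt : reduced_form t al' be'.
  split=> //.
  - by rewrite Ea in pa; exact: is_path_catl pa.
  - by rewrite Eb in pb; exact: is_path_catl pb.
  - case: ga Ea Eb {ups_t ups_b} => [|g ga] Ea Eb.
      rewrite !cats0 in Ea Eb; subst al' be'.
      have [_ _ [u [[_ ub] ua]] _] := ev_valid xA.
      by exists u; split.
    exists (src g); split.
      by move: pa; rewrite Ea is_path_cat => /and3P[_]; rewrite in_setE.
    by move: pb; rewrite Eb is_path_cat => /and3P[_]; rewrite in_setE.
have bab := reduced_form_bset t1 rt.
suff zab : ev (ups ga ze) (es [::] (prange al' `&` prange be')).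
  have [dom mapE] := pa_map_ups t1 rt zab.
  by rewrite ups_t ups_b in dom mapE.
case: ga Ea Eb {ups_t ups_b} => [|g ga] Ea Eb.
  rewrite !cats0 in Ea Eb; subst al' be' => /=.
  have [_ _ [v [[Av bv] av]] _] := ev_valid xA.
  rewrite -(ev_ups pra bab) dK; apply: (ev_up xA) => [u [[Au bu] au]//|].
  by split=> //=; [exact: bset_prangeI|exists v].
have pga : prependable (g :: ga) ze.
  have [pa' Ea'] := pra; rewrite Ea in pa' Ea'; split; first exact: is_path_catr pa'.
  by move=> _; rewrite prange_cat in Ea'; apply: Ea'; case: (al').
apply/(ev_src (up_dom (prependable_up pga)) bab); split.
  by move: pa; rewrite Ea is_path_cat => /and3P[_]; rewrite in_setE.
by move: pb; rewrite Eb is_path_cat => /and3P[_]; rewrite in_setE.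
Qed.

End Kappa.

(** * The map to the Steinberg algebra *)

Section SteinbergFunctions.
Variables (R : comPzRingType) (G : ultragraph).
Local Notation L := (leavitt R G).
Local Notation FG := (freeGroup (edge G)).
Local Notation X := (FG * tight G)%type.
Implicit Types (A B : gvtype G) (al be ga : seq (edge G)) (e f : edge G).
Implicit Types (xi eta ze : tight G) (x y : L) (t : FG) (g k : transf G).

Lemma transf_dom g : pa_dom (tr_grp g) (tr_range g).
Proof. exact: set_mem (valP g). Qed.

Lemma transf_mk t xi : pa_dom t xi -> exists g, set_val g = (t, xi).
Proof.
move=> h; have h' : (t, xi) \in [set x : X | pa_dom x.1 x.2] by rewrite inE.
by exists (exist _ (t, xi) h').
Qed.

Lemma transf_ext g k : tr_grp g = tr_grp k -> tr_range g = tr_range k -> g = k.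
Proof.
move=> E F; apply: val_inj.
by rewrite [LHS]surjective_pairing [RHS]surjective_pairing; congr pair.
Qed.

Lemma transf_nbhsP g (W : set (transf G)) : nbhs g W <->
  exists l, forall k, tr_grp k = tr_grp g ->
    agree l (ev (tr_range g)) (ev (tr_range k)) -> W k.
Proof.
split.
  move=> /initial_nbhsP[V [[V1 V2] /= [V1g /tight_nbhsP[l lV2]] sV] sW].
  exists l => k kg ag; apply/sW/sV; split=> /=; last exact: lV2.
  by rewrite -/(tr_grp k) kg; apply: nbhs_singleton.
move=> [l lW]; apply/initial_nbhsP.
exists ([set tr_grp g] `*` [set eta | agree l (ev (tr_range g)) (ev eta)]).
  exists ([set tr_grp g], [set eta | agree l (ev (tr_range g)) (ev eta)]) => //=.
  by split=> //; apply/tight_nbhsP; exists l.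
by move=> k [/= kg ag]; apply: lW.
Qed.

Lemma slice_compact t (z : ES G) : (forall xi, V_ z xi -> pa_dom t xi) ->
  compact (slice t z).
Proof.
move=> zt; apply: initial_compact.
have -> : set_val @` slice t z = [set t] `*` V_ z.
  apply/seteqP; split=> [_ [g [/= gt gz] <-]|[u xi] [/= -> xiz]]; first by split.
  have [g gE] := transf_mk (zt _ xiz).
  by exists g => //; split; rewrite /tr_grp /tr_range gE.
exact: compact_setX (@compact_set1 _ t) (@compact_V_ G z).
Qed.

Lemma slice_steinberg t (z : ES G) : (forall xi, V_ z xi -> pa_dom t xi) ->
  (\1_(slice t z) : transf G -> R^o) \in @steinberg_pred R (transf G).
Proof.
move=> zt; have lc : locally_constant (\1_(slice t z) : transf G -> R).
  move=> g; apply/transf_nbhsP; exists [:: z] => k kg.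
  rewrite /= andbT => /eqP E; rewrite !indicE; congr ((nat_of_bool _)%:R).
  by apply/idP/idP; rewrite !inE /slice /= kg /V_ /= !tsetE /= E.
apply/asboolP; split=> //.
apply: (subclosed_compact (closed_support lc) (slice_compact zt)) => g /=.
by rewrite indicE; case: (boolP (g \in _)) => [/set_mem//|]; rewrite eqxx.
Qed.

Definition kapr x : transf G -> R := fun g => kap x (set_val g).

Lemma kapr_mon al A be : is_path be ->
  kapr (mon R (al, A, be)) = \1_(slice (deg al * (deg be)^-1)%g
    (es al (mon_set A be `&` prange al))) :> (transf G -> R).
Proof.
move=> pb; apply/funext => g; rewrite /kapr.
have -> : set_val g = (tr_grp g, tr_range g) by rewrite /tr_grp /tr_range; case: set_val.
rewrite kap_mon indicE pb /=; case: ifP => [/andP[/eqP gt gx]|H].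
  by rewrite mem_set //; split.
rewrite memNset // => -[gt gx]; move: H.
by rewrite gt eqxx /= => /negP; apply.
Qed.

Lemma kap_supp x t xi : ~ pa_dom t xi -> kap x (t, xi) = 0.
Proof.
move=> nd; elim/leavitt_ind: x => [|x y xE yE|a x xE|[[al A] be]].
- by rewrite kap0.
- by rewrite kapD xE yE addr0.
- by rewrite kapZ xE mulr0.
rewrite kap_mon; case: ifP => // /and3P[/eqP tE pb xA].
by case: nd; rewrite tE; have [] := mon_pa pb xA.
Qed.

Lemma kapr_steinberg x : (kapr x : transf G -> R^o) \in @steinberg_pred R (transf G).
Proof.
elim/leavitt_ind: x => [|x y xE yE|a x xE|[[al A] be]].
- have -> : kapr 0 = (0 : transf G -> R^o) by apply/funext => g; rewrite /kapr kap0.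
  exact: rpred0.
- have -> : kapr (x + y) = (kapr x : transf G -> R^o) + kapr y.
    by apply/funext => g; rewrite /kapr kapD.
  exact: rpredD.
- have -> : kapr (a *: x) = a *: (kapr x : transf G -> R^o).
    by apply/funext => g; rewrite /kapr kapZ.
  exact: rpredZ.
case pb : (is_path be); last first.
  have -> : kapr (mon R (al, A, be)) = (0 : transf G -> R^o).
    by apply/funext => g; rewrite /kapr; case: set_val => t xi; rewrite kap_mon pb andbF.
  exact: rpred0.
rewrite kapr_mon //; apply: slice_steinberg => xi xA.
by have [] := mon_pa pb xA.
Qed.

Definition kappa_fun x : steinberg R (transf G) := Steinberg (kapr_steinberg x).

Lemma kappa_fun_linear : linear kappa_fun.
Proof.
by move=> a x y; apply/val_inj/funext => g /=; rewrite /kapr kapD kapZ.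
Qed.

HB.instance Definition _ := GRing.isLinear.Build R L (steinberg R (transf G)) _
  kappa_fun kappa_fun_linear.

Lemma kap_lincomb r (z : X) :
  kap (lincomb r) z = \sum_(m <- r) m.1 * kap (mon R m.2) z.
Proof.
rewrite /lincomb; elim: r => [|m r IH]; first by rewrite !big_nil kap0.
by rewrite !big_cons kapD kapZ IH.
Qed.

Lemma lam_lincomb r (h : X -> R^o) (z : X) :
  lam (lincomb r) h z = \sum_(m <- r) m.1 * lam (mon R m.2) h z :> R.
Proof.
rewrite /lincomb; elim: r => [|m r IH]; first by rewrite !big_nil lam0.
by rewrite !big_cons lamD lamZ -IH.
Qed.

Lemma set_valE g : set_val g = (tr_grp g, tr_range g).
Proof. by rewrite /tr_grp /tr_range; case: set_val. Qed.

Lemma tr_mul_det g h k g' h' : tr_mul g h k -> tr_mul g' h' k ->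
  tr_grp g = tr_grp g' -> g = g' /\ h = h'.
Proof.
move=> [s1 m1 r1] [s2 m2 r2] gg'.
have E : g = g' by apply: transf_ext; rewrite // -r1 -r2.
split=> //; subst g'; apply: transf_ext; last by rewrite -s1 -s2.
by apply: (mulgI (tr_grp g)); rewrite -m1 -m2.
Qed.

Definition conv_pairs (s : seq FG) k : set (transf G * transf G) :=
  [set q | tr_mul q.1 q.2 k /\ tr_grp q.1 \in s].

Lemma conv_pairs_finite s k : finite_set (conv_pairs s k).
Proof.
have inj : {in conv_pairs s k &, injective (fun q => tr_grp q.1)}.
  move=> [g h] [g' h'] /set_mem[/= gh _] /set_mem[/= gh' _] E.
  by have [-> ->] := tr_mul_det gh gh' E.
rewrite -(eq_finite_set (inj_card_eq inj)).
by apply: sub_finite_set (finite_seq s) => _ [q [_ qs] <-].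
Qed.

(** Factorizations of [k] are determined by the group component of their first
    factor, so for functions supported over finitely many group elements the
    convolution is a finite sum. *)
Lemma convolution_finite (s : seq FG) (f h : transf G -> R) k :
  (forall g, tr_grp g \notin s -> f g = 0) ->
  convolution (@tr_mul G) f h k =
  \sum_(q <- fset_set (conv_pairs s k)) f q.1 * h q.2.
Proof.
move=> fs; rewrite -fsbig_finite; last exact: conv_pairs_finite.
apply/esym/fsbig_widen => [q [] //|q [qk /= nq]].
rewrite /preimage /= fs ?mul0r //; apply/negP => qs.
by apply: nq; split.
Qed.

Definition mon_deg (m : seq (edge G) * gvtype G * seq (edge G)) : FG :=
  (deg m.1.1 * (deg m.2)^-1)%g.

Lemma kap_mon_deg m t xi : t != mon_deg m -> kap (mon R m) (t, xi) = 0.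
Proof. by case: m => [[al A] be] tm; rewrite kap_mon (negPf tm). Qed.

(** Against a monomial the convolution sum has a single term, since a
    factorization of [k] is determined by the degree of its first factor. *)
Lemma convolution_mon m y k :
  convolution (@tr_mul G) (kapr (mon R m)) (kapr y) k =
  lam (mon R m) (kap y) (set_val k).
Proof.
case: m => [[al A] be]; rewrite lam_mon partial_shiftE set_valE /=.
set xi := tr_range k; set t := (deg al * (deg be)^-1)%g.
have tV : (deg be * (deg al)^-1 = t^-1)%g by rewrite invgM invgK.
rewrite tV.
have zero q : tr_mul q.1 q.2 k -> tr_grp q.1 != t \/
    ~~ (is_path be && ev xi (es al (mon_set A be `&` prange al))) ->
    kapr (mon R (al, A, be)) q.1 * kapr y q.2 = 0.
  move=> [_ _ rk] H; rewrite {1}/kapr set_valE kap_mon -/t -rk -/xi.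
  by case: H => /negPf->; rewrite ?andbF mul0r.
case: ifP => [/andP[pb xA]|H]; last first.
  by apply: fsbig1 => q /zero -> //; right; rewrite H.
have [dom mapE] := mon_pa pb xA; rewrite -/t in dom mapE.
have [g gE] := transf_mk dom.
have [gt gxi] : tr_grp g = t /\ tr_range g = xi by rewrite /tr_grp /tr_range gE.
have kg : kapr (mon R (al, A, be)) g = 1 by rewrite /kapr gE kap_mon eqxx pb xA.
have [dom2|ndom2] := pselect (pa_dom (t^-1 * tr_grp k)%g (ups be (downs al xi))).
  have [h hE] := transf_mk dom2.
  have mul_gh : tr_mul g h k.
    split; rewrite ?gxi //.
      by rewrite /tr_source gt gxi mapE /tr_range hE.
    by rewrite gt /(tr_grp h) hE mulgA mulgV mul1g.
  rewrite /convolution -(@fsbig_widen _ _ _ _ [set (g, h)]); first last.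
  - move=> q [/= qk qgh]; apply: zero => //; left; apply/eqP => qt.
    apply: qgh; have [] := tr_mul_det mul_gh qk; first by rewrite gt.
    by case: (q) => ? ? /= <- <-.
  - by move=> q ->.
  by rewrite fsbig_set1 /= kg mul1r /kapr hE.
rewrite kap_supp //; apply: fsbig1 => q qk; have [qt|] := eqVneq (tr_grp q.1) t; last first.
  by move=> ?; apply: zero => //; left.
case: ndom2; have [sk mk rk] := qk.
have := transf_dom q.2; rewrite -sk /tr_source qt -rk mapE.
by rewrite mk qt mulgA mulVg mul1g.
Qed.

Lemma degrees_exist (r : seq (R * (seq (edge G) * gvtype G * seq (edge G)))) :
  exists s : seq FG, all (fun m => mon_deg m.2 \in s) r.
Proof.
elim: r => [|m r [s IH]]; first by exists [::].
exists (mon_deg m.2 :: s); rewrite /= mem_head; apply: sub_all IH => n.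
by rewrite inE => ->; rewrite orbT.
Qed.

Lemma kappa_convolution x y (k : transf G) :
  kapr (numul x y) k = convolution (@tr_mul G) (kapr x) (kapr y) k.
Proof.
rewrite {1}/kapr kapM; have [r ->] := leavitt_spanned x; rewrite lam_lincomb.
have [s rs] := degrees_exist r.
have deg0 m (g : transf G) : mon_deg m \in s -> tr_grp g \notin s -> kapr (mon R m) g = 0.
  move=> ms gs; rewrite /kapr set_valE; apply: kap_mon_deg.
  by apply: contraNneq gs => ->.
rewrite (@convolution_finite s); last first.
  move=> g gs; rewrite /kapr kap_lincomb.
  elim: r rs => [|m r IH] /=; first by rewrite big_nil.
  move=> /andP[ms /IH rs]; rewrite big_cons rs addr0.
  by have := deg0 _ g ms gs; rewrite /kapr => ->; rewrite mulr0.
under [RHS]eq_bigr do rewrite [kapr (lincomb _) _]kap_lincomb mulr_suml.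
rewrite exchange_big /=.
elim: r rs => [|m r IH] /=; first by rewrite !big_nil.
move=> /andP[ms /IH rs]; rewrite !big_cons rs; congr (_ + _).
rewrite -convolution_mon (@convolution_finite s) ?mulr_sumr.
  by apply: eq_bigr => q _; rewrite mulrA.
by move=> g; apply: deg0.
Qed.

End SteinbergFunctions.

(** * The diagonal *)

Section Diagonal.
Variables (R : comPzRingType) (G : ultragraph).
Local Notation L := (leavitt R G).
Local Notation p := (leavitt_p R).
Local Notation s := (leavitt_s R).
Local Notation ss := (leavitt_ss R).
Local Notation path := (seq (edge G)).
Implicit Types (A B C U : gvtype G) (al be ga : path) (e f : edge G) (x y : L).
Implicit Types (xi eta ze : tight G) (c : R) (v : vertex G).
Implicit Type r : seq (R * (path * gvtype G)).

(** The idempotent of the difference of two sets of [G^0]. *)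
Definition pdiff B U : L := p B - p (gvI B U).

Lemma pdiff_split B U A : pdiff B U = pdiff B (gvU U A) + pdiff (gvI A B) U.
Proof.
rewrite /pdiff (@leavitt_p_ext _ _ (gvI B (gvU U A)) (gvU (gvI B U) (gvI A B))); last first.
  by rewrite /= setIUr [X in _ `|` X]setIC.
rewrite leavitt_pU.
rewrite (@leavitt_p_ext _ _ (gvI (gvI A B) U) (gvI (gvI B U) (gvI A B))); last first.
  by apply/seteqP; split=> v /=; tauto.
set X := p (gvI (gvI B U) _); rewrite !opprD opprK !addrA.
by rewrite [X in _ = X - _]addrAC subrK addrK.
Qed.

Lemma pdiff0 B U : sval B `<=` sval U -> pdiff B U = 0.
Proof.
by move=> /setIidPl BU; rewrite /pdiff (@leavitt_p_ext _ _ (gvI B U) B) // subrr.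
Qed.

Lemma pdiff_pr B U A : numul (pdiff B (gvU U A)) (p A) = 0.
Proof.
rewrite /pdiff numulBl !leavitt_pI.
rewrite (@leavitt_p_ext _ _ (gvI (gvI B (gvU U A)) A) (gvI B A)) ?subrr //=.
by rewrite -setIA setUC setUK.
Qed.

Lemma pdiff_pl B U A : numul (pdiff (gvI A B) U) (p A) = pdiff (gvI A B) U.
Proof.
by rewrite /pdiff numulBl !leavitt_pI_sub // => v [] // [].
Qed.

Lemma pdiff_gv1 v B U : sval B v -> ~ sval U v -> pdiff (gvI (gv1 v) B) U = p (gv1 v).
Proof.
move=> Bv Uv; rewrite /pdiff (leavitt_p0 _ (A := gvI (gvI (gv1 v) B) U)) ?subr0 /=.
  by apply: leavitt_p_ext; apply/seteqP; split=> [u []//|u /= ->].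
by apply/seteqP; split=> // u [[/= -> _]].
Qed.

(** The diagonal monomial [s_ga p_A s_ga^*] and its Gelfand transform. *)
Definition dmon (m : path * gvtype G) : L := mon R (m.1, m.2, m.1).
Definition dsum r : L := \sum_(m <- r) m.1 *: dmon m.2.
Definition dval r xi : R :=
  \sum_(m <- r) if ev xi (es m.2.1 (sval m.2.2 `&` prange m.2.1)) then m.1 else 0.

Lemma dsum_cons m r : dsum (m :: r) = m.1 *: dmon m.2 + dsum r.
Proof. exact: big_cons. Qed.

Lemma dval_cons m r xi : dval (m :: r) xi =
  (if ev xi (es m.2.1 (sval m.2.2 `&` prange m.2.1)) then m.1 else 0) + dval r xi.
Proof. exact: big_cons. Qed.

Lemma dmon_nil A : dmon ([::], A) = p A.
Proof. by []. Qed.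

Lemma dmon_cons e ga A :
  dmon (e :: ga, A) = numul (numul (s e) (dmon (ga, A))) (ss e).
Proof. by rewrite /dmon /mon /= -numulA lmul_pathA. Qed.

Lemma p_dmon_cons C e ga A :
  numul (p C) (dmon (e :: ga, A)) = if `[< sval C (src e) >] then dmon (e :: ga, A) else 0.
Proof.
by rewrite dmon_cons !numulA leavitt_p_s; case: ifP => _; rewrite // !numul0x.
Qed.

Lemma dmon_cons_p C e ga A :
  numul (dmon (e :: ga, A)) (p C) = if `[< sval C (src e) >] then dmon (e :: ga, A) else 0.
Proof.
by rewrite dmon_cons -!numulA leavitt_ss_p; case: ifP => _; rewrite // !numulx0.
Qed.

Lemma p_dmonC C m : numul (p C) (dmon m) = numul (dmon m) (p C).
Proof.
case: m => [[|e ga] A]; last by rewrite p_dmon_cons dmon_cons_p.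
by rewrite dmon_nil leavitt_pC.
Qed.

Lemma p_dsumC C r : numul (p C) (dsum r) = numul (dsum r) (p C).
Proof.
rewrite /dsum numul_sumr numul_suml; apply: eq_bigr => m _.
by rewrite numulZr numulZl p_dmonC.
Qed.

(** [q (c + x)], where the constant [c] stands for a multiple of an identity
    element that [L] need not have. *)
Definition affine c x q : L := c *: q + numul q x.

Lemma affineD c x q q' : affine c x (q + q') = affine c x q + affine c x q'.
Proof. by rewrite /affine scalerDr numulDl addrACA. Qed.

Lemma affine0 c x : affine c x 0 = 0.
Proof. by rewrite /affine scaler0 numul0x addr0. Qed.

Lemma affine_sum c x (I : Type) (l : seq I) (F : I -> L) :
  affine c x (\sum_(i <- l) F i) = \sum_(i <- l) affine c x (F i).
Proof.
elim: l => [|i l IH]; first by rewrite !big_nil affine0.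
by rewrite !big_cons affineD IH.
Qed.

Definition qedge e : L := numul (s e) (ss e).

Lemma qedge_dmon e f ga A : numul (qedge e) (dmon (f :: ga, A)) =
  if f == e then dmon (f :: ga, A) else 0.
Proof.
rewrite /qedge dmon_cons !numulA -(numulA (s e)); case: eqP => [->|fe].
  by rewrite leavitt_ss_s leavitt_s_rng.
by rewrite leavitt_ss_s0; [rewrite numulx0 !numul0x|move=> ef; apply: fe].
Qed.

Definition nonempty_words r := all (fun m => m.2.1 != [::]) r.

Definition tails e r : seq (R * (path * gvtype G)) :=
  [seq (m.1, (behead m.2.1, m.2.2)) | m <- r & ohead m.2.1 == Some e].

Lemma affine_qedge c r e : nonempty_words r ->
  affine c (dsum r) (qedge e) =
  numul (numul (s e) (affine c (dsum (tails e r)) (p (gvr e)))) (ss e).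
Proof.
move=> ner; rewrite /affine numulDr numulDl numulZr leavitt_s_rng numulZl.
congr (_ + _); rewrite numulA leavitt_s_rng /dsum !numul_sumr numul_suml.
rewrite big_map big_filter [RHS]big_mkcond /=.
elim: r ner => [|[a [[//|f ga] A]] r IH] /=; first by rewrite !big_nil.
move=> /IH{}IH; rewrite !big_cons IH; congr (_ + _); rewrite numulZr qedge_dmon /=.
rewrite -[Some f == Some e]/(f == e); case: eqP => [->|_]; last by rewrite scaler0.
by rewrite dmon_cons numulZr numulZl.
Qed.

Lemma ev_up_cons e f ga A ze : ev ze (es [::] (rng e)) ->
  ev (up e ze) (es (f :: ga) (sval A `&` prange (f :: ga))) =
  (f == e) && ev ze (es ga (sval A `&` prange ga)).
Proof.
move=> zee; have := ev_cons (up e ze) f ga (gv_bset A); rewrite /= => ->.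
case: eqP => [->|fe]; first by rewrite up_dom // upK.
by apply/negP => /andP[xf _]; apply: fe; apply: ev_edge_inj xf (up_dom zee).
Qed.

Lemma dval_up e ze r : nonempty_words r -> ev ze (es [::] (rng e)) ->
  dval r (up e ze) = dval (tails e r) ze.
Proof.
move=> ner zee; rewrite /dval big_map big_filter [RHS]big_mkcond /=.
elim: r ner => [|[a [[//|f ga] A]] r IH] /=; first by rewrite !big_nil.
move=> /IH{}IH; rewrite !big_cons IH; congr (_ + _).
have /= -> := ev_up_cons f ga A zee.
by rewrite -[Some f == Some e]/(f == e); case: eqP.
Qed.

Definition heads r : seq (edge G) := pmap (fun m => ohead m.2.1) r.

Definition first_edges v r : seq (edge G) :=
  undup [seq e <- heads r | src e == v].

Lemma dval_first xi r : nonempty_words r ->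
  (forall e, e \in heads r -> ~ ev xi (es [:: e] (rng e))) ->
  dval r xi = 0.
Proof.
elim: r => [|[a [[//|f ga] A]] r IH] /=; first by rewrite /dval big_nil.
move=> ner no; rewrite dval_cons IH //= ?addr0; last first.
  by move=> e er; apply: no; rewrite inE er orbT.
by case: ifP => // /ev_behead xf; case: (no f); rewrite ?mem_head.
Qed.

(** At a vertex, the part of [c + x] not covered by the first edges of [x] is a
    multiple of [p_v - sum s_e s_e^*]; unless this vanishes by the relation at
    [v], some tight filter through [v] avoids these edges and sees [c]. *)
Lemma affine_vertex c r v : nonempty_words r ->
  (forall xi, ev xi (es [::] [set v]) -> c + dval r xi = 0) ->
  (forall e, e \in heads r -> src e = v ->
     affine c (dsum (tails e r)) (p (gvr e)) = 0) ->
  affine c (dsum r) (p (gv1 v)) = 0.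
Proof.
move=> ner val0 IH; pose E := first_edges v r.
have inE' e : (e \in E) = (src e == v) && (e \in heads r).
  by rewrite mem_undup mem_filter.
pose z := p (gv1 v) - \sum_(e <- E) qedge e.
have -> : p (gv1 v) = z + \sum_(e <- E) qedge e by rewrite subrK.
rewrite affineD affine_sum [X in _ + X]big1_seq ?addr0; last first.
  move=> e; rewrite inE' => /andP[_ /andP[/eqP ev' er]].
  by rewrite affine_qedge // IH // numulx0 numul0x.
have zr : numul z (dsum r) = 0.
  suff H r' : nonempty_words r' ->
      (forall e, src e = v -> e \in heads r' -> e \in E) ->
      numul z (dsum r') = 0.
    by apply: H => // e ee er; rewrite inE' ee eqxx.
  elim: r' => [|[a [[//|f ga] A]] r' IHr] /=; first by rewrite /dsum big_nil numulx0.
  move=> ner' sub; rewrite dsum_cons numulDr IHr //= ?addr0; last first.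
    by move=> e ee er; apply: sub => //; rewrite inE er orbT.
  rewrite numulZr /z numulBl p_dmon_cons numul_suml.
  under eq_bigr do rewrite qedge_dmon.
  case: asboolP => /= [fv|fv].
    have fE : f \in E by apply: sub => //; rewrite mem_head.
    rewrite (bigD1_seq f) ?undup_uniq //= eqxx big1 ?addr0 ?subrr ?scaler0 //.
    by move=> e ef; rewrite eq_sym (negPf ef).
  rewrite big1_seq ?subr0 ?scaler0 // => e; rewrite inE' => /andP[_ /andP[/eqP ee _]].
  by case: eqP => // fe; case: fv; rewrite fe.
rewrite /affine zr addr0.
have c0 xi : ev xi (es [::] [set v]) -> (forall e, e \in E -> ~ ev xi (es [:: e] (rng e))) ->
    c = 0.
  move=> xv no; rewrite -(val0 _ xv) dval_first ?addr0 // => e er xe.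
  apply: (no e) => //; rewrite inE' er andbT; apply/eqP.
  exact: (ev_src xe (bset_gv (gvset1 v))).1 xv.
have [[e [ee eE]]|all_E] := pselect (exists e, src e = v /\ e \notin E).
  have [xi xe] := ev_point (es_valid_edge e).
  rewrite (c0 xi) ?scale0r //.
    by apply/(ev_src xe) => //; exact/bset_gv/gvset1.
  by move=> f fE xf; rewrite (ev_edge_inj xe xf) fE in eE.
have [E0|Ene] := eqVneq E [::].
  have [xi xv] : exists xi, ev xi (es [::] [set v]).
    by apply: ev_point; split=> //; [exact/bset_gv/gvset1|exists v].
  by rewrite (c0 xi) ?scale0r // => e; rewrite E0.
have EE : [set e | src e = v] = [set` E].
  apply/seteqP; split=> e /=; last by rewrite inE' => /andP[/eqP].
  by move=> ee; apply/negPn/negP => eE; apply: all_E; exists e.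
have finE : finite_set [set e | src e = v] by rewrite EE; exact: finite_seq.
rewrite /z leavitt_emit //; last first.
  by case: (E) Ene EE => // e E' _ EE; exists e; rewrite EE /= mem_head.
rewrite (perm_big E) ?subrr ?scaler0 //=.
apply: uniq_perm; rewrite ?fset_uniq ?undup_uniq // => e.
by rewrite in_fset_set // EE; apply/idP/idP; rewrite in_setE.
Qed.

(** The statement of [diag_inj]; the constant [c] and the sets [B] and [U] are
    there to make it stable under the splittings of its proof. *)
Definition diag_vanish r : Prop := forall c B U,
  (forall xi, ev xi (es [::] (sval B)) -> ~~ ev xi (es [::] (sval U)) ->
     c + dval r xi = 0) ->
  affine c (dsum r) (pdiff B U) = 0.

(** On [A] the extra term changes the constant, outside [A] it disappears. *)
Lemma vanish_nil a A r : diag_vanish r -> diag_vanish ((a, ([::], A)) :: r).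
Proof.
move=> van c B U val0; rewrite (pdiff_split B U A) affineD.
have [bU bA bB] := And3 (gv_bset U) (gv_bset A) (gv_bset B).
have -> : affine c (dsum ((a, ([::], A)) :: r)) (pdiff B (gvU U A)) =
    affine c (dsum r) (pdiff B (gvU U A)).
  by rewrite /affine dsum_cons numulDr numulZr dmon_nil pdiff_pr scaler0 add0r.
have -> : affine c (dsum ((a, ([::], A)) :: r)) (pdiff (gvI A B) U) =
    affine (c + a) (dsum r) (pdiff (gvI A B) U).
  rewrite /affine dsum_cons numulDr numulZr dmon_nil pdiff_pl scalerDl.
  by rewrite addrA.
rewrite !van ?addr0 // => xi /= xB xU.
  move: xB; rewrite ev_setI // => /andP[xA xB].
  have := val0 _ xB xU; rewrite dval_cons /= setIT xA addrA => <-.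
  by [].
move: xU; rewrite ev_setU // negb_or => /andP[xU xA].
by have := val0 _ xB xU; rewrite dval_cons /= setIT (negPf xA) add0r.
Qed.

Lemma pdiff_pU B U : numul (pdiff B U) (p U) = 0.
Proof.
rewrite /pdiff numulBl !leavitt_pI (@leavitt_p_ext _ _ (gvI (gvI B U) U) (gvI B U)) ?subrr //=.
by rewrite -setIA setIid.
Qed.

Lemma ev_gv1 xi v A : ev xi (es [::] [set v]) -> ev xi (es [::] (sval A)) <-> sval A v.
Proof.
move=> xv; split=> [xA|Av].
  by have [_ _ [u [/= -> //]] _] := ev_valid (ev_meet xv xA).
by apply: (ev_up0 xv) (gv_bset A) => u ->.
Qed.

Lemma ev_gv1_point v : exists xi, ev xi (es [::] [set v]).
Proof. by apply: ev_point; split=> //; [exact/bset_gv/gvset1|exists v]. Qed.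

(** Words without common first edge are separated by their sources, and at
    each of these finitely many vertices by their first edges. *)
Lemma vanish_cons r : nonempty_words r ->
  (forall e, e \in heads r -> diag_vanish (tails e r)) ->
  diag_vanish r.
Proof.
move=> ner van c B U.
suff K (vs : seq (vertex G)) : forall U', (forall xi, ev xi (es [::] (sval B)) ->
      ~~ ev xi (es [::] (sval U')) -> c + dval r xi = 0) ->
    (forall e, e \in heads r -> src e \in vs \/ sval U' (src e)) ->
    affine c (dsum r) (pdiff B U') = 0.
  move=> val0; apply: (K [seq src e | e <- heads r] U) => // e er.
  by left; apply: map_f.
elim: vs => [|v vs IH] {}U val0 srcs.
  have -> : affine c (dsum r) (pdiff B U) = c *: pdiff B U.
    rewrite /affine -[RHS]addr0; congr (_ + _).
    have E : numul (p U) (dsum r) = dsum r.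
      have {}srcs e : e \in heads r -> sval U (src e) by move=> /srcs[].
      rewrite /dsum numul_sumr /heads in srcs *.
      elim: r ner srcs {val0 van} => [|[a [[//|f ga] A]] r IH] /=.
        by rewrite !big_nil.
      move=> ner srcs; rewrite !big_cons IH //; last first.
        by move=> e er; apply: srcs; rewrite inE er orbT.
      congr (_ + _); rewrite numulZr p_dmon_cons.
      by case: asboolP => // -[]; apply: srcs; rewrite mem_head.
    by rewrite -E numulA pdiff_pU numul0x.
  have [BU|/existsNP[u /not_implyP[Bu Uu]]] := pselect (sval B `<=` sval U).
    by rewrite pdiff0 ?scaler0.
  have [xi xu] := ev_gv1_point u.
  have xU : ~~ ev xi (es [::] (sval U)) by apply/negP => /(ev_gv1 U xu).
  have xB : ev xi (es [::] (sval B)) by apply/(ev_gv1 B xu).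
  have := val0 _ xB xU; rewrite dval_first // ?addr0 => [->|e /srcs[//|eU] xe].
    by rewrite scale0r.
  by move/negP: xU; apply; apply/(ev_src xe (gv_bset U)).
rewrite (pdiff_split B U (gv1 v)) affineD IH ?add0r; last 2 first.
- move=> xi xB; rewrite ev_setU; [|exact: gv_bset|exact: (gv_bset (gv1 v))].
  by rewrite negb_or => /andP[xU _]; exact: val0.
- move=> e /srcs[|]; last by right; left.
  by rewrite inE => /orP[/eqP|]; [right; right|left].
have [Bv|nBv] := pselect (sval B v); last first.
  by rewrite pdiff0 ?affine0 // => u [/= -> /nBv].
have [Uv|nUv] := pselect (sval U v).
  by rewrite pdiff0 ?affine0 // => u [/= -> _].
rewrite pdiff_gv1 //; apply: affine_vertex => // [xi xv|e er ev'].
  apply: val0; first exact/(ev_gv1 B xv).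
  by apply/negP => /(ev_gv1 U xv).
have := van e er c (gvr e) (gv0 G).
rewrite /pdiff (leavitt_p0 _ (A := gvI (gvr e) (gv0 G))) ?subr0 /= ?setI0 //.
apply=> ze zee _; rewrite -dval_up //; have ue := up_dom zee.
have uv : ev (up e ze) (es [::] [set v]).
  exact: (ev_src ue (bset_gv (gvset1 v))).2 ev'.
apply: val0; first exact/(ev_gv1 B uv).
by apply/negP => /(ev_gv1 U uv).
Qed.

(** The diagonal is faithfully represented by functions on the tight spectrum.
    The induction is on the length of the words: [vanish_cons] shortens them
    all at once. *)
Lemma diag_inj r : diag_vanish r.
Proof.
have [n] : exists n, all (fun m => size m.2.1 <= n)%N r.
  elim: r => [|m r [n IH]]; first by exists 0%N.
  exists (maxn (size m.2.1) n); rewrite /= leq_maxl; apply: sub_all IH => m' le.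
  by rewrite (leq_trans le) // leq_maxr.
pose isnil (m : R * (path * gvtype G)) := m.2.1 == [::].
(* An empty word contributes a multiple of some [p_A], treated separately. *)
have step r' : diag_vanish [seq m <- r' | ~~ isnil m] -> diag_vanish r'.
  move=> van2.
  have split_dsum : dsum r' = dsum ([seq m <- r' | isnil m] ++ [seq m <- r' | ~~ isnil m]).
    by rewrite /dsum big_cat !big_filter [LHS](bigID (fun m => isnil m)).
  have split_dval xi : dval r' xi =
      dval ([seq m <- r' | isnil m] ++ [seq m <- r' | ~~ isnil m]) xi.
    by rewrite /dval big_cat !big_filter [LHS](bigID (fun m => isnil m)).
  suff van : diag_vanish ([seq m <- r' | isnil m] ++ [seq m <- r' | ~~ isnil m]).
    move=> c B U val0; rewrite split_dsum; apply: van => xi xB xU.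
    by rewrite -split_dval; exact: val0.
  elim: {split_dsum split_dval} r' [seq m <- r' | ~~ isnil m] van2 => //=.
  move=> [a [[|e ga] A]] r' IH r2 van2; rewrite /isnil /=; last exact: IH.
  exact/vanish_nil/IH.
elim: n r => [|n IHn] r szr; apply: step.
  apply: vanish_cons => [|e]; first exact: filter_all.
  by rewrite /heads; elim: r szr => //= -[a [[|//] A]] r IH /IH.
apply: vanish_cons => [|e _]; first exact: filter_all.
apply: IHn; rewrite /tails all_map all_filter.
elim: r szr => //= -[a [[|f ga] A]] r IH /=; first by move=> /IH.
by move=> /andP[le /IH ->]; rewrite andbT; apply/implyP.
Qed.

End Diagonal.

(** * Injectivity *)

Section Injectivity.
Variables (R : comPzRingType) (G : ultragraph).
Local Notation L := (leavitt R G).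
Local Notation p := (leavitt_p R).
Local Notation s := (leavitt_s R).
Local Notation ss := (leavitt_ss R).
Local Notation path := (seq (edge G)).
Implicit Types (A B C U : gvtype G) (al be ga : path) (e f : edge G) (x y : L).
Implicit Types (xi eta ze : tight G) (c : R).

Lemma lmul_nonpath al x : ~~ is_path al -> lmul_path al x = 0.
Proof.
elim: al => [//|e [//|f al] IH].
have -> : is_path [:: e, f & al] = (src f \in rng e) && is_path (f :: al) by [].
rewrite negb_and => /orP[ef|/IH E]; last first.
  by rewrite -[LHS]/(numul (s e) (lmul_path (f :: al) x)) E numulx0.
rewrite /= -leavitt_s_rng -numulA (numulA (p _)) leavitt_p_s.
case: asboolP => [fe|_]; last by rewrite numul0x numulx0.
by rewrite mem_set in ef.
Qed.

Lemma rmul_nonpath al x : ~~ is_path al -> rmul_path al x = 0.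
Proof.
elim: al => [//|e [//|f al] IH].
have -> : is_path [:: e, f & al] = (src f \in rng e) && is_path (f :: al) by [].
rewrite negb_and => /orP[ef|/IH E]; last first.
  by rewrite -[LHS]/(numul (rmul_path (f :: al) x) (ss e)) E numul0x.
rewrite /= -(leavitt_rng_ss R e) numulA -(numulA _ (ss f)) leavitt_ss_p.
case: asboolP => [fe|_]; last by rewrite numulx0 numul0x.
by rewrite mem_set in ef.
Qed.

(** [A] cut down to the range of a word; it stays in [G^0] even for the empty
    word, whose range may not belong to it. *)
Lemma gv_cut_subproof A al : gvset (sval A `&` prange al).
Proof.
case: al => [|e al] /=; first by rewrite setIT; apply: svalP.
exact/gvsetI/gvset_rng/svalP.
Qed.

Definition gv_cut A al : gvtype G := exist _ _ (gv_cut_subproof A al).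

(** Since [s_al = s_al p_(r(al))], sets next to [s_al] may be cut down to the range. *)
Lemma lmul_cut al A x :
  lmul_path al (numul (p A) x) = lmul_path al (numul (p (gv_cut A al)) x).
Proof.
elim: al => [|e al IH]; first by rewrite /= (@leavitt_p_ext _ _ (gv_cut A [::]) A) //= setIT.
case: al IH => [_|f al IH]; last first.
  by rewrite -[LHS]/(numul (s e) (lmul_path (f :: al) (numul (p A) x))) IH
    (@leavitt_p_ext _ _ (gv_cut A [:: e, f & al]) (gv_cut A (f :: al))).
rewrite /= !numulA; congr numul.
rewrite -leavitt_s_rng -!numulA !leavitt_pI; congr numul; apply: leavitt_p_ext => /=.
by apply/seteqP; split=> v /=; tauto.
Qed.

Lemma rmul_cut al A x :
  rmul_path al (numul x (p A)) = rmul_path al (numul x (p (gv_cut A al))).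
Proof.
elim: al => [|e al IH]; first by rewrite /= (@leavitt_p_ext _ _ (gv_cut A [::]) A) //= setIT.
case: al IH => [_|f al IH]; last first.
  by rewrite -[LHS]/(numul (rmul_path (f :: al) (numul x (p A))) (ss e)) IH
    (@leavitt_p_ext _ _ (gv_cut A [:: e, f & al]) (gv_cut A (f :: al))).
rewrite /= -!numulA; congr numul.
rewrite -leavitt_rng_ss !numulA !leavitt_pI; congr numul; apply: leavitt_p_ext => /=.
by apply/seteqP; split=> v /=; tauto.
Qed.

Lemma dsum_local_unit r : exists B, numul (p B) (dsum r) = dsum r :> L.
Proof.
elim: r => [|[a [ga A]] r [B IH]].
  by exists (gv0 G); rewrite /dsum big_nil numulx0.
pose C := if ga is e :: _ then gv1 (src e) else A.
exists (gvU B C); rewrite dsum_cons numulDr numulZr /=; congr (_ *: _ + _).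
  rewrite /C; case: ga {C} => [|e ga].
    by rewrite dmon_nil leavitt_pC leavitt_pI_sub // => v; right.
  by rewrite p_dmon_cons; case: asboolP => // -[]; right.
rewrite -IH numulA; congr numul.
by rewrite leavitt_pC leavitt_pI_sub // => v; left.
Qed.

Definition shift_mon al be (m : R * (path * gvtype G)) :
    R * (path * gvtype G * path) :=
  (m.1, (al ++ m.2.1, m.2.2, be ++ m.2.1)).

Lemma lincomb_shift al be r :
  lincomb [seq shift_mon al be m | m <- r] = lmul_path al (rmul_path be (dsum r)).
Proof.
rewrite /lincomb big_map; elim: r => [|m r IH].
  by rewrite big_nil /dsum big_nil rmul_path0 lmul_path0.
rewrite big_cons IH dsum_cons rmul_pathD lmul_pathD rmul_pathZ lmul_pathZ.
congr (_ *: _ + _); rewrite /dmon /mon /= lmul_path_cat rmul_path_cat.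
by congr lmul_path; apply: lmul_rmul.
Qed.

Lemma shift_mon_val al be m ze : is_path al -> is_path be ->
  (forall ga, ga = al \/ ga = be -> ga <> [::] -> ev ze (es [::] (prange ga))) ->
  kap (mon R (shift_mon al be m).2) ((deg al * (deg be)^-1)%g, ups al ze) =
  if ev ze (es m.2.1 (sval m.2.2 `&` prange m.2.1)) then 1 else 0.
Proof.
move=> pa pb zab; case: m => a [ga A]; rewrite /shift_mon /= kap_mon.
have pra : prependable al ze by split=> //; apply: zab; left.
have prb : prependable be ze by split=> //; apply: zab; right.
rewrite !deg_cat invgM -!mulgA (mulgA (deg ga)) mulgV mul1g eqxx /=.
rewrite ev_ups_cat //; last exact: mon_set_bset.
have bA := gv_bset A.
have -> // : is_path (be ++ ga) && ev ze (es ga (mon_set A (be ++ ga) `&` prange ga)) =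
  ev ze (es ga (sval A `&` prange ga)).
rewrite /mon_set; case: ga => [|e ga].
  rewrite cats0 pb /= !setIT; apply/idP/idP => [zA|zA].
    by apply: (ev_up0 zA) => // v [].
  have [b0|b0] := eqVneq be [::]; first by rewrite b0 /= setIT.
  apply: ev_meet => //; apply: zab; first by right.
  by apply/eqP.
rewrite prange_cat -setIA setIid; case zA : (ev ze _); last by rewrite andbF.
rewrite andbT is_path_cat pb /=.
have [/= -> _ _ _] := ev_valid zA; rewrite andbT.
case b0 : be => [|b be']; apply: mem_set => //; rewrite -b0.
have pbe : ev ze (es [::] (prange be)) by apply: zab; [right|rewrite b0].
by apply/(ev_src zA) => //; rewrite b0; exact/bset_gv/gvset_rng.
Qed.

(** A combination of monomials of a single degree is [s_al y s_be^*] with [y] in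
    the diagonal, and its transform on [V_t] is that of [y] moved by the partial
    map; so the homogeneous case reduces to [diag_inj]. *)
Lemma homogeneous_inj al be r :
  (forall g, kap (lincomb [seq shift_mon al be m | m <- r]) g = 0) ->
  lincomb [seq shift_mon al be m | m <- r] = 0.
Proof.
move=> kap0r; rewrite lincomb_shift.
have [pa|npa] := boolP (is_path al); last by rewrite lmul_nonpath.
have [pb|npb] := boolP (is_path be); last by rewrite rmul_nonpath // lmul_path0.
have [B BE] := dsum_local_unit r; rewrite -BE lmul_rmul lmul_cut -lmul_rmul.
rewrite p_dsumC rmul_cut -p_dsumC.
set C := gv_cut (gv_cut B al) be.
suff -> : numul (p C) (dsum r) = 0 by rewrite rmul_path0 lmul_path0.
have := @diag_inj _ _ r 0 C (gv0 G).
rewrite /affine scale0r add0r /pdiff (leavitt_p0 _ (A := gvI C (gv0 G))) ?subr0 /= ?setI0 //.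
apply=> ze zC _; rewrite add0r.
have := kap0r ((deg al * (deg be)^-1)%g, ups al ze).
rewrite kap_lincomb big_map => <-; apply: eq_bigr => m _.
rewrite shift_mon_val //.
  by case: ifP => _; rewrite ?mulr1 ?mulr0.
move=> ga E ga0; apply: (ev_up0 zC); last exact: bset_prange.
by case: E => -> v [[]].
Qed.

Lemma homogeneous_shift r (t : freeGroup (edge G)) : all (fun m => mon_deg m.2 == t) r ->
  exists al be r', r = [seq shift_mon al be m | m <- r'].
Proof.
case: r => [|m0 r] rt; first by exists [::], [::], [::].
have [/eqP m0t _] := andP rt.
have [al [be [_ [_ _ degE wordE]]]] := deg_reduced m0.2.1.1 m0.2.2.
have tw : fgword t = pos al ++ neg be by rewrite -m0t /mon_deg degE.
exists al, be; elim: (m0 :: r) rt => [|[a [[al1 A] be1]] {m0 m0t degE wordE}r IH] /=.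
  by exists [::].
move=> /andP[/eqP mt /IH[r' ->]].
have [al2 [be2 [ga [E1 E2 dE wE]]]] := deg_reduced al1 be1.
have [Ea Eb] : al2 = al /\ be2 = be.
  by apply: pos_neg_inj; rewrite -wE -tw -mt /mon_deg dE.
by exists ((a, (ga, A)) :: r'); rewrite /= /shift_mon /= -Ea -Eb -E1 -E2.
Qed.

(** Split [x] by degree: [kap] separates the degrees. *)
Lemma kap_inj x : (forall g, kap x g = 0) -> x = 0.
Proof.
have [r ->] := leavitt_spanned x.
have [n] := ubnP (size r); elim: n r => // n IH [|m0 r] szr kap0r.
  by rewrite /lincomb big_nil.
pose t := mon_deg m0.2; set r0 := m0 :: r in kap0r *.
pose isdeg (m : R * (path * gvtype G * path)) := mon_deg m.2 == t.
have splitr :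
    lincomb r0 = lincomb [seq m <- r0 | isdeg m] + lincomb [seq m <- r0 | ~~ isdeg m].
  by rewrite /lincomb !big_filter [LHS](bigID (fun m => isdeg m)).
have off1 u xi : u != t -> kap (lincomb [seq m <- r0 | isdeg m]) (u, xi) = 0.
  move=> ut; rewrite kap_lincomb big_filter big1 // => m /eqP mt.
  by rewrite kap_mon_deg ?mulr0 // mt.
have off2 xi : kap (lincomb [seq m <- r0 | ~~ isdeg m]) (t, xi) = 0.
  rewrite kap_lincomb big_filter big1 // => m mt.
  by rewrite kap_mon_deg ?mulr0 // eq_sym.
have kap1 g : kap (lincomb [seq m <- r0 | isdeg m]) g = 0.
  case: g => u xi; have [->|ut] := eqVneq u t; last exact: off1.
  by have := kap0r (t, xi); rewrite splitr kapD off2 addr0.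
have z1 : lincomb [seq m <- r0 | isdeg m] = 0.
  have [|al [be [r' rE]]] := @homogeneous_shift [seq m <- r0 | isdeg m] t.
    exact: filter_all.
  by rewrite rE in kap1 *; apply: homogeneous_inj.
rewrite splitr z1 add0r; apply: IH.
  rewrite /r0 /= /isdeg eqxx /= size_filter.
  have szr' : (size r < n)%N by []. exact: leq_ltn_trans (count_size _ _) szr'.
by move=> g; have := kap0r g; rewrite splitr z1 add0r.
Qed.

Lemma kapr_inj x : (forall g : transf G, kapr x g = 0) -> x = 0.
Proof.
move=> kr; apply: kap_inj => -[t xi].
have [/transf_mk[g gE]|nd] := pselect (pa_dom t xi); last exact: kap_supp.
by have := kr g; rewrite /kapr gE.
Qed.

End Injectivity.

(** * Surjectivity *)

Section Surjectivity.
Variables (R : comPzRingType) (G : ultragraph).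
Local Notation L := (leavitt R G).
Local Notation FG := (freeGroup (edge G)).
Local Notation X := (FG * tight G)%type.
Implicit Types (A B : set (vertex G)) (al be ga : seq (edge G)) (e f : edge G).
Implicit Types (xi eta ze : tight G) (x y : L) (t : FG) (g : X) (k : transf G).
Implicit Types (U : tight G -> bool).

Lemma idempotent0 A : bset A -> exists q : L,
  lam q = partial_shift R (fun g : X => ev g.2 (es [::] A)) id.
Proof.
elim=> {A} [A gA|A B bA [qA EA] bB [qB EB]|A B bA [qA EA] bB [qB EB]|
    A B bA [qA EA] bB [qB EB]].
- by exists (leavitt_p R (exist _ A gA)); rewrite lam_p.
- exists (qA - numul qA qB); rewrite lamD -scaleN1r lamZ lamM EA EB partial_shiftM scaleN1r.
  apply: linopE => h; apply/funext => g.
  rewrite -[LHS]/(partial_shift R _ _ h g - partial_shift R _ _ h g : R) !partial_shiftE /=.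
  rewrite ev_setD //; case: (ev g.2 (es [::] A)); case: (ev g.2 (es [::] B)) => /=;
  by rewrite ?subrr ?subr0.
- exists (qA + qB - numul qA qB).
  rewrite lamD -scaleN1r lamZ lamD lamM EA EB partial_shiftM scaleN1r.
  apply: linopE => h; apply/funext => g.
  rewrite -[LHS]/(partial_shift R _ _ h g + partial_shift R _ _ h g
    - partial_shift R _ _ h g : R) !partial_shiftE /=.
  rewrite ev_setU //; case: (ev g.2 (es [::] A)); case: (ev g.2 (es [::] B)) => /=;
  by rewrite ?subr0 ?addr0 ?add0r ?addrK.
- exists (numul qA qB); rewrite lamM EA EB partial_shiftM.
  by apply: eq_partial_shift => // g; rewrite ev_setI.
Qed.

(** The algebra [L] contains the idempotent of each element of [E(S)], also for
    the sets that are only in the Boolean closure of [G^0]. *)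
Lemma idempotent (z : ES G) : exists q : L,
  lam q = partial_shift R (fun g : X => ev g.2 z) id.
Proof.
case: (esP z) => [|al A [/= _ bA _ /setIidPl sA]].
  by exists 0; rewrite lam0 partial_shift0 // => g; rewrite ev_None.
rewrite -sA {sA}; have [q0 E0] := idempotent0 bA.
elim: al => [|e al [q E]]; first by exists q0; rewrite /= setIT.
exists (numul (numul (leavitt_s R e) q) (leavitt_ss R e)).
rewrite !lamM E lam_s lam_ss !partial_shiftM; apply: eq_partial_shift => -[t xi].
  have /= -> := ev_cons xi e al bA.
  by case xe : (ev xi _) => //=; rewrite down_dom // andbT.
by move=> /= /andP[/andP[xe _] _]; rewrite downK // mulgA mulgV mul1g.
Qed.

Definition cutting U : Prop := forall y, exists y' : L, forall t xi,
  kap y' (t, xi) = if U xi then kap y (t, xi) else 0.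

Lemma cutting_ev z : cutting (fun xi => ev xi z).
Proof.
move=> y; have [q E] := idempotent z; exists (numul q y) => t xi.
by rewrite kapM E partial_shiftE.
Qed.

Lemma cuttingN U : cutting U -> cutting (fun xi => ~~ U xi).
Proof.
move=> cU y; have [y' E] := cU y; exists (y - y') => t xi.
by rewrite -scaleN1r kapD kapZ mulN1r E; case: (U xi); rewrite ?subrr ?subr0.
Qed.

Lemma cuttingI U U' : cutting U -> cutting U' -> cutting (fun xi => U xi && U' xi).
Proof.
move=> cU cU' y; have [y' E] := cU y; have [y'' E'] := cU' y'; exists y'' => t xi.
by rewrite E' E andbC; case: (U' xi).
Qed.

Lemma cutting_agree l xi : cutting (fun eta => agree l (ev xi) (ev eta)).
Proof.
elim: l => [|z l IH]; first by move=> y; exists y.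
apply: (@cuttingI (fun eta => ev xi z == ev eta z)) IH; case: (ev xi z) => y.
  have [y' E] := cutting_ev z y; exists y' => t eta.
  by rewrite E; case: (ev eta z).
have [y' E] := cuttingN (cutting_ev z) y; exists y' => t eta.
by rewrite E; case: (ev eta z).
Qed.

(** [W = (t, U)] stands for the subset [{t} x U] of the groupoid. *)
Definition covers (W : FG * (tight G -> bool)) g : bool := (g.1 == W.1) && W.2 g.2.

Definition in_image (W : FG * (tight G -> bool)) : Prop :=
  exists y : L, forall g, kap y g = if covers W g then 1 else 0.

Lemma in_image_cut t U U' : in_image (t, U) -> cutting U' ->
  in_image (t, fun xi => U xi && U' xi).
Proof.
move=> [y E] cU'; have [y' E'] := cU' y; exists y' => -[u xi].
by rewrite E' E /covers /= andbA; case: (U' xi); rewrite ?andbT ?andbF.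
Qed.

(** If [t] is not the identity, the neighborhood is all of [V_t], whose indicator
    is the transform of a monomial. The unit space need not be compact, so for
    the identity any [z] in the filter is taken. *)
Lemma nbhs_in_image t xi : pa_dom t xi ->
  exists z, ev xi z /\ in_image (t, fun eta => ev eta z).
Proof.
have [-> _|t1 [tE|[al [be [_ rt Vxi]]]]] := eqVneq t 1%g.
- have [[[_ [z xz]] _ _ _ _] _] := evP xi; exists z; split=> //.
  have [q E] := idempotent z; exists q => -[u eta].
  rewrite /kap E partial_shiftE /unit_delta /covers /=.
  by case: (ev eta z); rewrite ?andbT ?andbF.
- by case/eqP: t1.
exists (es al (prange al `&` prange be)); split=> //.
have [pa pb _ wE] := rt.
have [A AE] : exists A : gvtype G, mon_set A be `&` prange al = prange al `&` prange be.
  case: be {rt Vxi pb} wE => [|b be] wE; last first.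
    exists (gvr (last b be)); rewrite /mon_set /=.
    by rewrite setIid setIC.
  case: al {pa} wE => [|a al] wE; first by case/eqP: t1; apply: val_inj.
  exists (gvr (last a al)); rewrite /mon_set /=.
  by rewrite !setIT setIid.
exists (mon R (al, A, be)) => -[u eta]; rewrite kap_mon AE pb /covers /=.
suff -> : (deg al * (deg be)^-1)%g = t by [].
apply: val_inj; rewrite [RHS]wE [LHS]fgwordM fgword_deg fgword_degV.
by apply: wmul_cat; have := reducedP t; rewrite wE.
Qed.

Section LocallyConstant.
Variable f : transf G -> R.

Definition good (W : FG * (tight G -> bool)) : Prop :=
  [/\ in_image W, cutting W.2 & exists c, forall k, covers W (set_val k) -> f k = c].

Lemma good_nbhs k : locally_constant f ->
  exists W, [/\ good W, covers W (set_val k) &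
    \forall k' \near k, covers W (set_val k')].
Proof.
move=> lf; have /transf_nbhsP[l fl] := lf k.
have [z [xz imz]] := nbhs_in_image (transf_dom k).
pose U eta := ev eta z && agree l (ev (tr_range k)) (ev eta).
exists (tr_grp k, U); split.
- split; first exact: in_image_cut imz (@cutting_agree l _).
    exact: cuttingI (@cutting_ev z) (@cutting_agree l _).
  by exists (f k) => k'; rewrite set_valE => /andP[/eqP kk /andP[_ ag]]; exact: fl.
- by rewrite set_valE /covers /= eqxx /U xz agree_refl.
apply/transf_nbhsP; exists (z :: l) => k' kk /= /andP[/eqP zz ag].
by rewrite set_valE /covers /= kk eqxx /U -zz xz.
Qed.

(** The pieces are made disjoint by cutting each one with the complements of the
    later ones of the same degree. *)
Lemma sum_on_cover (l : seq {W | good W}) : exists y : L, forall k,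
  kapr y k = if has (fun W => covers (sval W) (set_val k)) l then f k else 0.
Proof.
elim: l => [|[[t U] [im cU [c fc]]] l [y yE]] /=.
  by exists 0 => k; rewrite /kapr kap0.
have [z zE] : in_image (t, fun xi => U xi && ~~ has (fun W => covers (sval W) (t, xi)) l).
  elim: l {y yE} => [|[[t' U'] [_ /= cU' _]] l IH] /=.
    have [z E] := im; exists z => g; rewrite E /covers /=.
    by rewrite andbT.
  have [tt|tt] := eqVneq t t'; last first.
    have [z E] := IH; exists z => g; rewrite E /covers /=.
    by rewrite (negPf tt).
  have [z E] := in_image_cut IH (cuttingN cU'); exists z => g.
  rewrite E /covers /= tt eqxx /= negb_or -!andbA.
  by congr (if [&& _, _ & _] then _ else _); rewrite andbC.
exists (y + c *: z) => k; rewrite /kapr kapD kapZ -/(kapr y k) yE.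
set H := has _ l; have -> : kap z (set_val k) =
    if covers (t, U) (set_val k) && ~~ H then 1 else 0.
  have cE V : covers (t, V) (set_val k) = ((set_val k).1 == t) && V (set_val k).2 by [].
  rewrite zE !cE; case: eqP => // kt; rewrite !andTb.
  have -> : (t, (set_val k).2) = set_val k by rewrite -kt -surjective_pairing.
  by [].
case cU' : (covers (t, U) _); case: H; rewrite ?mulr0 ?mulr1 ?addr0 ?add0r //=.
exact/esym/fc.
Qed.

Lemma compact_good_cover (K : set (transf G)) : locally_constant f -> compact K ->
  exists l : seq {W | good W},
    forall k, K k -> has (fun W => covers (sval W) (set_val k)) l.
Proof.
move=> lf /compact_near_coveringP /(_ (seq {W | good W})).
(* Finite families ordered by inclusion, of which containing an infix is a proxy. *)
pose F : set_system (seq {W | good W}) :=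
  [set S | exists l0, forall l l', S (l ++ l0 ++ l')].
have FF : Filter F.
  split; first by exists [::].
    move=> S T [l1 S1] [l2 T2]; exists (l1 ++ l2) => l l'; split.
      by rewrite -catA; apply: S1.
    by rewrite -catA catA; apply: T2.
  by move=> S T ST [l0 S0]; exists l0 => l l'; apply/ST/S0.
move=> /(_ F (fun l k => has (fun W => covers (sval W) (set_val k)) l) FF) [].
  move=> k _; have [W [gW Wk nW]] := good_nbhs k lf.
  exists ([set k' | covers W (set_val k')],
      [set l | exists l1 l2, l = l1 ++ (exist _ W gW) :: l2]).
    by split=> //=; exists [:: exist _ W gW] => l l'; exists l, l'.
  by move=> [k' _] [/= Wk' [l1 [l2 ->]]]; rewrite has_cat /= Wk' orbT.
by move=> l0 /(_ [::] [::]); rewrite cats0; exists l0.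
Qed.

End LocallyConstant.

Lemma kapr_surj (f : transf G -> R^o) : f \in @steinberg_pred R (transf G) ->
  exists y : L, kapr y = f.
Proof.
move=> /asboolP[lf cf]; have [l lK] := compact_good_cover lf cf.
have [y yE] := sum_on_cover l; exists y; apply/funext => k; rewrite yE.
case: ifP => // H; apply/esym/eqP/negPn/negP => fk.
by have := lK k fk; rewrite H.
Qed.

End Surjectivity.

(** * The isomorphism *)

Theorem theorem5p5 (R : comPzRingType) (G : ultragraph) :
  exists kappa : {linear leavitt R G -> steinberg R (transf G)},
    [/\ bijective kappa,
        forall x y : leavitt R G,
          kappa (numul x y) = convolution (@tr_mul G) (kappa x) (kappa y)
            :> (transf G -> R),
        forall A : gvtype G,
          kappa (leavitt_p R A) = \1_(slice 1%g (es [::] (sval A)))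
            :> (transf G -> R),
        forall e : edge G,
          kappa (leavitt_s R e) = \1_(slice (fggen e) (es [:: e] (rng e)))
            :> (transf G -> R)
      & forall e : edge G,
          kappa (leavitt_ss R e) =
            \1_(slice (fggen e)^-1%g (es [::] (rng e)))
            :> (transf G -> R)].
Proof.
pose kappa : {linear leavitt R G -> steinberg R (transf G)} := @kappa_fun R G.
have kappaE x : kappa x = kapr x :> (transf G -> R) by [].
have kappa_inj : injective kappa.
  move=> x y xy; apply/eqP; rewrite -subr_eq0; apply/eqP/kapr_inj => g.
  rewrite /kapr -scaleN1r kapD kapZ mulN1r; apply/eqP; rewrite subr_eq0; apply/eqP.
  by have := congr1 (fun h : steinberg R (transf G) => (h : transf G -> R) g) xy.
exists kappa; split.
- have /choice[inv invE] : forall f : steinberg R (transf G), exists x, kappa x = f.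
    move=> f; have [x xE] := kapr_surj (valP f).
    by exists x; apply: val_inj.
  exists inv => // x; apply: kappa_inj; exact: invE.
- by move=> x y; apply/funext => k; rewrite !kappaE kappa_convolution.
- move=> A; rewrite kappaE -[leavitt_p R A]/(mon R ([::], A, [::])) kapr_mon //.
  by rewrite /mon_set /= !setIT invg1 mulg1.
- move=> e; rewrite kappaE -leavitt_s_rng.
  rewrite -[numul _ _]/(mon R ([:: e], gvr e, [::])) kapr_mon //.
  by rewrite /mon_set /= setIT setIid invg1 !mulg1.
- move=> e; rewrite kappaE -leavitt_rng_ss.
  rewrite -[numul _ _]/(mon R ([::], gvr e, [:: e])) kapr_mon //.
  by rewrite /mon_set /= setIid setIT mul1g mulg1.
Qed.
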